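(* Let $\mathcal G$ be a compact metric graph, $N\ge1$ an integer, and $p\in\left(2,2+\frac4{N+1}\right]$. Then there exists a critical mass $\mu_2=\mu_2(\mathbb R^N\times\mathcal G,p)>0$ such that, for every $\mu>0$ for which a ground state of mass $\mu$ of $E_p(\cdot,\mathbb R^N\times\mathcal G)$ exists and for every such ground state $u_\mu$, $$\mu<\mu_2\ \Longrightarrow\ \partial_yu_\mu\equiv0,\qquad\qquad \mu>\mu_2\ \Longrightarrow\ \partial_yu_\mu\not\equiv0.$$
   Context: A compact metric graph $\mathcal G$ is a connected graph with finitely many edges (edge set $\mathfrak E$) and vertices, each edge $e$ being identified with an interval $[0,\ell_e]$, $0<\ell_e<\infty$, whose endpoints are glued at vertices (self-loops and multiple edges allowed). All functions are real-valued. A function $u$ on $\mathbb R^N\times\mathcal G$ (variables $x\in\mathbb R^N$, $y\in\mathcal G$) is a family $\{u_e\}_{e\in\mathfrak E}$, $u_e$ defined on $\mathbb R^N\times e\subset\mathbb R^{N+1}$; $\|u\|_p^p=\sum_e\|u_e\|^p_{L^p(\mathbb R^N\times e)}$. $H^1(\mathbb R^N\times\mathcal G)$ is the set of $u$ with $u_e\in H^1(\mathbb R^N\times e)$ for every $e$, $\sum_e\|u_e\|_{H^1}^2<\infty$, and such that for any two edges meeting at a vertex $v$ the traces of the corresponding functions on $\mathbb R^N\times\{v\}$ coincide in $L^2(\mathbb R^N)$. $E_p(u,\mathbb R^N\times\mathcal G)=\frac12\|\nabla_xu\|_2^2+\frac12\|\partial_yu\|_2^2-\frac1p\|u\|_p^p$;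 $H^1_\mu(\mathbb R^N\times\mathcal G)=\{u\in H^1(\mathbb R^N\times\mathcal G):\|u\|_2^2=\mu\}$. A ground state of mass $\mu$ is a minimizer of $E_p(\cdot,\mathbb R^N\times\mathcal G)$ on $H^1_\mu(\mathbb R^N\times\mathcal G)$. *)

(* Defs.v *)
From HB Require Import structures.
From mathcomp Require Import all_boot all_order all_algebra.
From mathcomp Require Import all_classical all_reals all_analysis.

Set Implicit Arguments.
Unset Strict Implicit.
Unset Printing Implicit Defensive.

Import Order.TTheory GRing.Theory Num.Theory.
Import numFieldNormedType.Exports.

Local Open Scope classical_set_scope.
Local Open Scope ring_scope.

Section measurable_rV.
Context {R : realType} (n : nat).

Let coord (i : 'I_n) (x : 'rV[R]_n) : R := x ord0 i.

Let rV_set0 : g_sigma_preimage coord set0.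
Proof. exact: sigma_algebra0. Qed.

Let rV_setC A : g_sigma_preimage coord A -> g_sigma_preimage coord (~` A).
Proof. exact: sigma_algebraC. Qed.

Let rV_bigcup (F : (set 'rV[R]_n)^nat) :
  (forall i, g_sigma_preimage coord (F i)) ->
  g_sigma_preimage coord (\bigcup_i (F i)).
Proof. exact: sigma_algebra_bigcup. Qed.

HB.instance Definition _ := @isMeasurable.Build default_measure_display
  'rV[R]_n (g_sigma_preimage coord) rV_set0 rV_setC rV_bigcup.

Lemma measurable_coord (i : 'I_n) :
  measurable_fun [set: 'rV[R]_n] (fun x : 'rV[R]_n => x ord0 i).
Proof.
move=> _ Y mY; rewrite setTI; apply: sub_sigma_algebra => /=.
rewrite -bigcup_seq/=; exists i => /=; first by rewrite mem_index_enum.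
by exists Y => //; rewrite setTI.
Qed.

Lemma measurable_fun_rV d (T : measurableType d) (f : T -> 'rV[R]_n) :
  (forall i, measurable_fun [set: T] (fun x => f x ord0 i)) ->
  measurable_fun [set: T] f.
Proof.
move=> mf.
have pre : preimage_set_system setT f (g_sigma_preimage coord) `<=` measurable.
  rewrite -g_sigma_preimage_comp; apply: smallest_sub.
    exact: sigma_algebra_measurable.
  by rewrite -bigcup_seq => A [i _ [B mB <-]]; exact: mf.
by move=> _ A mA; apply: pre; exists A.
Qed.

End measurable_rV.

Section lebesgue_rV.
Context {R : realType}.

Definition consrV n (z : R * 'rV[R]_n) : 'rV[R]_n.+1 :=
  \row_i (if unlift ord0 i is Some j then z.2 ord0 j else z.1).

Definition unconsrV n (x : 'rV[R]_n.+1) : R * 'rV[R]_n :=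
  (x ord0 ord0, \row_j x ord0 (lift ord0 j)).

Lemma consrVK n : cancel (@consrV n) (@unconsrV n).
Proof.
case=> a v; rewrite /unconsrV /consrV /= mxE unlift_none; congr pair.
by apply/rowP => j; rewrite !mxE liftK.
Qed.

Lemma measurable_consrV n : measurable_fun setT (@consrV n).
Proof.
apply: measurable_fun_rV => i; rewrite /consrV.
case: (unliftP ord0 i) => [j|] ->.
- rewrite (_ : (fun _ => _) = (fun x : 'rV[R]_n => x ord0 j) \o snd).
    by apply: measurableT_comp => //; exact: measurable_coord.
  by apply/funext => z; rewrite mxE liftK.
- rewrite (_ : (fun _ => _) = fst); first exact: measurable_fst.
  by apply/funext => z; rewrite mxE unlift_none.
Qed.

Lemma measurable_unconsrV n : measurable_fun setT (@unconsrV n).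
Proof.
apply/measurable_fun_pairP; split; first exact: measurable_coord.
apply: measurable_fun_rV => i.
rewrite (_ : (fun _ => _) = (fun x : 'rV[R]_n.+1 => x ord0 (lift ord0 i))).
  exact: measurable_coord.
by apply/funext => x /=; rewrite mxE.
Qed.

Section succ.
Context n (m : {sigma_finite_measure set 'rV[R]_n -> \bar R}).

Definition lebesgue_rV_succ : set 'rV[R]_n.+1 -> \bar R :=
  pushforward (lebesgue_measure \x m)%E (@consrV n).

Let succ0 : lebesgue_rV_succ set0 = 0%E.
Proof. by rewrite /lebesgue_rV_succ /pushforward preimage_set0 measure0. Qed.

Let succ_ge0 A : (0 <= lebesgue_rV_succ A)%E.
Proof. by rewrite /lebesgue_rV_succ /pushforward measure_ge0. Qed.

Let succ_sigma_additive : semi_sigma_additive lebesgue_rV_succ.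
Proof.
have mpre A : measurable A -> measurable (@consrV n @^-1` A).
  by move=> mA; rewrite -[X in measurable X]setTI; exact: measurable_consrV.
move=> F mF tF mUF; rewrite /lebesgue_rV_succ /pushforward preimage_bigcup.
apply: measure_semi_sigma_additive; first by move=> k; exact: mpre.
- apply/trivIsetP => i j _ _ ij; rewrite -preimage_setI.
  by move/trivIsetP : tF => /(_ _ _ _ _ ij) ->//; rewrite preimage_set0.
- by rewrite -preimage_bigcup; exact: mpre.
Qed.

HB.instance Definition _ := isMeasure.Build _ _ _ lebesgue_rV_succ
  succ0 succ_ge0 succ_sigma_additive.

Let succ_sigma_finite : sigma_finite setT lebesgue_rV_succ.
Proof.
have /sigma_finiteP[F [TF ndF Foo]] := sigma_finiteT (@lebesgue_measure R).
have /sigma_finiteP[G [TG ndG Goo]] := sigma_finiteT m.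
exists (fun k => @unconsrV n @^-1` (F k `*` G k)).
  rewrite -preimage_bigcup (_ : \bigcup_k _ = setT) ?preimage_setT//.
  rewrite -subTset => -[x y] _.
  have [k _ Fkx] : (\bigcup_k F k) x by rewrite -TF.
  have [l _ Gly] : (\bigcup_k G k) y by rewrite -TG.
  exists (maxn k l) => //; split => /=.
  - by move: x Fkx; exact/subsetPset/ndF/leq_maxl.
  - by move: y Gly; exact/subsetPset/ndG/leq_maxr.
move=> k; have [mF Fkoo] := Foo k; have [mG Gkoo] := Goo k; split.
  rewrite -[X in measurable X]setTI.
  by apply: measurable_unconsrV => //; exact: measurableX.
rewrite /lebesgue_rV_succ /pushforward -comp_preimage.
rewrite (_ : _ \o _ = id); last by apply/funext => z /=; rewrite consrVK.
by rewrite preimage_id product_measure1E// lte_mul_pinfty// ge0_fin_numE.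
Qed.

HB.instance Definition _ := Measure_isSigmaFinite.Build _ _ _ lebesgue_rV_succ
  succ_sigma_finite.

End succ.

Fixpoint lebesgue_rV n : {sigma_finite_measure set 'rV[R]_n -> \bar R} :=
  if n is k.+1 then lebesgue_rV_succ (lebesgue_rV k) else \d_(0 : 'rV[R]_0).

End lebesgue_rV.

Section lebesgue_itv.
Context {R : realType}.

Definition lebesgue_itv (l : R) : set (measurableTypeR R) -> \bar R :=
  mrestr lebesgue_measure (measurable_itv `]0, l[).

HB.instance Definition _ (l : R) := Measure.on (lebesgue_itv l).

Let lebesgue_itv_fin (l : R) : fin_num_fun (lebesgue_itv l).
Proof.
have itv_fin : (lebesgue_itv l setT < +oo)%E.
  rewrite /lebesgue_itv /mrestr setTI lebesgue_measure_itv.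
  by case: ifPn => _; rewrite ltry.
exact: lty_fin_num_fun.
Qed.

HB.instance Definition _ (l : R) := @Measure_isFinite.Build _ _ _
  (lebesgue_itv l) (@lebesgue_itv_fin l).

(* Lebesgue measure on R^N x ]0, l[, as a measure on R^N x R. *)
Definition strip N (l : R) :
    {measure set ('rV[R]_N * measurableTypeR R)%type -> \bar R} :=
  (lebesgue_rV N \x lebesgue_itv l)%E.

End lebesgue_itv.

Section sobolev.
Context {R : realType} (N : nat).
Local Notation X := ('rV[R]_N * R)%type.
Implicit Types (f g phi : X -> R) (v : X) (l : R).

Definition smooth f := forall s : seq X,
  let g := foldr (fun v h => 'D_v h) f s in
  continuous g /\ forall x v, derivable g x v.

Definition supp f := closure [set z | f z != 0].

Definition Cc_infty (U : set X) phi :=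
  [/\ smooth phi, compact (supp phi) & supp phi `<=` U].

Definition dirx (i : 'I_N) : X := (delta_mx ord0 i, 0).
Definition diry : X := (0, 1).

Definition weak_derivative l v f g :=
  forall phi, Cc_infty [set z | 0 < z.2 < l] phi ->
  \int[strip N l]_z (f z * 'D_v phi z) = - \int[strip N l]_z (g z * phi z).

(* A function of H^1(R^N x ]0, l[) is bundled with its weak partial
   derivatives, which it determines almost everywhere; values outside the strip
   are irrelevant. *)
Record sobolev l := Sobolev {
  sob_val :> X -> R;
  sob_dx : 'I_N -> X -> R;
  sob_dy : X -> R;
  sob_val_L2 : sob_val \in Lfun (strip N l) 2%:E;
  sob_dx_L2 : forall i, sob_dx i \in Lfun (strip N l) 2%:E;
  sob_dy_L2 : sob_dy \in Lfun (strip N l) 2%:E;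
  sob_dxP : forall i, weak_derivative l (dirx i) sob_val (sob_dx i);
  sob_dyP : weak_derivative l diry sob_val sob_dy }.

Definition L2_cvg d (T : measurableType d) (m : {measure set T -> \bar R})
    (fs : nat -> T -> R) (f : T -> R) :=
  ('N[m]_2%:E[EFin \o (fs k \- f)%R])%E @[k --> \oo] --> 0%E.

(* [t] is the trace of [f] on R^N x {a}, for a = 0 or a = l: the trace is the
   continuous extension to H^1 of the restriction to R^N x {a}, defined on
   C_c^oo(R^N x R), which is dense in H^1. *)
Definition is_trace l (f : sobolev l) (a : R) (t : 'rV[R]_N -> R) :=
  t \in Lfun (lebesgue_rV N) 2%:E /\
  exists phi : nat -> X -> R,
  [/\ forall k, Cc_infty setT (phi k),
      L2_cvg (strip N l) phi f,
      forall i, L2_cvg (strip N l) (fun k => 'D_(dirx i) (phi k)) (sob_dx f i),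
      L2_cvg (strip N l) (fun k => 'D_diry (phi k)) (sob_dy f) &
      L2_cvg (lebesgue_rV N) (fun k x => phi k (x, a)) t].

End sobolev.

(* The edge [e] is [0, len e]; [endpoint e false] is the vertex at which 0 is
   glued and [endpoint e true] the vertex at which [len e] is. *)
Record metric_graph (R : realType) := MetricGraph {
  vertex : finType;
  edge : finType;
  endpoint : edge -> bool -> vertex;
  len : edge -> R;
  len_gt0 : forall e, 0 < len e;
  graph_connected : forall v w : vertex,
    connect [rel a b | [exists e, [exists s,
      (endpoint e s == a) && (endpoint e (~~ s) == b)]]] v w }.

Section energy.
Context {R : realType} (N : nat) (G : metric_graph R).

Definition end_pos (e : edge G) (s : bool) : R := if s then len e else 0.

Record H1 := MkH1 {
  H1_fun :> forall e : edge G, sobolev N (len e);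
  H1_trace : forall e s e' s', endpoint e s = endpoint e' s' ->
    exists t, is_trace (H1_fun e) (end_pos e s) t /\
              is_trace (H1_fun e') (end_pos e' s') t }.

Implicit Type u : H1.

Definition norm_pow u (p : R) : \bar R :=
  (\sum_e 'N[strip N (len e)]_p%:E[EFin \o u e] `^ p)%E.

Definition normsq_dx u : \bar R :=
  (\sum_e \sum_i 'N[strip N (len e)]_2%:E[EFin \o sob_dx (u e) i] `^ 2)%E.

Definition normsq_dy u : \bar R :=
  (\sum_e 'N[strip N (len e)]_2%:E[EFin \o sob_dy (u e)] `^ 2)%E.

Definition energy (p : R) u : \bar R :=
  (2^-1%:E * normsq_dx u + 2^-1%:E * normsq_dy u - p^-1%:E * norm_pow u p)%E.

Definition has_mass (mu : R) u := norm_pow u 2 = mu%:E.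

Definition ground_state (p mu : R) u :=
  has_mass mu u /\ forall v : H1, has_mass mu v -> (energy p u <= energy p v)%E.

Definition dy_zero u :=
  forall e, sob_dy (u e) = cst 0 %[ae strip N (len e)].

End energy.

(* Main.v *)
Require Import Defs.
From HB Require Import structures.
From mathcomp Require Import all_boot all_order all_algebra.
From mathcomp Require Import all_classical all_reals all_analysis.
From mathcomp Require Import measurable_realfun.
From mathcomp Require Import ring lra.

(* Write [M], [X], [Y] for the squared [L^2]-norms of [u], its gradient in x and its
   derivative in y, [P] for the p-th power of its [L^p]-norm, and [J = X/2 - P/p], so
   that [E = J + Y/2]. The maps [u |-> a u(c x, y)] can multiply [M] and [Y] by any
   [t > 0] and [J] by [t^g] for some [g > 1]: increasing the mass makes [Y] cheaper.
   Hence a mass with a flat ground state ([Y = 0]) never exceeds a mass with a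
   non-flat one, and [mu2] can be put in between provided that the former masses are
   bounded and the latter bounded away from 0.
   Flat masses are bounded: multiplying a flat [u] on each edge by a function of y
   equal to 1 at the vertices and with mean square 1 keeps [M] and [X] and strictly
   increases [P].
   Non-flat masses are bounded below: at mass 1 the Gagliardo-Nirenberg inequality
   bounds [K Y], where [K] is the large weight of [Y] at small mass; some slice
   [u(., y0)] has at most the average of [J + w M], and extending it constantly in y
   gives a flat competitor whose mass differs from 1 by [O(sqrt Y)], which for a
   suitable multiplier [w] raises [J] by [O(Y)] only.
   All functions are obtained from their approximations by test functions. *)

Set Implicit Arguments.
Unset Strict Implicit.
Unset Printing Implicit Defensive.

Import Order.TTheory GRing.Theory Num.Theory.
Import numFieldNormedType.Exports.

Local Open Scope classical_set_scope.
Local Open Scope ring_scope.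

(** * Lebesgue measure on R^n *)

(** No existence of ground states is used: those that exist are compared across masses by scaling,
    so the end of the proof is about the set of attainable quadruples [(M, X, Y, P)] only. The
    scaling exponent is [g = (s + 2) / s] with [s = 4 / (p - 2) - N], and the assumption on [p] is
    exactly [s >= 1]. Indeed, interpolating between 2 and the exponent [2 + 4 / N], critical on R^N,
    bounds [P] with a growth of order [Y ^ (1 / s)], which must be at most linear for [K Y / 2] to
    absorb it. The obstacle at small mass is that a gain [K Y] beats a loss of order [t ^ 2] but not
    one of order [t], where [1 + t] is the mass of the flat competitor. With [w = - g J] the
    selected slice has its [J] bounded by [J (1 + g t)]; bringing its mass back to 1 divides by
    [(1 + t) ^ g], and the terms linear in [t] cancel. A function [g(x) h(y)] with [h = 1] at all
    vertices satisfies the vertex conditions on any graph, since all its traces equal [g]. The graph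
    itself matters only when the masses of slices on different edges are compared, through shared
    traces along a path. *)

Section measure_rV.
Context {R : realType}.
Local Notation leb := (@lebesgue_measure R).
Implicit Types (n : nat) (c l : R).

Lemma integral_lebesgue_itv l (f : measurableTypeR R -> \bar R) :
  measurable_fun setT f -> (forall x, 0 <= f x)%E ->
  (\int[lebesgue_itv l]_x f x = \int[leb]_(x in `]0%R, l[) f x)%E.
Proof.
move=> mf f0.
have mN : measurable (~` (`]0, l[%classic : set (measurableTypeR R))).
  exact: measurableC.
rewrite (ge0_negligible_integral mN)//; last first.
  by rewrite /= /lebesgue_itv /mrestr setICl measure0.
rewrite setTD setCK; apply: eq_measure_integral => A mA AD.
by rewrite /= /lebesgue_itv /mrestr setIidl.
Qed.

(** The right-hand side is a measure in [A] that gives every []a, b]] its length, and Lebesgue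
    measure is the only such measure. *)
Lemma lebesgue_measure_scale c (A : set (measurableTypeR R)) : 0 < c ->
  measurable A -> (leb A = c%:E * leb ((fun x => c * x)%R @^-1` A))%E.
Proof.
move=> c0.
have mc : measurable_fun (@setT (measurableTypeR R)) (fun x : measurableTypeR R => c * x : measurableTypeR R).
  exact: measurable_funM.
pose phi : {mfun measurableTypeR R >-> measurableTypeR R} :=
  HB.pack (fun x : measurableTypeR R => c * x : measurableTypeR R) (isMeasurableFun.Build _ _ _ _ _ mc).
pose nu' := (mscale (NngNum (ltW c0)) (pushforward leb phi) :
  {measure set (measurableTypeR R) -> \bar R}).
move=> mA; rewrite (@lebesgue_measure_unique _ (nu' mc)) => // _ [[a b]] _ <-.
rewrite /= /mscale /= /pushforward.
have -> : (fun x => c * x) @^-1` `]a, b]%classic = `]c^-1 * a, c^-1 * b]%classic.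
  by apply/seteqP; split => x; rewrite /= !in_itv/= ltr_pdivrMl// ler_pdivlMl.
rewrite !lebesgue_measure_itv/= !lte_fin ltr_pM2l ?invr_gt0//.
case: ifPn => _; last by rewrite mule0.
by rewrite -!EFinB -EFinM -mulrBr mulrA mulfV ?gt_eqF// mul1r.
Qed.

Lemma ge0_integral_scale c (f : measurableTypeR R -> \bar R) : 0 < c ->
  measurable_fun setT f -> (forall x, 0 <= f x)%E ->
  (\int[leb]_x f (c * x)%R = c^-1%:E * \int[leb]_x f x)%E.
Proof.
move=> c0 mf f0.
have mc : measurable_fun (@setT (measurableTypeR R)) (fun x : measurableTypeR R => c * x : measurableTypeR R).
  exact: measurable_funM.
pose phi : {mfun measurableTypeR R >-> measurableTypeR R} :=
  HB.pack (fun x : measurableTypeR R => c * x : measurableTypeR R) (isMeasurableFun.Build _ _ _ _ _ mc).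
pose nu := (pushforward leb phi : {measure set (measurableTypeR R) -> \bar R}).
have e1 : (\int[leb]_x f (c * x)%R = \int[nu mc]_x f x)%E.
  by rewrite ge0_integral_pushforward.
have e2 : (\int[leb]_x f x = \int[mscale (NngNum (ltW c0)) (nu mc)]_x f x)%E.
  by apply: eq_measure_integral => A mA _; exact: (lebesgue_measure_scale c0 mA).
rewrite e1 e2 ge0_integral_mscale//= muleA -EFinM mulVf ?gt_eqF//.
by rewrite mul1e.
Qed.

Lemma measurable_scalerV n c : measurable_fun setT (fun x : 'rV[R]_n => c *: x).
Proof.
apply: measurable_fun_rV => i.
rewrite (_ : (fun _ => _) = (fun x : 'rV[R]_n => c * x ord0 i)).
  by apply: measurable_funM => //; exact: measurable_coord.
by apply/funext => x; rewrite mxE.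
Qed.

Section succ.
Context n (f : 'rV[R]_n.+1 -> \bar R).
Hypotheses (mf : measurable_fun setT f) (f0 : forall x, (0 <= f x)%E).

Let mcons : measurable_fun (@setT (measurableTypeR R * 'rV[R]_n)%type) (@consrV R n).
Proof. exact: measurable_consrV. Qed.

Let mfc : measurable_fun (@setT (measurableTypeR R * 'rV[R]_n)%type) (f \o @consrV R n).
Proof. by apply: measurableT_comp => //; exact: mcons. Qed.

Let fc0 z : (0 <= (f \o @consrV R n) z)%E. Proof. exact: f0. Qed.

Lemma measurable_rVS1 :
  measurable_fun setT (fun a : measurableTypeR R => \int[lebesgue_rV n]_v f (consrV (a, v)))%E.
Proof. exact: (measurable_fun_fubini_tonelli_F (m2 := lebesgue_rV n) _ mfc fc0). Qed.

Lemma measurable_rVS2 :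
  measurable_fun setT (fun v : 'rV[R]_n => \int[leb]_a f (consrV (a, v)))%E.
Proof. exact: (measurable_fun_fubini_tonelli_G (m1 := leb) _ mfc fc0). Qed.

Lemma integral_rVS1 : (\int[lebesgue_rV n.+1]_x f x =
  \int[leb]_a \int[lebesgue_rV n]_v f (consrV (a, v)))%E.
Proof.
transitivity (\int[leb \x lebesgue_rV n]_z (f \o @consrV R n) z)%E.
  have := @ge0_integral_pushforward _ _ _ _ R _ mcons
    (leb \x lebesgue_rV n)%E setT f measurableT mf (fun x _ => f0 x).
  by rewrite preimage_setT.
by rewrite fubini_tonelli1.
Qed.

Lemma integral_rVS2 : (\int[lebesgue_rV n.+1]_x f x =
  \int[lebesgue_rV n]_v \int[leb]_a f (consrV (a, v)))%E.
Proof.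
by rewrite integral_rVS1; exact: (@fubini_tonelli _ _ _ _ _ leb (lebesgue_rV n) _ mfc fc0).
Qed.

End succ.

Lemma scale_consrV n c (a : R) (v : 'rV[R]_n) :
  c *: consrV (a, v) = consrV (c * a, c *: v).
Proof. by apply/rowP => i; rewrite !mxE; case: unlift => [j|]//=; rewrite mxE. Qed.

Lemma ge0_integral_scalerV n c (f : 'rV[R]_n -> \bar R) : 0 < c ->
  measurable_fun setT f -> (forall x, 0 <= f x)%E ->
  (\int[lebesgue_rV n]_x f (c *: x)%R = (c ^- n)%:E * \int[lebesgue_rV n]_x f x)%E.
Proof.
move=> c0; elim: n f => [|n IH] f mf f0.
  rewrite expr0 invr1 mul1e; apply: eq_integral => x _; congr f.
  by apply/rowP => -[].
rewrite integral_rVS1//; last first.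
  by apply: measurableT_comp => //; exact: measurable_scalerV.
rewrite integral_rVS1//.
pose G a := (\int[lebesgue_rV n]_v f (consrV (a, v)))%E.
have mG : measurable_fun setT G by exact: measurable_rVS1.
have G0 a : (0 <= G a)%E by exact: integral_ge0.
have mGc : measurable_fun (@setT (measurableTypeR R)) (fun a : measurableTypeR R => G (c * a)).
  by apply: measurableT_comp => //; exact: measurable_funM.
transitivity (\int[leb]_a ((c ^- n)%:E * G (c * a)%R))%E.
  apply: eq_integral => a _; under eq_integral do rewrite scale_consrV.
  apply: (IH (fun v => f (consrV (c * a, v)))) => //.
  apply: measurableT_comp mf _; apply: measurableT_comp => //.
  exact: measurable_consrV.
rewrite (@ge0_integralZl _ _ _ leb setT measurableT (fun a => G (c * a)) mGc _ (fun x _ => G0 _)).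
  by rewrite (ge0_integral_scale c0 mG G0) muleA -EFinM exprSr invfM mulrC.
by rewrite lee_fin invr_ge0 exprn_ge0// ltW.
Qed.

End measure_rV.

Section continuous_measurable.
Context {R : realType}.

Lemma measurable_fun_countable d (T : measurableType d) (C : countType)
    d' (U : measurableType d') (c : T -> C) (h : C -> U) :
  (forall k, measurable (c @^-1` [set k])) -> measurable_fun setT (h \o c).
Proof.
move=> mc _ Y mY; rewrite setTI.
rewrite (_ : _ @^-1` _ = \bigcup_(k in [set k | Y (h k)]) c @^-1` [set k]).
  rewrite bigcup_mkcond; apply: countable_bigcupT_measurable => // k.
  by case: ifP.
apply/seteqP; split => [x /= Yx|x [k /= Yk cx]]; last by rewrite /= cx.
by exists (c x).
Qed.

(** The sigma-algebra on ['rV[R]_n] is generated by the coordinates, not by the open sets. So [f] is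
    written as a limit of functions of countably many values: [c k x] indexes the grid cell of side
    [1 / (k + 1)] containing [x], and [h k] returns a corner of the cell. *)
Lemma continuous_measurable_rV n (f : 'rV[R]_n -> R) :
  continuous f -> measurable_fun setT f.
Proof.
move=> cf.
pose c (k : nat) (x : 'rV[R]_n) := [ffun i : 'I_n => Num.floor (k.+1%:R * x ord0 i)].
pose h (k : nat) (z : {ffun 'I_n -> int}) : 'rV[R]_n := \row_i (k.+1%:R^-1 * (z i)%:~R).
apply: (@measurable_fun_cvg _ _ _ _ (fun k => f \o h k \o c k)).
  move=> k; apply: measurable_fun_countable => z.
  rewrite (_ : _ @^-1` _ = \bigcap_(i in [set: 'I_n])
    ((fun x : 'rV[R]_n => x ord0 i) @^-1` `[(z i)%:~R / k.+1%:R, (z i + 1)%:~R / k.+1%:R[%classic)).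
    apply: fin_bigcap_measurable => // i _.
    by rewrite -[X in measurable X]setTI; apply: measurable_coord.
  apply/seteqP; split => [x /= <- i _|x H]; rewrite /= ?ffunE.
    rewrite in_itv/= ler_pdivrMr// ltr_pdivlMr// mulrC.
    by rewrite ge_floor floorD1_gt.
  apply/ffunP => i; rewrite ffunE; apply/eqP; rewrite floor_eq.
  have := H i I; rewrite /= in_itv/= ler_pdivrMr// ltr_pdivlMr// mulrC.
  by [].
move=> x _; apply: (@continuous_cvg _ _ _ _ _ _ f x); first exact: cf.
apply/cvgrPdist_le => e e0; near=> k.
rewrite -[leLHS]/(mx_norm _) mx_normrE; apply: bigmax_le; first exact: ltW.
move=> [i j] _ /=; rewrite !mxE !ffunE (ord1 i).
have k0 : 0 < k.+1%:R :> R by [].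
rewrite -[X in X - _](mulKf (lt0r_neq0 k0)) -mulrBr normrM gtr0_norm ?invr_gt0//.
rewrite ler_pdivrMl//; apply: (@le_trans _ _ 1).
  have := floor_itv (k.+1%:R * x ord0 j); rewrite intrD => /andP[h1 h2].
  by rewrite ger0_norm ?subr_ge0//; lra.
rewrite -ler_pdivrMr// mul1r.
apply: (@le_trans _ _ k%:R); last by rewrite ler_nat.
by near: k; exact: nbhs_infty_ger.
Unshelve. all: by end_near. Qed.

End continuous_measurable.

(** * Square integrals and interpolation *)

Lemma measurable_powR_norm (R : realType) (r : R) d (T : measurableType d) (f : T -> R) :
  measurable_fun setT f -> measurable_fun setT (fun z => (`|f z| `^ r)%:E).
Proof.
move=> mf; apply/measurable_EFinP.
by apply: (@measurableT_comp _ _ _ _ _ _ (@powR R ^~ _)) => //; exact: measurableT_comp.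
Qed.

Section real_integrals.
Context d (T : measurableType d) (R : realType) (m : {measure set T -> \bar R}).
Implicit Types (f g h : T -> R) (D : set T) (a b : R).

Lemma ge0_le_integral_EFin D f g : measurable D ->
  measurable_fun setT f -> measurable_fun setT g ->
  (forall x, 0 <= f x) -> (forall x, f x <= g x) ->
  (\int[m]_(x in D) (f x)%:E <= \int[m]_(x in D) (g x)%:E)%E.
Proof.
move=> mD mf mg f0 fg; apply: ge0_le_integral => //.
- by move=> x _; rewrite lee_fin.
- by apply/measurable_EFinP; exact: measurable_funTS.
- by apply/measurable_EFinP; exact: measurable_funTS.
- by move=> x _; rewrite lee_fin.
Qed.

Lemma integral_lin2 D f g a b : measurable D ->
  measurable_fun setT f -> measurable_fun setT g ->
  (forall x, 0 <= f x) -> (forall x, 0 <= g x) -> 0 <= a -> 0 <= b ->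
  (\int[m]_(x in D) (a * f x + b * g x)%:E =
   a%:E * \int[m]_(x in D) (f x)%:E + b%:E * \int[m]_(x in D) (g x)%:E)%E.
Proof.
move=> mD mf mg f0 g0 a0 b0.
under eq_integral do rewrite EFinD !EFinM.
have mf' : measurable_fun D (EFin \o f).
  by apply/measurable_EFinP; exact: measurable_funTS.
have mg' : measurable_fun D (EFin \o g).
  by apply/measurable_EFinP; exact: measurable_funTS.
rewrite ge0_integralD//.
- by rewrite !ge0_integralZl_EFin// => x _; rewrite lee_fin.
- by move=> x _; rewrite -EFinM lee_fin mulr_ge0.
- exact: measurable_funeM.
- by move=> x _; rewrite -EFinM lee_fin mulr_ge0.
- exact: measurable_funeM.
Qed.

Lemma le_integral_lin2 D h f g a b : measurable D ->
  measurable_fun setT f -> measurable_fun setT g -> measurable_fun setT h ->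
  (forall x, 0 <= f x) -> (forall x, 0 <= g x) -> (forall x, 0 <= h x) ->
  0 <= a -> 0 <= b -> (forall x, h x <= a * f x + b * g x) ->
  (\int[m]_(x in D) (h x)%:E <=
   a%:E * \int[m]_(x in D) (f x)%:E + b%:E * \int[m]_(x in D) (g x)%:E)%E.
Proof.
move=> mD mf mg mh f0 g0 h0 a0 b0 hfg; rewrite -integral_lin2//.
apply: ge0_le_integral_EFin => //.
by apply: measurable_funD; apply: measurable_funM.
Qed.

Definition sqint (f : T -> R) : \bar R := (\int[m]_x (f x ^+ 2)%:E)%E.

Lemma sqint_ge0 f : (0 <= sqint f)%E.
Proof. by apply: integral_ge0 => x _; rewrite lee_fin sqr_ge0. Qed.

Lemma sqintZ f a : measurable_fun setT f ->
  sqint (fun x => a * f x) = ((a ^+ 2)%:E * sqint f)%E.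
Proof.
move=> mf; rewrite /sqint; under eq_integral do rewrite exprMn EFinM.
rewrite ge0_integralZl_EFin ?sqr_ge0//.
- by move=> x _; rewrite lee_fin sqr_ge0.
- by apply/measurable_EFinP; apply: measurable_funX.
Qed.

Lemma le_sqint_lin2 h f g a b :
  measurable_fun setT f -> measurable_fun setT g -> measurable_fun setT h ->
  0 <= a -> 0 <= b -> (forall x, h x ^+ 2 <= a * f x ^+ 2 + b * g x ^+ 2) ->
  (sqint h <= a%:E * sqint f + b%:E * sqint g)%E.
Proof.
move=> mf mg mh a0 b0 hfg.
apply: (le_integral_lin2 (h := fun x => h x ^+ 2) (f := fun x => f x ^+ 2)
  (g := fun x => g x ^+ 2)) => //; try by apply: measurable_funX.
- by move=> x; rewrite sqr_ge0.
- by move=> x; rewrite sqr_ge0.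
- by move=> x; rewrite sqr_ge0.
Qed.

(* The elementary inequality [x ^ p <= t ^ (- r) x ^ 2 + t x ^ q], with [r] such
   that both sides are homogeneous, is integrated: an interpolation without
   Hoelder's inequality. *)
Lemma powR_interpolation (p q t x : R) : 2 < p -> p < q -> 0 < t -> 0 <= x ->
  x `^ p <= t `^ (- ((p - 2) / (q - p))) * x ^+ 2 + t * x `^ q.
Proof.
move=> p2 pq t0; rewrite le_eqVlt => /orP[/eqP<-|x0].
  by rewrite !powR0 ?mulr0 ?addr0 ?expr0n ?mulr0//; apply/eqP; lra.
have qp : 0 < q - p by lra.
have xne : x != 0 by rewrite gt_eqF.
(* If [t x ^ (q - p) >= 1] the second term alone dominates, otherwise the first one does. *)
have [h|h] := leP 1 (t * x `^ (q - p)).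
  apply: (@le_trans _ _ (t * x `^ q)); last first.
    by rewrite lerDr mulr_ge0 ?powR_ge0 ?sqr_ge0.
  have -> : x `^ q = x `^ (q - p) * x `^ p.
    by rewrite -powRD ?subrK// xne implybT.
  by rewrite mulrA ler_peMl ?powR_ge0.
apply: (@le_trans _ _ (t `^ (- ((p - 2) / (q - p))) * x ^+ 2)); last first.
  by rewrite lerDl mulr_ge0 ?powR_ge0 ?ltW.
have -> : x `^ p = x `^ (p - 2) * x ^+ 2.
  rewrite -powR_mulrn ?ltW// -powRD ?subrK// xne implybT//.
rewrite ler_wpM2r ?sqr_ge0//.
have -> : x `^ (p - 2) = (x `^ (q - p)) `^ ((p - 2) / (q - p)).
  by rewrite -powRrM mulrCA mulfV ?mulr1// gt_eqF.
have -> : t `^ (- ((p - 2) / (q - p))) = t^-1 `^ ((p - 2) / (q - p)).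
  by rewrite -(powR_inv1 (ltW t0)) -powRrM mulN1r.
apply: ge0_ler_powR; rewrite ?nnegrE ?powR_ge0 ?invr_ge0 ?(ltW t0)//.
- by rewrite divr_ge0//; lra.
- by rewrite -[leRHS]mul1r ler_pdivlMr// mulrC ltW.
Qed.

Lemma integral_interpolation (p q t : R) f : 2 < p -> p < q -> 0 < t ->
  measurable_fun setT f ->
  (\int[m]_x (`|f x| `^ p)%:E <= (t `^ (- ((p - 2) / (q - p))))%:E * sqint f
     + t%:E * \int[m]_x (`|f x| `^ q)%:E)%E.
Proof.
move=> p2 pq t0 mf.
have mp r : measurable_fun setT (fun x => `|f x| `^ r).
  by apply: (@measurableT_comp _ _ _ _ _ _ (@powR R ^~ r)) => //; exact: measurableT_comp.
apply: (@le_integral_lin2 setT (fun x => `|f x| `^ p) (fun x => f x ^+ 2)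
  (fun x => `|f x| `^ q)) => //.
- exact: measurable_funX.
- by move=> x; rewrite sqr_ge0.
- exact: powR_ge0.
- exact: ltW.
- by move=> x; rewrite -[f x ^+ 2]real_normK ?num_real//; exact: powR_interpolation.
Qed.

Lemma integral_powR_eq0 f (p q : R) : p != 0 -> q != 0 -> measurable_fun setT f ->
  (\int[m]_x (`|f x| `^ p)%:E = 0)%E -> (\int[m]_x (`|f x| `^ q)%:E = 0)%E.
Proof.
move=> p0 q0 mf f0; transitivity (\int[m]_z (0 : \bar R))%E; last by rewrite integral0.
apply: ge0_ae_eq_integral => //; first exact: measurable_powR_norm.
have : (\int[m]_x `|(`|f x| `^ p)%:E| = 0)%E.
  by rewrite -f0; apply: eq_integral => x _; rewrite gee0_abs// lee_fin powR_ge0.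
move/(ae_eq_integral_abs _ measurableT (measurable_powR_norm p mf)).
apply: filterS => x /(_ I)[] /= /powR_eq0_eq0/eqP; rewrite normr_eq0 => /eqP -> _.
by rewrite normr0 powR0.
Qed.

Lemma sqint_powR f : sqint f = (\int[m]_x (`|f x| `^ 2)%:E)%E.
Proof.
by apply: eq_integral => x _; rewrite powR_mulrn// real_normK ?num_real.
Qed.

End real_integrals.

(** * Restriction to lines, and variation of a square along an interval *)

Section line.
Context {R : realType}.

(* [i] is affine with linear part sending [u] to [v] *)
Lemma is_derive_line (U V : normedModType R) (i : U -> V) (f : V -> R) x u v d :
  (forall h : R, i (h *: u + x) = h *: v + i x) ->
  is_derive (i x) v f d -> is_derive x u (f \o i) d.
Proof.
move=> iE [df fE].
have E : (fun h : R => h^-1 *: (((f \o i) \o shift x) (h *: u) - (f \o i) x)) =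
         (fun h : R => h^-1 *: ((f \o shift (i x)) (h *: v) - f (i x))).
  by apply/funext => h /=; rewrite iE.
split; first by rewrite /derivable E.
by rewrite -fE /derive E.
Qed.

Lemma integral_derive (F F' : R -> R) (a b : R) : a < b ->
  (forall t : R, is_derive t 1 F (F' t)) -> continuous F' ->
  (\int[lebesgue_measure]_(t in `[a, b]) (F' t)%:E = (F b - F a)%:E)%E.
Proof.
move=> ab dF cF'.
have cF : continuous F.
  by move=> t; apply: differentiable_continuous; apply/derivable1_diffP; exact: ex_derive.
rewrite (continuous_FTC2 ab (F := F)) ?EFinB//.
- exact: continuous_subspaceT.
- split; last 2 first.
  + by apply: cvg_at_right_filter; exact: cF.
  + by apply: cvg_at_left_filter; exact: cF.
  + by move=> x _; exact: ex_derive.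
- by move=> x _; rewrite derive1E; exact: derive_val.
Qed.

(** The derivative [2 F F'] of [F ^ 2] is at most [s F ^ 2 + F' ^ 2 / s] by Young's inequality. The
    weight [s] stays free because each later use optimizes it differently. *)
Lemma sqr_variation (F F' : R -> R) (a b s : R) : a <= b -> 0 < s ->
  (forall t : R, is_derive t 1 F (F' t)) -> continuous F' ->
  (`|F b ^+ 2 - F a ^+ 2|%:E <=
   \int[lebesgue_measure]_(t in `[a, b]) (s * F t ^+ 2 + s^-1 * F' t ^+ 2)%:E)%E.
Proof.
rewrite le_eqVlt => /orP[/eqP <-|ab] s0 dF cF'.
  rewrite subrr normr0; apply: integral_ge0 => x _.
  by rewrite lee_fin addr_ge0// mulr_ge0 ?sqr_ge0 ?invr_ge0 ?(ltW s0).
have cF : continuous F.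
  by move=> t; apply: differentiable_continuous; apply/derivable1_diffP; exact: ex_derive.
have mF : measurable_fun setT F by exact: continuous_measurable_fun.
have mF' : measurable_fun setT F' by exact: continuous_measurable_fun.
have dF2 (t : R) : is_derive t 1 (fun t => F t ^+ 2) (2 * F t * F' t).
  rewrite (_ : (fun _ => _) = F * F); last by apply/funext => y; rewrite expr2.
  have h := is_deriveM (dF t) (dF t); apply: (is_derive_eq h).
  by rewrite [LHS](_ : _ = F t * F' t + F t * F' t)//; ring.
have cF2 : continuous (fun t => 2 * F t * F' t).
  move=> t; apply: cvgM; last exact: cF'.
  by apply: cvgM; [exact: cvg_cst|exact: cF].
have m2 : measurable_fun `[a, b] (fun t => (2 * F t * F' t)%:E).
  apply/measurable_EFinP; apply: measurable_funTS.
  by apply: continuous_measurable_fun.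
have := integral_derive ab dF2 cF2; move=> /(congr1 abse); rewrite abse_EFin => <-.
have mab : measurable (`[a, b]%classic : set (measurableTypeR R)) by [].
apply: (le_trans (@le_abse_integral _ (measurableTypeR R) R lebesgue_measure _ _ mab m2)).
rewrite [X in (X <= _)%E](_ : _ =
  \int[lebesgue_measure]_(t in `[a, b]) (`|2 * F t * F' t|)%:E)%E//.
apply: ge0_le_integral_EFin => //.
- by apply: measurableT_comp => //; apply: continuous_measurable_fun.
- by apply: measurable_funD; apply: measurable_funM => //; apply: measurable_funX.
- move=> x; have si : 0 < s^-1 by rewrite invr_gt0.
  rewrite ler_norml; apply/andP; split; rewrite -subr_ge0.
    have -> : 2 * F x * F' x - - (s * F x ^+ 2 + s^-1 * F' x ^+ 2) = s^-1 * (s * F x + F' x) ^+ 2.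
      by field; rewrite gt_eqF.
    by rewrite mulr_ge0 ?sqr_ge0// ltW.
  have -> : s * F x ^+ 2 + s^-1 * F' x ^+ 2 - 2 * F x * F' x = s^-1 * (s * F x - F' x) ^+ 2.
    by field; rewrite gt_eqF.
  by rewrite mulr_ge0 ?sqr_ge0// ltW.
Qed.

End line.

(** * The Gagliardo-Nirenberg inequality *)

Section gagliardo_nirenberg.
Context {R : realType}.
Local Notation leb := (@lebesgue_measure R).

(** The class on which the induction on the dimension runs: it is stable under fixing the first
    coordinate. The partial derivatives are data, so that those of a slice are slices of the given
    ones, and compact support is reduced to a bound on the coordinates. *)
Record C1c n (f : 'rV[R]_n -> R) (df : 'I_n -> 'rV[R]_n -> R) : Prop := MkC1c {
  C1c_cont : continuous f;
  C1c_dcont : forall i, continuous (df i);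
  C1c_box : exists B, forall x, f x != 0 -> forall i, `|x ord0 i| <= B;
  C1c_derive : forall i x, is_derive x (delta_mx ord0 i : 'rV[R]_n) f (df i x) }.

Lemma consrV_lift n a (v : 'rV[R]_n) (h : R) j :
  consrV (a, h *: delta_mx ord0 j + v) =
  h *: delta_mx ord0 (lift ord0 j) + consrV (a, v).
Proof.
apply/rowP => i; rewrite !mxE/=; case: (unliftP ord0 i) => [k ->|->] /=.
  by rewrite !mxE eqxx/= (inj_eq lift_inj).
by rewrite mulr0 add0r.
Qed.

Lemma consrV_ord0 n (a h : R) (v : 'rV[R]_n) :
  consrV (h *: 1 + a, v) = h *: delta_mx ord0 ord0 + consrV (a, v).
Proof.
apply/rowP => i; rewrite !mxE/=; case: (unliftP ord0 i) => [k ->|->] /=.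
  by rewrite mulr0 add0r.
by rewrite [h *: _]/(h * 1).
Qed.

Lemma continuous_consrVr n (a : R) : continuous (fun v : 'rV[R]_n => consrV (a, v)).
Proof.
move=> v; have FF : Filter (nbhs v) by exact: nbhs_filter.
apply/cvgrPdist_le => e e0; near=> w.
rewrite -[leLHS]/(mx_norm _) mx_normrE; apply: bigmax_le; first exact: ltW.
move=> [i j] _ /=; rewrite (ord1 i) !mxE /=; case: unlift => [k|] /=; last first.
  by rewrite subrr normr0 ltW.
apply: (@le_trans _ _ `|v - w|).
  rewrite -[leRHS]/(mx_norm _) mx_normrE.
  by have := le_bigmax_cond 0 (fun i : 'I_1 * 'I_n => `|(v - w) i.1 i.2|) (isT : predT (ord0, k)); rewrite !mxE.
near: w; exact: cvgr_dist_le.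
Unshelve. all: by end_near. Qed.

Lemma continuous_consrVl n (v : 'rV[R]_n) : continuous (fun a : R => consrV (a, v)).
Proof.
move=> a; have FF : Filter (nbhs a) by exact: nbhs_filter.
apply/cvgrPdist_le => e e0; near=> b.
rewrite -[leLHS]/(mx_norm _) mx_normrE; apply: bigmax_le; first exact: ltW.
move=> [i j] _ /=; rewrite (ord1 i) !mxE /=; case: unlift => [k|] /=.
  by rewrite subrr normr0 ltW.
near: b; exact: cvgr_dist_le.
Unshelve. all: by end_near. Qed.

Lemma C1c_slice n (f : 'rV[R]_n.+1 -> R) df a : C1c f df ->
  C1c (fun v => f (consrV (a, v))) (fun j v => df (lift ord0 j) (consrV (a, v))).
Proof.
move=> [cf cdf [B fB] df_]; split.
- by move=> v; apply: continuous_comp; [exact: continuous_consrVr|exact: cf].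
- by move=> j v; apply: continuous_comp; [exact: continuous_consrVr|exact: cdf].
- exists B => v fv j; have := fB _ fv (lift ord0 j).
  by rewrite mxE liftK.
- move=> j v; apply: (is_derive_line (i := fun v => consrV (a, v)) _ (df_ _ _)).
  by move=> h; exact: consrV_lift.
Qed.

Lemma C1c_measurable n (f : 'rV[R]_n -> R) df : C1c f df ->
  measurable_fun setT f /\ forall i, measurable_fun setT (df i).
Proof.
by move=> [cf cdf _ _]; split => [|i]; apply: continuous_measurable_rV.
Qed.

(** On each line in the first direction, [sqr_variation] is applied from a point where [f] vanishes;
    the result is integrated over the other coordinates. *)
Lemma sqint_slice_le n (f : 'rV[R]_n.+1 -> R) df s a : C1c f df -> 0 < s ->
  (sqint (lebesgue_rV n) (fun v => f (consrV (a, v))) <=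
   s%:E * sqint (lebesgue_rV n.+1) f +
   s^-1%:E * sqint (lebesgue_rV n.+1) (df ord0))%E.
Proof.
move=> hf s0; have [mf mdf] := C1c_measurable hf.
have si : 0 < s^-1 by rewrite invr_gt0.
have [cf cdf [B fB] df_] := hf.
pose h (x : 'rV[R]_n.+1) := s * f x ^+ 2 + s^-1 * df ord0 x ^+ 2.
have h0 x : 0 <= h x by rewrite addr_ge0// mulr_ge0 ?sqr_ge0// ltW.
have mh : measurable_fun setT h.
  by apply: measurable_funD; apply: measurable_funM => //; apply: measurable_funX.
have mh' : measurable_fun setT (EFin \o h) by exact/measurable_EFinP.
rewrite /sqint -(@integral_lin2 _ _ _ _ setT (fun x => f x ^+ 2) (fun x => df ord0 x ^+ 2)) ?(ltW s0) ?(ltW si)//;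
  try (by apply: measurable_funX); try by (move=> x; rewrite sqr_ge0).
rewrite (integral_rVS2 mh'); last by move=> x; rewrite lee_fin.
have [mfa _] := C1c_measurable (C1c_slice a hf).
apply: ge0_le_integral => //.
- by move=> x _; rewrite lee_fin sqr_ge0.
- by apply/measurable_EFinP; apply: measurable_funX.
- by apply: measurable_rVS2 => // x; rewrite lee_fin.
move=> v _.
pose F t := f (consrV (t, v)); pose F' t := df ord0 (consrV (t, v)).
have dF (t : R) : is_derive t 1 F (F' t).
  apply: (is_derive_line (i := fun a => consrV (a, v)) _ (df_ _ _)).
  by move=> x; rewrite consrV_ord0.
have cF' : continuous F'.
  by move=> t; apply: continuous_comp; [exact: continuous_consrVl|exact: cdf].
(* A point to the left of [a] and outside the box that contains the support. *)
pose c := - (`|a| + `|B| + 1).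
have Fc : F c = 0.
  apply/eqP; apply: contraT => /fB /(_ ord0); rewrite mxE unlift_none /= /c normrN.
  rewrite ger0_norm; last by rewrite !addr_ge0.
  by have := normr_ge0 a; have := ler_norm B; lra.
have ca : c <= a.
  by rewrite /c; have := ler_norm (- a); rewrite normrN; have := normr_ge0 B; lra.
have := sqr_variation ca s0 dF cF'.
rewrite Fc expr0n subr0 ger0_norm ?sqr_ge0// => /le_trans; apply.
apply: ge0_subset_integral => //.
  apply/measurable_EFinP.
  have mF' : measurable_fun setT F' by exact: continuous_measurable_fun.
  have mF : measurable_fun setT F.
    apply: continuous_measurable_fun => t.
    by apply: continuous_comp; [exact: continuous_consrVl|exact: cf].
  by apply: measurable_funD; apply: measurable_funM => //; apply: measurable_funX.
by move=> t _; rewrite lee_fin h0.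
Qed.

(** The weight [sqrt D / sqrt M] makes the two terms of [sqint_slice_le] equal. *)
Lemma sqint_slice_le_sqrt n (f : 'rV[R]_n.+1 -> R) df M D a : C1c f df ->
  0 < M -> 0 < D ->
  (sqint (lebesgue_rV n.+1) f <= M%:E)%E ->
  (sqint (lebesgue_rV n.+1) (df ord0) <= D%:E)%E ->
  (sqint (lebesgue_rV n) (fun v => f (consrV (a, v))) <=
   (2 * (Num.sqrt M * Num.sqrt D))%:E)%E.
Proof.
move=> hf M0 D0 fM fD.
have sM : 0 < Num.sqrt M by rewrite sqrtr_gt0.
have sD : 0 < Num.sqrt D by rewrite sqrtr_gt0.
have s0 : 0 < Num.sqrt D / Num.sqrt M by rewrite divr_gt0.
apply: (le_trans (sqint_slice_le a hf s0)).
apply: (@le_trans _ _ ((Num.sqrt D / Num.sqrt M)%:E * M%:E + (Num.sqrt D / Num.sqrt M)^-1%:E * D%:E)%E).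
  by apply: leeD; apply: lee_wpmul2l; rewrite // lee_fin ?invr_ge0 ltW.
rewrite -!EFinM -EFinD lee_fin.
rewrite -[X in _ * X + _](sqr_sqrtr (ltW M0)) -[X in _ + _ * X](sqr_sqrtr (ltW D0)).
by rewrite le_eqVlt; apply/orP; left; apply/eqP; field; rewrite !gt_eqF.
Qed.

(** Replaces a [D] that may be 0 or infinite by positive real upper bounds, which can be divided by
    and raised to negative powers. *)
Lemma lee_mul_approx (X : \bar R) (c : R) (D : \bar R) : 0 < c -> (0 <= D)%E ->
  (forall D', 0 < D' -> (D <= D'%:E)%E -> (X <= (c * D')%:E)%E) -> (X <= c%:E * D)%E.
Proof.
move=> c0 D0 H; have [Dfin|] := boolP (D \is a fin_num); last first.
  rewrite ge0_fin_numE// -leNgt leye_eq => /eqP ->.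
  by rewrite gt0_muley ?lte_fin// leey.
apply/lee_addgt0Pr => e e0.
have dD : 0 <= fine D by exact: fine_ge0.
apply: (le_trans (H (fine D + e / c) _ _)).
- by rewrite ltr_wpDl// divr_gt0.
- by rewrite -[X in (X <= _)%E]fineK// lee_fin lerDl ltW// divr_gt0.
- rewrite -[in (c%:E * D)%E](fineK Dfin) -EFinM -EFinD lee_fin mulrDr mulrCA.
  by rewrite mulfV ?mulr1// gt_eqF.
Qed.

(** In dimension 1 a slice is a point, the measure on R^0 being a Dirac mass. The slice bound is
    then a pointwise bound on [f ^ 2], and [|f| ^ 6] is [(f ^ 2) ^ 2] times [f ^ 2]. *)
Let gn_base (f : 'rV[R]_1 -> R) df : C1c f df -> forall M, 0 < M ->
  (sqint (lebesgue_rV 1) f <= M%:E)%E ->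
  (\int[lebesgue_rV 1]_x (`|f x| `^ (2 + 4 / 1%:R))%:E <=
   (4 * M `^ (2 / 1%:R))%:E * \sum_i sqint (lebesgue_rV 1) (df i))%E.
Proof.
move=> hf M M0 fM; have [mf mdf] := C1c_measurable hf.
apply: lee_mul_approx; first by rewrite mulr_gt0// powR_gt0.
  by apply: sume_ge0 => i _; exact: sqint_ge0.
move=> D D0; rewrite big_ord1 => fD.
have fA x : f x ^+ 2 <= 2 * (Num.sqrt M * Num.sqrt D).
  have := sqint_slice_le_sqrt (x ord0 ord0) hf M0 D0 fM fD.
  rewrite /sqint /= integral_dirac//; last first.
    have [mfa _] := C1c_measurable (C1c_slice (x ord0 ord0) hf).
    by apply/measurable_EFinP; apply: measurable_funX.
  rewrite diracT mul1e lee_fin (_ : consrV _ = x)//.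
  apply/rowP => i; rewrite !mxE; case: unliftP => [[]//|->] //.
have e : (2 + 4 / 1%:R : R) = 6%:R by rewrite divr1; ring.
have e' : (2 / 1%:R : R) = 2%:R by rewrite divr1.
rewrite e e' powR_mulrn ?(ltW M0)//.
apply: (@le_trans _ _ ((4 * M * D)%:E * sqint (lebesgue_rV 1) f)%E).
  rewrite /sqint -ge0_integralZl_EFin//; last 3 first.
  - by move=> x _; rewrite lee_fin sqr_ge0.
  - by apply/measurable_EFinP; apply: measurable_funX.
  - by rewrite !mulr_ge0// ltW.
  under [X in (_ <= X)%E]eq_integral do rewrite -EFinM.
  apply: ge0_le_integral_EFin => //.
  - apply: (@measurableT_comp _ _ _ _ _ _ (@powR R ^~ 6)) => //; exact: measurableT_comp.
  - by apply: measurable_funM => //; apply: measurable_funX.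
  move=> x; rewrite powR_mulrn// (exprM _ 2 3) real_normK ?num_real//.
  rewrite exprSr ler_wpM2r ?sqr_ge0//.
  rewrite -mulrA (_ : 4 * (M * D) = (2 * (Num.sqrt M * Num.sqrt D)) ^+ 2).
    by rewrite ler_sqr ?nnegrE ?sqr_ge0// !mulr_ge0// sqrtr_ge0.
  by rewrite !exprMn !sqr_sqrtr ?ltW// -natrX.
have c0 : 0 < 4 * M * D by rewrite !mulr_gt0.
apply: (@le_trans _ _ ((4 * M * D)%:E * M%:E)%E).
  by apply: lee_wpmul2l; rewrite // lee_fin ltW.
by rewrite -EFinM lee_fin le_eqVlt; apply/orP; left; apply/eqP; ring.
Qed.

(** This [t] balances the interpolation inequality in [gn_step]: both of its terms become multiples
    of [M ^ (2 / (m + 1)) D]. *)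
Let gn_exponents (m M D : R) : 1 <= m -> 0 < M -> 0 < D ->
  let t := M `^ ((m - 1) / (m * (m + 1))) * D `^ (- m^-1) in
  t `^ (- m) * M = M `^ (2 / (m + 1)) * D /\
  t * ((2 * (Num.sqrt M * Num.sqrt D)) `^ (2 / m) * D) =
  2 `^ (2 / m) * (M `^ (2 / (m + 1)) * D).
Proof.
move=> m1 M0 D0 t.
have m0 : m != 0 by apply: lt0r_neq0; lra.
have m10 : m + 1 != 0 by apply: lt0r_neq0; lra.
rewrite {}/t.
(* With [M] and [D] written as exponentials, the claims become rational identities between
   exponents. *)
have [a ->] : exists a, M = expR a by exists (ln M); rewrite lnK.
have [b ->] : exists b, D = expR b by exists (ln D); rewrite lnK.
rewrite -!powR12_sqrt ?expR_ge0//; split.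
  rewrite -!expRM -!expRD -!expRM -!expRD; congr expR; field.
  by rewrite m0 m10.
rewrite [in LHS]powRM ?mulr_ge0 ?powR_ge0// -!expRM -!expRD -!expRM.
rewrite mulrCA -!mulrA; congr (_ * _).
by rewrite -!expRD; congr expR; field; rewrite m0 m10.
Qed.

(* The inequality in dimension [n] is applied on each slice [f (a, .)]; the slices have
   [L^2]-norm squared at most [sqrt (M D)], where [D = |d_1 f|_2^2]. *)
Let gn_step n (C : R) : (1 <= n)%N -> 0 < C ->
  (forall (f : 'rV[R]_n -> R) df, C1c f df -> forall M, 0 < M ->
    (sqint (lebesgue_rV n) f <= M%:E)%E ->
    (\int[lebesgue_rV n]_x (`|f x| `^ (2 + 4 / n%:R))%:E <=
    (C * M `^ (2 / n%:R))%:E * \sum_i sqint (lebesgue_rV n) (df i))%E) ->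
  forall (f : 'rV[R]_n.+1 -> R) df, C1c f df -> forall M, 0 < M ->
    (sqint (lebesgue_rV n.+1) f <= M%:E)%E ->
    (\int[lebesgue_rV n.+1]_x (`|f x| `^ (2 + 4 / n.+1%:R))%:E <=
    ((1 + C * 2 `^ (2 / n%:R)) * M `^ (2 / n.+1%:R))%:E *
      \sum_i sqint (lebesgue_rV n.+1) (df i))%E.
Proof.
move=> n1 C0 IH f df hf M M0 fM; have [mf mdf] := C1c_measurable hf.
apply: lee_mul_approx.
- by rewrite mulr_gt0 ?powR_gt0// ltr_wpDl// mulr_gt0// powR_gt0.
- by apply: sume_ge0 => i _; exact: sqint_ge0.
move=> D D0 fD.
have fD0 : (sqint (lebesgue_rV n.+1) (df ord0) <= D%:E)%E.
  apply: le_trans fD; rewrite big_ord_recl leeDl//.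
  by apply: sume_ge0 => i _; exact: sqint_ge0.
pose A : R := 2 * (Num.sqrt M * Num.sqrt D).
have A0 : 0 < A by rewrite !mulr_gt0// sqrtr_gt0.
set m : R := n%:R.
have m1 : 1 <= m by rewrite /m ler1n.
have m0 : 0 < m by lra.
have mS : n.+1%:R = m + 1 :> R by rewrite -natr1.
pose q : R := 2 + 4 / m.
have mq : measurable_fun setT (fun x => `|f x| `^ q).
  by apply: (@measurableT_comp _ _ _ _ _ _ (@powR R ^~ q)) => //; exact: measurableT_comp.
have mq' : measurable_fun setT (EFin \o (fun x => `|f x| `^ q)) by exact/measurable_EFinP.
have cA0 : 0 < C * A `^ (2 / m) by rewrite mulr_gt0// powR_gt0.
(* The inequality of dimension [n], with its own exponent [q], holds on each slice with the common
   mass bound [A]; integrating over the first coordinate gives the [q]-norm of [f]. *)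
have Q : (\int[lebesgue_rV n.+1]_x (`|f x| `^ q)%:E <= (C * A `^ (2 / m) * D)%:E)%E.
  rewrite (integral_rVS1 mq'); last by move=> x; rewrite lee_fin powR_ge0.
  apply: (@le_trans _ _ (\int[leb]_a ((C * A `^ (2 / m))%:E *
      \sum_i sqint (lebesgue_rV n) (fun v => df (lift ord0 i) (consrV (a, v)))))%E).
    apply: ge0_le_integral => //.
    - by move=> a _; apply: integral_ge0 => x _; rewrite lee_fin powR_ge0.
    - by apply: (measurable_rVS1 mq') => x; rewrite lee_fin powR_ge0.
    - apply: measurable_funeM; apply: emeasurable_sum => i.
      apply: (@measurable_rVS1 _ _ (fun x => (df (lift ord0 i) x ^+ 2)%:E)).
        by apply/measurable_EFinP; apply: measurable_funX.
      by move=> x; rewrite lee_fin sqr_ge0.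
    - move=> a _; apply: (IH _ _ (C1c_slice a hf) A A0).
      exact: sqint_slice_le_sqrt hf M0 D0 fM fD0.
  rewrite ge0_integralZl//; last 3 first.
  - apply: emeasurable_sum => i.
    apply: (@measurable_rVS1 _ _ (fun x => (df (lift ord0 i) x ^+ 2)%:E)).
      by apply/measurable_EFinP; apply: measurable_funX.
    by move=> x; rewrite lee_fin sqr_ge0.
  - by move=> a _; apply: sume_ge0 => i _; exact: sqint_ge0.
  - by rewrite lee_fin ltW.
  rewrite [in (_ * D)%:E]EFinM; apply: lee_wpmul2l; first by rewrite lee_fin ltW.
  rewrite ge0_integral_sum//; last 2 first.
  - move=> i; apply: (@measurable_rVS1 _ _ (fun x => (df (lift ord0 i) x ^+ 2)%:E)).
      by apply/measurable_EFinP; apply: measurable_funX.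
    by move=> x; rewrite lee_fin sqr_ge0.
  - by move=> i a _; exact: sqint_ge0.
  apply: le_trans fD; rewrite big_ord_recl.
  apply: le_trans (leeDr _ _); last exact: sqint_ge0.
  apply: lee_sum => i _; rewrite /sqint integral_rVS1//.
  - by apply/measurable_EFinP; apply: measurable_funX.
  - by move=> x; rewrite lee_fin sqr_ge0.
have [e1 e2] := gn_exponents m1 M0 D0.
set t := (X in X `^ (- m)) in e1; rewrite -/t in e2.
have t0 : 0 < t by rewrite mulr_gt0 ?powR_gt0.
(* The exponent of dimension [n + 1] lies strictly between 2 and [q], so it is reached by
   interpolation. *)
have p2 : 2 < 2 + 4 / n.+1%:R :> R by rewrite ltrDl divr_gt0.
have pq : 2 + 4 / n.+1%:R < q by rewrite /q ltrD2l ltr_pM2l// ltf_pV2 ?posrE// mS; lra.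
apply: (le_trans (integral_interpolation (lebesgue_rV n.+1) p2 pq t0 mf)).
have -> : (2 + 4 / n.+1%:R - 2) / (q - (2 + 4 / n.+1%:R)) = m :> R.
  rewrite /q mS; field; rewrite !gt_eqF//; lra.
apply: (@le_trans _ _ ((t `^ (- m))%:E * M%:E + t%:E * (C * A `^ (2 / m) * D)%:E)%E).
  by apply: leeD; apply: lee_wpmul2l; rewrite // lee_fin ?powR_ge0 ?(ltW t0).
rewrite -!EFinM -EFinD lee_fin e1 mS.
have -> : t * (C * A `^ (2 / m) * D) = C * (t * (A `^ (2 / m) * D)) by ring.
by rewrite e2 le_eqVlt; apply/orP; left; apply/eqP; ring.
Qed.

Lemma gagliardo_nirenberg n : exists2 C : R, 0 < C &
  forall (f : 'rV[R]_n.+1 -> R) df, C1c f df -> forall M, 0 < M ->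
    (sqint (lebesgue_rV n.+1) f <= M%:E)%E ->
    (\int[lebesgue_rV n.+1]_x (`|f x| `^ (2 + 4 / n.+1%:R))%:E <=
    (C * M `^ (2 / n.+1%:R))%:E * \sum_i sqint (lebesgue_rV n.+1) (df i))%E.
Proof.
elim: n => [|n [C C0 IH]]; first by exists 4 => //; exact: gn_base.
exists (1 + C * 2 `^ (2 / n.+1%:R)); first by rewrite ltr_wpDl// mulr_gt0// powR_gt0.
exact: gn_step IH.
Qed.

End gagliardo_nirenberg.

(** * Test functions *)

Section line_inv.
Context {R : realType}.

Lemma is_derive_line_inv (U V : normedModType R) (i : U -> V) (f : V -> R) x u v d :
  (forall h : R, i (h *: u + x) = h *: v + i x) ->
  is_derive x u (f \o i) d -> is_derive (i x) v f d.
Proof.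
move=> iE [df fE].
have E : (fun h : R => h^-1 *: (((f \o i) \o shift x) (h *: u) - (f \o i) x)) =
         (fun h : R => h^-1 *: ((f \o shift (i x)) (h *: v) - f (i x))).
  by apply/funext => h /=; rewrite iE.
split; first by rewrite /derivable -E.
by rewrite -fE /derive E.
Qed.

(** Only the derivative along [v] is assumed, not differentiability, so [f] is restricted to the
    line through [x] and the chain rule of one variable is applied there. *)
Lemma is_derive_dirZ (V : normedModType R) (f : V -> R) (x v : V) (a d : R) :
  is_derive x v f d -> is_derive x (a *: v) f (a * d).
Proof.
move=> df; pose i (t : R) := t *: v + x; pose j (t : R) := t *: (a *: v) + x.
have i0 : i 0 = x by rewrite /i scale0r add0r.
have j0 : j 0 = x by rewrite /j scale0r add0r.
have dfi : is_derive (0 : R) 1 (f \o i) d.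
  apply: (is_derive_line (v := v)); last by rewrite i0.
  by move=> h; rewrite /i scale0r add0r addr0 (_ : h *: 1 = h) //; exact: mulr1.
rewrite -{1}j0; apply: (is_derive_line_inv (u := 1 : R)).
  by move=> h; rewrite /j scale0r add0r addr0 (_ : h *: 1 = h) //; exact: mulr1.
have -> : f \o j = (f \o i) \o ( *%R a).
  by apply/funext => t; rewrite /= /i /j scalerA mulrC.
rewrite mulrC; apply: is_derive1_comp; first by rewrite mulr0.
by apply: (is_derive_eq (is_deriveZ a (is_derive_id (0 : R) 1))); exact: mulr1.
Qed.

Lemma continuous_pair (S U V : topologicalType) (f : S -> U) (g : S -> V) :
  continuous f -> continuous g -> continuous (fun x => (f x, g x)).
Proof.
move=> cf cg z.
by apply: (@cvg_pair _ _ _ (nbhs z) (nbhs (f z)) (nbhs (g z))); [exact: cf|exact: cg].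
Qed.

End line_inv.

Section test_functions.
Context {R : realType} (N : nat).
Local Notation X := ('rV[R]_N * R)%type.
Implicit Types (f phi : X -> R) (v z : X).

(** [smooth] quantifies over all iterated derivatives. It is proved by exhibiting a class of
    functions that is stable under differentiation. *)
Lemma smooth_coind (K : (X -> R) -> Prop) :
  (forall f, K f -> [/\ continuous f, forall z v, derivable f z v &
    forall v, K ('D_v f)]) -> forall f, K f -> smooth f.
Proof.
move=> H f Kf s.
suff Kg : K (foldr (fun v h => 'D_v h) f s) by have [? ? _] := H _ Kg; split.
by elim: s => //= v s IH; have [_ _] := H _ IH; apply.
Qed.

Lemma smooth_derive f v : smooth f -> smooth ('D_v f).
Proof.
move=> sf s; have := sf (rcons s v).
by rewrite -cats1 foldr_cat.
Qed.

Lemma smooth_cont f : smooth f -> continuous f.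
Proof. by move=> /(_ [::])[]. Qed.

Lemma smooth_is_derive f z v : smooth f -> is_derive z v f ('D_v f z).
Proof. by move=> /(_ [::])[_] df; apply: derivableP; exact: df. Qed.

Section tensor.
Variables (a b c : R).

(** One map for two purposes: a dilation in x ([b = 0], [c = 1]), and a zoom onto the slice at
    height [b] ([a = 1], [c] small). *)
Definition affine z : X := (a *: z.1, b + c * z.2).

Lemma affineE (h : R) v z : affine (h *: v + z) = h *: (a *: v.1, c * v.2) + affine z.
Proof.
rewrite /affine; congr pair; rewrite /=.
  by rewrite scalerDr !scalerA mulrC.
rewrite mulrDr addrCA; congr (_ + _).
by rewrite /GRing.scale /= mulrCA.
Qed.

Lemma continuous_affine : continuous affine.
Proof.
apply: continuous_pair => z.
  by apply: cvgZl_tmp; exact: cvg_fst.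
apply: cvgD; first exact: cvg_cst.
by apply: cvgM; [exact: cvg_cst|exact: cvg_snd].
Qed.

(** The class given to [smooth_coind]. Sums are included because the product rule turns one product
    into two. *)
Inductive tens : (X -> R) -> Prop :=
| tens1 phi (g : {poly R}) : smooth phi ->
    tens (fun z => phi (affine z) * g.[z.2])
| tensD f1 f2 : tens f1 -> tens f2 -> tens (fun z => f1 z + f2 z).

Lemma is_derive_tensor phi (g : {poly R}) z v : smooth phi ->
  is_derive z v (fun z => phi (affine z) * g.[z.2])
   ('D_(a *: v.1, c * v.2) phi (affine z) * g.[z.2] +
    phi (affine z) * (v.2 *: g^`())%R.[z.2]).
Proof.
move=> sphi.
have h1 : is_derive z v (phi \o affine) ('D_(a *: v.1, c * v.2) phi (affine z)).
  by apply: is_derive_line (smooth_is_derive _ _ sphi) => h; exact: affineE.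
have h2 : is_derive z v (horner g \o snd) ((v.2 *: g^`())%R.[z.2]).
  apply: (@is_derive_line _ _ _ snd (horner g) z v v.2) => //.
  rewrite hornerZ -{1}[v.2]mulr1.
  by apply: (@is_derive_dirZ _ _ _ _ (1 : R)); exact: is_derive_poly.
have := is_deriveM h1 h2; rewrite /=; set d := (X in is_derive _ _ _ X).
move=> h; apply: (is_derive_eq h); rewrite /d /GRing.scale /= addrC; congr (_ + _).
by rewrite mulrC.
Qed.

Lemma tens_smooth f : tens f -> smooth f.
Proof.
apply: smooth_coind => {}f; elim => {f}.
- move=> phi g sphi.
  have df z v := is_derive_tensor g z v sphi.
  split.
  + move=> z; apply: cvgM.
      by apply: continuous_comp; [exact: continuous_affine|exact: smooth_cont].
    by apply: continuous_comp; [exact: cvg_snd|exact: continuous_horner].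
  + by move=> z v; have [] := df z v.
  + move=> v.
    have -> : 'D_v (fun z => phi (affine z) * g.[z.2]) =
      (fun z => 'D_(a *: v.1, c * v.2) phi (affine z) * g.[z.2] +
                 phi (affine z) * (v.2 *: g^`())%R.[z.2]).
      by apply/funext => z; exact: derive_val.
    apply: tensD; last exact: (tens1 _ sphi).
    by apply: (@tens1 ('D_(a *: v.1, c * v.2) phi)); exact: smooth_derive.
- move=> f1 f2 t1 [c1 d1 D1] t2 [c2 d2 D2]; split.
  + by move=> z; apply: cvgD; [exact: c1|exact: c2].
  + by move=> z v; apply: derivableD.
  + move=> v; have -> : 'D_v (fun z => f1 z + f2 z) = (fun z => 'D_v f1 z + 'D_v f2 z).
      by apply/funext => z; exact: deriveD.
    exact: tensD.
Qed.

End tensor.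

Local Notation Cc := (@Cc_infty R N setT).

Lemma Cc_smooth phi : Cc phi -> smooth phi. Proof. by case. Qed.

Lemma Cc_cont phi : Cc phi -> continuous phi.
Proof. by move=> /Cc_smooth/smooth_cont. Qed.

Lemma Cc_is_derive phi z v : Cc phi -> is_derive z v phi ('D_v phi z).
Proof. by move=> /Cc_smooth/smooth_is_derive. Qed.

Lemma supp_derive phi v : supp ('D_v phi) `<=` supp phi.
Proof.
rewrite /supp [X in _ `<=` X](closure_id _).1; last exact: closed_closure.
apply: closureS => z /= /eqP Dz; apply: contrapT => nz.
apply: Dz.
have oz : open (~` closure [set z | phi z != 0]) by exact/closed_openC/closed_closure.
have : \forall y \near z, phi y = cst 0 y.
  have := open_nbhs_nbhs (conj oz nz); apply: filterS => y ny.
  by apply: contrapT => /eqP py; apply: ny; exact: subset_closure.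
move=> /(near_eq_derive v) ->; exact: derive_cst.
Qed.

Lemma Cc_derive phi v : Cc phi -> Cc ('D_v phi).
Proof.
move=> [sphi cphi _]; split; [exact: smooth_derive| |by []].
apply: subclosed_compact cphi _; first exact: closed_closure.
exact: supp_derive.
Qed.

Lemma Cc_bounded phi : Cc phi -> exists2 K : R, 0 < K & forall z, `|phi z| <= K.
Proof.
move=> Cphi; have [sphi cphi _] := Cphi.
have cim : compact (phi @` supp phi).
  by apply: continuous_compact => //; apply: continuous_subspaceT; exact: Cc_cont.
have [M [Mr HM]] := compact_bounded cim.
exists (`|M| + 1); first by rewrite ltr_wpDl.
move=> z; have [->|nz] := eqVneq (phi z) 0; first by rewrite normr0 addr_ge0.
apply: (HM (`|M| + 1)); first by rewrite (le_lt_trans (ler_norm _))// ltrDl.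
by exists z => //; exact: subset_closure.
Qed.

Lemma Cc_box phi : Cc phi -> exists2 B : R, 0 < B & forall z, phi z != 0 ->
  (forall i, `|z.1 ord0 i| <= B) /\ `|z.2| <= B.
Proof.
move=> [_ cphi _]; have [M [Mr HM]] := compact_bounded cphi.
exists (`|M| + 1); first by rewrite ltr_wpDl.
move=> z nz.
have : `|z| <= `|M| + 1.
  apply: (HM (`|M| + 1)); first by rewrite (le_lt_trans (ler_norm _))// ltrDl.
  exact: subset_closure.
rewrite prod_normE ge_max => /andP[h1 h2]; split => // i.
apply: le_trans h1.
rewrite -[leRHS]/(mx_norm _) mx_normrE.
by have := le_bigmax_cond 0 (fun k : 'I_1 * 'I_N => `|z.1 k.1 k.2|) (isT : predT (ord0, i)).
Qed.

Lemma Cc_tensor phi (a b c : R) (g : {poly R}) : Cc phi -> a != 0 -> c != 0 ->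
  Cc (fun z => phi (affine a b c z) * g.[z.2]).
Proof.
move=> Cphi a0 c0; have [sphi cphi _] := Cphi; split; last by [].
  by apply: tens_smooth; exact: tens1.
(* The inverse of [affine]: the new support lies in the image under [inv] of a compact set, whatever
   the polynomial does at infinity. *)
pose inv (z : X) : X := (a^-1 *: z.1, c^-1 * (z.2 - b)).
have cinv : continuous inv.
  apply: continuous_pair => z; first by apply: cvgZl_tmp; exact: cvg_fst.
  apply: cvgM; first exact: cvg_cst.
  by apply: cvgB; [exact: cvg_snd|exact: cvg_cst].
have ci : compact (inv @` supp phi).
  by apply: continuous_compact => //; exact: continuous_subspaceT.
apply: subclosed_compact ci _; first exact: closed_closure.
have cl : closed (affine a b c @^-1` supp phi).
  apply: preimage_closed; last exact: closed_closure.
  by move=> z _; exact: continuous_affine.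
have sub : affine a b c @^-1` supp phi `<=` inv @` supp phi.
  move=> z /= zs; exists (affine a b c z) => //.
  rewrite /inv /affine /= scalerA mulVf// scale1r addrAC subrr add0r.
  by rewrite mulrA mulVf// mul1r; case: (z).
apply: subset_trans sub.
rewrite [X in _ `<=` X](closure_id _).1//; apply: closureS => z /=.
by rewrite mulf_eq0 negb_or => /andP[nz _]; exact: subset_closure.
Qed.

Lemma derive_tensor_dirx phi (a b c : R) (g : {poly R}) z i : Cc phi ->
  'D_(dirx i) (fun z => phi (affine a b c z) * g.[z.2]) z =
  a * 'D_(dirx i) phi (affine a b c z) * g.[z.2].
Proof.
move=> Cphi; have h := is_derive_tensor a b c g z (dirx i) (Cc_smooth Cphi).
rewrite derive_val /= scale0r horner0 [X in _ + X]mulr0 addr0; congr (_ * _).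
have -> : (a *: delta_mx ord0 i, c * 0) = a *: dirx i :> X.
  by rewrite mulr0 /dirx; congr pair; rewrite /= /GRing.scale /= mulr0.
have h' := is_derive_dirZ a (Cc_is_derive (affine a b c z) (dirx i) Cphi).
by rewrite derive_val.
Qed.

Lemma derive_tensor_diry phi (a b c : R) (g : {poly R}) z : Cc phi ->
  'D_(diry N) (fun z => phi (affine a b c z) * g.[z.2]) z =
  c * 'D_(diry N) phi (affine a b c z) * g.[z.2] + phi (affine a b c z) * g^`().[z.2].
Proof.
move=> Cphi; have h := is_derive_tensor a b c g z (diry N) (Cc_smooth Cphi).
rewrite derive_val /= scale1r; congr (_ * _ + _).
have -> : (a *: 0, c * 1) = c *: diry N :> X by rewrite /diry; congr pair; rewrite /= !scaler0.
have h' := is_derive_dirZ c (Cc_is_derive (affine a b c z) (diry N) Cphi).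
by rewrite derive_val.
Qed.

Lemma Cc_slice phi y : Cc phi ->
  C1c (fun x => phi (x, y)) (fun i x => 'D_(dirx i) phi (x, y)).
Proof.
move=> Cphi.
have cy : continuous (fun x : 'rV[R]_N => (x, y) : X).
  by apply: continuous_pair; [move=> x; exact: cvg_id|exact: cst_continuous].
split.
- by move=> x; apply: continuous_comp; [exact: cy|exact: Cc_cont].
- move=> i x.
  apply: (@continuous_comp _ _ _ (fun x => (x, y) : X) ('D_(dirx i) phi)); first exact: cy.
  by apply: Cc_cont; exact: Cc_derive.
- by have [B _ HB] := Cc_box Cphi; exists B => x /HB[].
- move=> i x; apply: (is_derive_line (i := fun x => (x, y) : X) _ (Cc_is_derive _ _ Cphi)).
  by move=> h; congr pair; rewrite /= /GRing.scale /= mulr0 add0r.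
Qed.

(** Transported to [continuous_measurable_rV] by identifying R^N x R with R^(N+1). *)
Lemma continuous_measurable_X f : continuous f -> measurable_fun setT f.
Proof.
move=> cf.
pose u (x : 'rV[R]_N.+1) : X := let z := unconsrV x in (z.2, z.1).
have cu : continuous u.
  apply: continuous_pair => x /=; last exact: coord_continuous.
  have FF : Filter (nbhs x) by exact: nbhs_filter.
  apply/cvgrPdist_le => e e0; near=> w.
  rewrite -[leLHS]/(mx_norm _) mx_normrE; apply: bigmax_le; first exact: ltW.
  move=> [i j] _ /=; rewrite (ord1 i) !mxE /=.
  apply: (@le_trans _ _ `|x - w|).
    rewrite -[leRHS]/(mx_norm _) mx_normrE.
    by have := le_bigmax_cond 0 (fun i : 'I_1 * 'I_N.+1 => `|(x - w) i.1 i.2|) (isT : predT (ord0, lift ord0 j)); rewrite !mxE.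
  near: w; exact: cvgr_dist_le.
have mfu : measurable_fun setT (f \o u).
  apply: continuous_measurable_rV => x.
  by apply: continuous_comp; [exact: cu|exact: cf].
have -> : f = (f \o u) \o (fun z : X => consrV (z.2, z.1)).
  by apply/funext => z; rewrite /= /u consrVK; case: z.
apply: measurableT_comp => //.
apply: (measurableT_comp (measurable_consrV (n := N))).
by apply/measurable_fun_pairP; split; [exact: measurable_snd|exact: measurable_fst].
Unshelve. all: by end_near. Qed.

End test_functions.

(** * Functions on a strip *)

Section L2_facts.
Context d (T : measurableType d) (R : realType) (m : {measure set T -> \bar R}).
Implicit Types f g : T -> R.

Lemma powR_Lnorm_EFin (r : R) f : r != 0 ->
  ('N[m]_r%:E[EFin \o f] `^ r = \int[m]_x (`|f x| `^ r)%:E)%E.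
Proof.
by move=> r0; rewrite poweR_Lnorm//; apply: eq_integral => x _; rewrite /= poweR_EFin.
Qed.

Lemma sqint_Lnorm f : ('N[m]_2%:E[EFin \o f] `^ 2 = sqint m f)%E.
Proof.
rewrite powR_Lnorm_EFin; last by [].
by apply: eq_integral => x _; rewrite powR_mulrn// real_normK ?num_real.
Qed.

Lemma Lfun2P f : f \in Lfun m 2%:E <->
  measurable_fun setT f /\ (sqint m f < +oo)%E.
Proof.
split=> [|[mf fy]].
  rewrite inE => /andP[]; rewrite !inE /= => mf fy; split => //.
  by rewrite -sqint_Lnorm; exact: poweR_lty.
apply/andP; split; rewrite !inE//=.
by apply: (@lty_poweRy _ _ 2); rewrite // sqint_Lnorm.
Qed.

Lemma Lfun2_sqint f : f \in Lfun m 2%:E -> sqint m f \is a fin_num.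
Proof. by move=> /Lfun2P[_ fy]; rewrite ge0_fin_numE// sqint_ge0. Qed.

Lemma Lfun2_measurable f : f \in Lfun m 2%:E -> measurable_fun setT f.
Proof. by move=> /Lfun2P[]. Qed.

Lemma L2_cvgP (fs : nat -> T -> R) f : L2_cvg m fs f <->
  forall e : R, 0 < e -> \forall k \near \oo, (sqint m (fs k \- f)%R <= e%:E)%E.
Proof.
rewrite /L2_cvg; split => [H e e0|H].
  have se : 0 < Num.sqrt e by rewrite sqrtr_gt0.
  have := H [set x | (x < (Num.sqrt e)%:E)%E]; rewrite /= => H1.
  have : \forall k \near \oo, ('N[m]_2%:E[EFin \o (fs k \- f)%R] < (Num.sqrt e)%:E)%E.
    apply: H1; apply: open_nbhs_nbhs; split; first exact: open_ereal_lt_ereal.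
    by rewrite /= lte_fin.
  apply: filterS => k kl; rewrite -sqint_Lnorm.
  rewrite -(sqr_sqrtr (ltW e0)) -powR_mulrn ?sqrtr_ge0// -poweR_EFin.
  apply: gt0_ler_poweR => //; last exact: ltW.
  - by rewrite in_itv/= leey andbT Lnorm_ge0.
  - by rewrite in_itv/= leey andbT lee_fin sqrtr_ge0.
have H' (e : R) : 0 < e -> \forall k \near \oo, ('N[m]_2%:E[EFin \o (fs k \- f)%R] <= e%:E)%E.
  move=> e0; have := H (e ^+ 2); rewrite exprn_gt0// => /(_ isT).
  apply: filterS => k; rewrite -sqint_Lnorm => le2.
  have two0 : (2 : R) != 0 by [].
  have -> : ('N[m]_2%:E[EFin \o (fs k \- f)%R] =
      ('N[m]_2%:E[EFin \o (fs k \- f)%R] `^ 2) `^ 2^-1)%E.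
    by rewrite -poweRrM mulfV// poweRe1// Lnorm_ge0.
  have -> : e%:E = ((e ^+ 2)%:E `^ 2^-1)%E.
    by rewrite poweR_EFin -powR_mulrn ?(ltW e0)// -powRrM mulfV// powRr1// ltW.
  apply: gt0_ler_poweR => //.
  - by rewrite in_itv/= leey andbT poweR_ge0.
  - by rewrite in_itv/= leey andbT lee_fin sqr_ge0.
apply/fine_cvgP; split.
  have := H' 1 ltr01; apply: filterS => k k1.
  by rewrite ge0_fin_numE ?Lnorm_ge0// (le_lt_trans k1)// ltry.
apply/cvgrPdist_le => e e0; have := H' e e0; apply: filterS => k ke.
rewrite sub0r normrN /= ger0_norm ?fine_ge0 ?Lnorm_ge0//.
by rewrite -lee_fin fineK// ge0_fin_numE ?Lnorm_ge0// (le_lt_trans ke)// ltry.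
Qed.

(** Young's inequality for the square of [g + (f - g)]. The coefficient of [sqint m g] can be taken
    as close to 1 as desired, which makes [sqint] continuous along L^2 limits. *)
Lemma sqint_add_le f g (s : R) : 0 < s -> measurable_fun setT f ->
  measurable_fun setT g ->
  (sqint m f <= (1 + s)%:E * sqint m g + (1 + s^-1)%:E * sqint m (f \- g)%R)%E.
Proof.
move=> s0 mf mg; have si : 0 < s^-1 by rewrite invr_gt0.
apply: le_sqint_lin2 => //.
- exact: measurable_funB.
- by rewrite addr_ge0// ltW.
- by rewrite addr_ge0// ltW.
move=> x; rewrite -subr_ge0 /=.
rewrite (_ : _ - _ = s^-1 * (s * g x - (f x - g x)) ^+ 2); last by field; rewrite gt_eqF.
by rewrite mulr_ge0 ?sqr_ge0// ltW.
Qed.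

Lemma L2_cvg_sqint_le (fs : nat -> T -> R) f (e : R) :
  (forall k, measurable_fun setT (fs k)) -> f \in Lfun m 2%:E ->
  L2_cvg m fs f -> 0 < e ->
  \forall k \near \oo, (sqint m (fs k) <= sqint m f + e%:E)%E /\
    (sqint m f <= sqint m (fs k) + e%:E)%E.
Proof.
move=> mfs Lf /L2_cvgP H e0; have [mf fy] := (Lfun2P f).1 Lf.
have ffin := Lfun2_sqint Lf.
pose M := fine (sqint m f).
have M0 : 0 <= M by rewrite fine_ge0// sqint_ge0.
have fM : sqint m f = M%:E by rewrite fineK.
(* Chosen so that [s M <= e / 4]; [b] below then makes the contribution of the difference at most
   [e / 4]. *)
pose s := Num.min 1 (e / (4 * (M + 1))).
have M1 : 0 < M + 1 by rewrite ltr_wpDl.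
have s0 : 0 < s by rewrite lt_min ltr01 divr_gt0// mulr_gt0.
have s1 : s <= 1 by rewrite ge_min lexx.
have sM : s * M <= e / 4.
  apply: (@le_trans _ _ (e / (4 * (M + 1)) * M)).
    by apply: ler_wpM2r => //; rewrite ge_min lexx orbT.
  rewrite invfM mulrA -mulrA ger_pMr; last by rewrite divr_gt0.
  by rewrite mulrC ler_pdivrMr// mul1r lerDl.
have c0 : 0 < 1 + s^-1 by rewrite ltr_wpDl// invr_gt0.
pose b := e / 4 / (1 + s^-1).
have b0 : 0 < b by rewrite !divr_gt0.
have bE : (1 + s^-1) * b = e / 4 by rewrite /b mulrC divfK// gt_eqF.
have := H b b0; apply: filterS => k kd.
have mk := mfs k.
have h1 := sqint_add_le s0 mk mf.
have h2 := sqint_add_le s0 mf mk.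
have sym : sqint m (f \- fs k)%R = sqint m (fs k \- f)%R.
  by apply: eq_integral => x _; rewrite /= -sqrrN opprB.
rewrite sym in h2.
have h3 : ((1 + s^-1)%:E * sqint m (fs k \- f)%R <= (e / 4)%:E)%E.
  by rewrite -bE EFinM; apply: lee_wpmul2l => //; rewrite lee_fin ltW.
have kM : (sqint m (fs k) <= ((1 + s) * M + e / 4)%:E)%E.
  apply: (le_trans h1); rewrite [X in (_ <= X)%E]EFinD; apply: leeD => //.
  by rewrite fM -EFinM.
have kfin : sqint m (fs k) \is a fin_num.
  by rewrite ge0_fin_numE ?sqint_ge0// (le_lt_trans kM)// ltry.
split.
  by apply: (le_trans kM); rewrite fM -EFinD lee_fin; lra.
apply: (le_trans h2); move: kM h3; rewrite -(fineK kfin); set K := fine _.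
rewrite lee_fin => kM h3.
apply: (@le_trans _ _ (((1 + s) * K)%:E + (e / 4)%:E)%E).
  by rewrite EFinM; apply: leeD.
rewrite -!EFinD lee_fin.
have K0 : 0 <= K by rewrite fine_ge0// sqint_ge0.
have : s * K <= s * ((1 + s) * M + e / 4) by apply: ler_wpM2l => //; exact: ltW.
have : s * (s * M) <= 1 * (s * M) by apply: ler_wpM2r => //; rewrite mulr_ge0// ltW.
have : s * e <= 1 * e by rewrite ler_pM2r.
lra.
Qed.

End L2_facts.

(** * Fubini on a strip, and the measure of boxes *)

Section strip_integral.
Context {R : realType} (N : nat).
Local Notation X := ('rV[R]_N * R)%type.
Local Notation XT := ('rV[R]_N * measurableTypeR R)%type.
Implicit Types (f : XT -> R) (l : R).

Lemma lebesgue_itvT l : 0 < l -> lebesgue_itv l setT = l%:E.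
Proof.
move=> l0; rewrite /lebesgue_itv /mrestr setTI lebesgue_measure_itv/=.
by rewrite lte_fin l0 oppr0 adde0.
Qed.

Lemma integral_lebesgue_itv_cst l (c : \bar R) : 0 < l ->
  (\int[lebesgue_itv l]_x c = c * l%:E)%E.
Proof. by move=> l0; rewrite integral_cst//; congr (_ * _)%E; exact: lebesgue_itvT. Qed.

Lemma strip_yx l (F : XT -> \bar R) : measurable_fun setT F ->
  (forall z, 0 <= F z)%E ->
  (\int[strip N l]_z F z =
   \int[lebesgue_itv l]_y \int[lebesgue_rV N]_x F (x, y))%E.
Proof.
by move=> mF F0; exact: (@fubini_tonelli2 _ _ _ _ _ (lebesgue_rV N) (lebesgue_itv l) F mF F0).
Qed.

Lemma strip_xy l (F : XT -> \bar R) : measurable_fun setT F ->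
  (forall z, 0 <= F z)%E ->
  (\int[strip N l]_z F z =
   \int[lebesgue_rV N]_x \int[lebesgue_itv l]_y F (x, y))%E.
Proof.
by move=> mF F0; exact: (@fubini_tonelli1 _ _ _ _ _ (lebesgue_rV N) (lebesgue_itv l) F mF F0).
Qed.

Lemma measurable_strip_x (F : XT -> \bar R) : measurable_fun setT F ->
  (forall z, 0 <= F z)%E ->
  measurable_fun setT (fun y : measurableTypeR R => \int[lebesgue_rV N]_x F (x, y))%E.
Proof.
by move=> mF F0; exact: (measurable_fun_fubini_tonelli_G (m1 := lebesgue_rV N) _ mF F0).
Qed.

Lemma measurable_strip_y l (F : XT -> \bar R) : measurable_fun setT F ->
  (forall z, 0 <= F z)%E ->
  measurable_fun setT (fun x : 'rV[R]_N => \int[lebesgue_itv l]_y F (x, y))%E.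
Proof.
by move=> mF F0; exact: (measurable_fun_fubini_tonelli_F (m2 := lebesgue_itv l) _ mF F0).
Qed.

Lemma continuous_measurable_strip (f : X -> R) : continuous f ->
  measurable_fun (@setT XT) f.
Proof. exact: continuous_measurable_X. Qed.

Lemma measurable_slice_x f y : measurable_fun setT f ->
  measurable_fun setT (fun x => f (x, y)).
Proof. by move=> mf; apply: (measurableT_comp mf); exact: measurable_pair2. Qed.

Lemma measurable_slice_y f x : measurable_fun setT f ->
  measurable_fun setT (fun y => f (x, y)).
Proof. by move=> mf; apply: (measurableT_comp mf); exact: measurable_pair1. Qed.

Lemma measurable_sqr f : measurable_fun setT f ->
  measurable_fun setT (fun z => (f z ^+ 2)%:E).
Proof. by move=> mf; apply/measurable_EFinP; exact: measurable_funX. Qed.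

Lemma sqint_strip l f : measurable_fun setT f ->
  (sqint (strip N l) f =
   \int[lebesgue_itv l]_y sqint (lebesgue_rV N) (fun x => f (x, y)))%E.
Proof.
move=> mf; rewrite /sqint strip_yx//; first exact: measurable_sqr.
by move=> z; rewrite lee_fin sqr_ge0.
Qed.

Lemma measurable_sqint_slice f : measurable_fun setT f ->
  measurable_fun setT (fun y : measurableTypeR R => sqint (lebesgue_rV N) (fun x => f (x, y))).
Proof.
move=> mf; apply: (@measurable_strip_x (fun z => (f z ^+ 2)%:E)); first exact: measurable_sqr.
by move=> z; rewrite lee_fin sqr_ge0.
Qed.

(** Used with [h] the indicator of an interval: boxes have finite measure. *)
Lemma integral_rV_prod n (h : R -> R) : measurable_fun setT h -> (forall t, 0 <= h t) ->
  (\int[lebesgue_measure]_t (h t)%:E < +oo)%E ->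
  (\int[lebesgue_rV n]_x (\prod_(i < n) h (x ord0 i))%:E < +oo)%E.
Proof.
move=> mh h0 hy; elim: n => [|n IH].
  under eq_integral do rewrite big_ord0.
  by rewrite integral_cst// mul1e /= diracT ltry.
have mp k : measurable_fun setT (fun x : 'rV[R]_k => \prod_(i < k) h (x ord0 i)).
  apply: measurable_prod => i _.
  by apply: measurableT_comp => //; exact: measurable_coord.
rewrite integral_rVS1; last 2 first.
- by apply/measurable_EFinP; exact: mp.
- by move=> x; rewrite lee_fin prodr_ge0.
set I := (\int[lebesgue_rV n]_x _)%E in IH.
have I0 : (0 <= I)%E by apply: integral_ge0 => x _; rewrite lee_fin prodr_ge0.
have Ifin : I \is a fin_num by rewrite ge0_fin_numE.
have e a : (\int[lebesgue_rV n]_v (\prod_(i < n.+1) h (consrV (a, v) ord0 i))%:E =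
    (fine I * h a)%:E)%E.
  under eq_integral => v _.
    rewrite big_ord_recl mxE unlift_none /=.
    under eq_bigr do rewrite mxE liftK /=.
    rewrite EFinM; over.
  rewrite ge0_integralZl_EFin//; last 2 first.
  - by move=> v _; rewrite lee_fin prodr_ge0.
  - by apply/measurable_EFinP; exact: mp.
  by rewrite EFinM fineK// muleC.
under eq_integral do rewrite e EFinM.
rewrite ge0_integralZl_EFin//; last 3 first.
- by move=> a _; rewrite lee_fin.
- exact/measurable_EFinP.
- exact: fine_ge0.
by rewrite lte_mul_pinfty// ?lee_fin ?fine_ge0.
Qed.

End strip_integral.

(** * Integrals of derivatives over the line and over R^n *)

Section one_dim.
Context {R : realType}.
Local Notation leb := (@lebesgue_measure R).

Lemma integral_itv_cc l (f : measurableTypeR R -> \bar R) : 0 < l ->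
  measurable_fun setT f -> (forall x, 0 <= f x)%E ->
  (\int[leb]_(x in `[0%R, l]) f x = \int[lebesgue_itv l]_x f x)%E.
Proof.
move=> l0 mf f0; rewrite integral_lebesgue_itv//.
rewrite -integral_itv_bndo_bndc; last by apply: measurable_funTS.
rewrite -integral_itv_obnd_cbnd//; apply: measurable_funTS => //.
Qed.

Lemma le_integral_lebesgue_itv l (f g : measurableTypeR R -> \bar R) :
  measurable_fun setT f -> measurable_fun setT g ->
  (forall x, 0 <= f x)%E -> (forall x, 0 <= g x)%E ->
  (forall x, 0 < x < l -> (f x <= g x)%E) ->
  (\int[lebesgue_itv l]_x f x <= \int[lebesgue_itv l]_x g x)%E.
Proof.
move=> mf mg f0 g0 fg; rewrite !integral_lebesgue_itv//.
apply: ge0_le_integral => //.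
- exact: measurable_funTS.
- exact: measurable_funTS.
Qed.

(** That the derivative has integral 0 is expressed with its positive and negative parts: both are
    nonnegative, so the equality can be integrated over further variables by Tonelli. *)
Lemma integral_derive_posneg (F F' : R -> R) (a b : R) : a < b ->
  (forall t : R, is_derive t 1 F (F' t)) -> continuous F' -> F a = F b ->
  (\int[leb]_(t in `[a, b]) (Num.max (F' t) 0)%:E =
   \int[leb]_(t in `[a, b]) (Num.max (- F' t) 0)%:E)%E.
Proof.
move=> ab dF cF' Fab; have := integral_derive ab dF cF'.
rewrite Fab subrr integralE.
have e1 : (\int[leb]_(x in `[a, b]) ((fun t => (F' t)%:E)^\+ x) =
    \int[leb]_(t in `[a, b]) (Num.max (F' t) 0)%:E)%E.
  by apply: eq_integral => x _; rewrite funeposE EFin_max.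
have e2 : (\int[leb]_(x in `[a, b]) ((fun t => (F' t)%:E)^\- x) =
    \int[leb]_(t in `[a, b]) (Num.max (- F' t) 0)%:E)%E.
  by apply: eq_integral => x _; rewrite funenegE EFin_max EFinN.
rewrite e1 e2; set U := (\int[_]_(_ in _) _)%E; set V := (\int[_]_(_ in _) _)%E.
have V0 : (0 <= V)%E by apply: integral_ge0 => x _; rewrite lee_fin le_max lexx orbT.
case: U => [u| |]; case: V V0 => [v| |] //= _.
by rewrite -EFinB => -[] /eqP; rewrite subr_eq0 => /eqP ->.
Qed.

Lemma C1c_mul n (f g : 'rV[R]_n -> R) df dg : C1c f df ->
  continuous g -> (forall i, continuous (dg i)) ->
  (forall i x, is_derive x (delta_mx ord0 i : 'rV[R]_n) g (dg i x)) ->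
  C1c (fun x => f x * g x) (fun i x => f x * dg i x + g x * df i x).
Proof.
move=> [cf cdf [B fB] hdf] cg cdg hdg; split.
- by move=> x; exact: (continuousM (cf x) (cg x)).
- move=> i x.
  exact: (continuousD (continuousM (cf x) (cdg i x)) (continuousM (cg x) (cdf i x))).
- by exists B => x; rewrite mulf_eq0 negb_or => /andP[/fB].
- by move=> i x; exact: (is_deriveM (hdf i x) (hdg i x)).
Qed.

Lemma C1c_integral_derive n (f : 'rV[R]_n -> R) df i : C1c f df ->
  (\int[lebesgue_rV n]_x (Num.max (df i x) 0)%:E =
   \int[lebesgue_rV n]_x (Num.max (- df i x) 0)%:E)%E.
Proof.
elim: n f df i => [|n IH] f df i; first by case: i.
move=> hf; have [mf mdf] := C1c_measurable hf.
have mp : measurable_fun setT (fun x => (Num.max (df i x) 0)%:E).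
  by apply/measurable_EFinP; apply: measurable_maxr.
have mn : measurable_fun setT (fun x => (Num.max (- df i x) 0)%:E).
  by apply/measurable_EFinP; apply: measurable_maxr => //; exact: measurableT_comp.
have p0 x : (0 <= (Num.max (df i x) 0)%:E)%E by rewrite lee_fin le_max lexx orbT.
have n0 x : (0 <= (Num.max (- df i x) 0)%:E)%E by rewrite lee_fin le_max lexx orbT.
case: (unliftP ord0 i) => [j ij|i0].
  rewrite (integral_rVS1 mp p0) (integral_rVS1 mn n0); apply: eq_integral => a _.
  by rewrite ij; exact: (IH _ _ j (C1c_slice a hf)).
rewrite (integral_rVS2 mp p0) (integral_rVS2 mn n0); apply: eq_integral => v _.
have [cf cdf [B fB] hdf] := hf.
pose F t := f (consrV (t, v)); pose F' t := df ord0 (consrV (t, v)).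
have dF (t : R) : is_derive t 1 F (F' t).
  apply: (is_derive_line (i := fun a => consrV (a, v)) _ (hdf _ _)).
  by move=> x; rewrite consrV_ord0.
have cF' : continuous F'.
  by move=> t; apply: continuous_comp; [exact: continuous_consrVl|exact: cdf].
pose b : R := `|B| + 1.
have b0 : 0 < b by rewrite ltr_wpDl.
have F0 t : `|B| < `|t| -> F t = 0.
  move=> Bt; apply/eqP; apply: contraT => /fB /(_ ord0); rewrite mxE unlift_none /=.
  by have := ler_norm B; lra.
have Fb : F b = 0 by apply: F0; rewrite (gtr0_norm b0) /b ltrDl.
have Fnb : F (- b) = 0 by apply: F0; rewrite normrN (gtr0_norm b0) /b ltrDl.
(* Thus the integrals over the whole line reduce to [[- b, b]], at whose ends [F] vanishes. *)
have F'0 t : t \notin `[- b, b] -> F' t = 0.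
  rewrite in_itv /= -ler_norml -ltNge => bt.
  have Bt : `|B| < `|t| by move: bt; rewrite /b; lra.
  rewrite -(@derive_val _ _ _ _ _ _ _ (dF t)).
  have : \forall y \near t, F y = cst 0 y.
    have : \forall y \near t, `|B| < `|y|.
      have FF : Filter (nbhs t) by exact: nbhs_filter.
      exact: (cvgr_gt _ (@norm_continuous R R t) _ Bt).
    by apply: filterS => y /F0.
  by move=> /(near_eq_derive (1 : R)) ->; exact: derive_cst.
have nbb : - b < b by lra.
have := integral_derive_posneg nbb dF cF'; rewrite Fb Fnb => /(_ erefl).
have restr (h : R -> R) : h 0 = 0 ->
  (\int[leb]_(t in `[(- b)%R, b]) (h (F' t))%:E = \int[leb]_t (h (F' t))%:E)%E.
  move=> h0; rewrite integral_mkcond; apply: eq_integral => t _.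
  rewrite patchE; case: ifPn => //; rewrite notin_setE /= => /negP tb.
  by rewrite F'0// h0.
rewrite (restr (fun t => Num.max t 0)) ?maxxx// (restr (fun t => Num.max (- t) 0)) ?oppr0 ?maxxx//.
by rewrite i0.
Qed.

End one_dim.

(** * Test functions on a strip: masses of slices and integration by parts *)

Section Cc_strip.
Context {R : realType} (N : nat).
Local Notation X := ('rV[R]_N * R)%type.
Local Notation XT := ('rV[R]_N * measurableTypeR R)%type.
Local Notation Cc := (@Cc_infty R N setT).
Implicit Types (phi psi : X -> R) (l s y : R).

(** [I] is the measure of the box. It does not depend on [f], so one constant serves all slices of a
    test function. *)
Lemma sqint_box_le (B : R) : exists2 I : R, 0 <= I & forall (f : 'rV[R]_N -> R) (K : R),
  measurable_fun setT f -> (forall x, `|f x| <= K) ->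
  (forall x, f x != 0 -> forall i, `|x ord0 i| <= B) ->
  (sqint (lebesgue_rV N) f <= (K ^+ 2 * I)%:E)%E.
Proof.
pose h : R -> R := \1_(`[- B, B]%classic).
have mh : measurable_fun setT h by exact: measurable_indic.
have h0 t : 0 <= h t by rewrite /h indicE.
have hy : (\int[lebesgue_measure]_t (h t)%:E < +oo)%E.
  have : (lebesgue_measure (`[(- B)%R, B]%classic : set (measurableTypeR R)) < +oo)%E.
    by rewrite lebesgue_measure_itv/=; case: ifP => _; rewrite ltry.
  by rewrite integral_indic// setIT.
have := integral_rV_prod N mh h0 hy; set I := (\int[_]_x _)%E => Iy.
have mp : measurable_fun setT (fun x : 'rV[R]_N => \prod_(i < N) h (x ord0 i)).
  apply: measurable_prod => i _.
  by apply: measurableT_comp => //; exact: measurable_coord.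
have I0 : (0 <= I)%E by apply: integral_ge0 => x _; rewrite lee_fin prodr_ge0.
have Ifin : I \is a fin_num by rewrite ge0_fin_numE.
exists (fine I); first exact: fine_ge0.
move=> f K mf fK fB; rewrite EFinM fineK// /I -ge0_integralZl_EFin ?sqr_ge0//; last 2 first.
- by move=> x _; rewrite lee_fin prodr_ge0.
- exact/measurable_EFinP.
under [X in (_ <= X)%E]eq_integral do rewrite -EFinM.
apply: ge0_le_integral_EFin => //.
- exact: measurable_funX.
- by apply: measurable_funM.
- by move=> x; rewrite sqr_ge0.
move=> x; have [->|fx] := eqVneq (f x) 0.
  by rewrite expr0n mulr_ge0 ?sqr_ge0 ?prodr_ge0.
rewrite big1 ?mulr1; last first.
  by move=> i _; rewrite /h indicE mem_set//= in_itv/= -ler_norml; exact: fB.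
by rewrite -[f x ^+ 2]real_normK ?num_real// ler_sqr ?nnegrE// (le_trans _ (fK x)).
Qed.

Lemma Cc_measurable phi : Cc phi -> measurable_fun (@setT XT) phi.
Proof. by move=> /Cc_cont/continuous_measurable_strip. Qed.

Lemma Cc_slice_bound phi : Cc phi -> exists2 C : R, 0 <= C & forall y : R,
  (sqint (lebesgue_rV N) (fun x => phi (x, y)) <= C%:E)%E.
Proof.
move=> Cphi; have [K K0 HK] := Cc_bounded Cphi; have [B _ HB] := Cc_box Cphi.
have [I I0 HI] := sqint_box_le B.
exists (K ^+ 2 * I); first by rewrite mulr_ge0 ?sqr_ge0.
move=> y; apply: HI => //.
- by apply: measurable_slice_x; exact: Cc_measurable.
- by move=> x /HB[].
Qed.

Lemma Cc_Lfun2 l phi : 0 < l -> Cc phi -> phi \in Lfun (strip N l) 2%:E.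
Proof.
move=> l0 Cphi; have mphi := Cc_measurable Cphi; apply/Lfun2P; split => //.
have [C C0 HC] := Cc_slice_bound Cphi.
rewrite sqint_strip//.
apply: (@le_lt_trans _ _ (\int[lebesgue_itv l]_y C%:E)%E).
  apply: ge0_le_integral => //.
  - by move=> y _; exact: sqint_ge0.
  - exact: measurable_sqint_slice.
by rewrite integral_lebesgue_itv_cst// -EFinM ltry.
Qed.

Lemma Cc_sqint_fin l phi : 0 < l -> Cc phi -> sqint (strip N l) phi \is a fin_num.
Proof. by move=> l0 Cphi; apply: Lfun2_sqint; exact: Cc_Lfun2. Qed.

Lemma Cc_line phi x (t : R) : Cc phi ->
  is_derive t 1 (fun t => phi (x, t)) ('D_(diry N) phi (x, t)).
Proof.
move=> Cphi; apply: (is_derive_line (i := fun t => (x, t) : X) _ (Cc_is_derive _ _ Cphi)).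
by move=> h; congr pair; rewrite /= scaler0 add0r.
Qed.

Lemma continuous_line (f : X -> R) x : continuous f -> continuous (fun t => f (x, t)).
Proof.
move=> cf t; apply: (@continuous_comp _ _ _ (fun t => (x, t) : X) f); last exact: cf.
by apply: continuous_pair; [exact: cst_continuous|move=> z; exact: cvg_id].
Qed.

(** The integral over the strip of the bound in [sqr_variation], taken in the direction y. *)
Definition variation l s phi : \bar R :=
  (s%:E * sqint (strip N l) phi + s^-1%:E * sqint (strip N l) ('D_(diry N) phi))%E.

Lemma variation_ge0 l s phi : 0 < s -> (0 <= variation l s phi)%E.
Proof.
move=> s0; rewrite /variation; apply: adde_ge0; apply: mule_ge0; rewrite ?sqint_ge0//.
  by rewrite lee_fin ltW.
by rewrite lee_fin invr_ge0 ltW.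
Qed.

(** [sqr_variation] between [y] and [y'] on each vertical segment, enlarged to the whole segment and
    integrated in x. *)
Lemma slice_variation l s phi y y' : 0 < l -> 0 < s -> Cc phi ->
  0 <= y <= l -> 0 <= y' <= l ->
  (sqint (lebesgue_rV N) (fun x => phi (x, y)) <=
   sqint (lebesgue_rV N) (fun x => phi (x, y')) + variation l s phi)%E.
Proof.
move=> l0 s0 Cphi /andP[y0 yl] /andP[y'0 y'l].
have si : 0 < s^-1 by rewrite invr_gt0.
have CD := Cc_derive (diry N) Cphi.
have mphi := Cc_measurable Cphi; have mD := Cc_measurable CD.
pose h (z : XT) : R := s * phi z ^+ 2 + s^-1 * 'D_(diry N) phi z ^+ 2.
have h0 z : 0 <= h z by rewrite addr_ge0// mulr_ge0 ?sqr_ge0// ltW.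
have mh : measurable_fun setT h.
  by apply: measurable_funD; apply: measurable_funM => //; apply: measurable_funX.
have mh' : measurable_fun setT (EFin \o h) by exact/measurable_EFinP.
have h0' z : (0 <= (EFin \o h) z)%E by rewrite lee_fin.
have -> : variation l s phi = (\int[strip N l]_z (EFin \o h) z)%E.
  apply/esym; apply: (@integral_lin2 _ XT R (strip N l) setT (fun z => phi z ^+ 2)
    (fun z => 'D_(diry N) phi z ^+ 2) s s^-1) => //.
  - exact: measurable_funX.
  - exact: measurable_funX.
  - by move=> z; rewrite sqr_ge0.
  - by move=> z; rewrite sqr_ge0.
  - exact: ltW.
  - exact: ltW.
rewrite (strip_xy _ mh' h0').
have my t : measurable_fun setT (fun x => (phi (x, t) ^+ 2)%:E).
  by apply/measurable_EFinP; apply: measurable_funX; exact: measurable_slice_x.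
rewrite /sqint -ge0_integralD//; last 3 first.
- by move=> x _; rewrite lee_fin sqr_ge0.
- by move=> x _; exact: integral_ge0.
- exact: (measurable_strip_y l mh' h0').
apply: ge0_le_integral => //.
- by move=> x _; rewrite lee_fin sqr_ge0.
- by apply: emeasurable_funD => //; exact: (measurable_strip_y l mh' h0').
move=> x _.
have dF t := Cc_line x t Cphi.
have cF' := @continuous_line _ x (Cc_cont CD).
have mhx : measurable_fun setT (fun t : measurableTypeR R => (h (x, t))%:E).
  by apply/measurable_EFinP; exact: (measurable_slice_y x mh).
have hx0 t : (0 <= (h (x, t))%:E)%E by rewrite lee_fin.
rewrite -(integral_itv_cc l0 mhx hx0).
have sub a b : 0 <= a -> b <= l -> (\int[lebesgue_measure]_(t in `[a, b]) (h (x, t))%:E <=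
    \int[lebesgue_measure]_(t in `[0%R, l]) (h (x, t))%:E)%E.
  move=> a0 bl; apply: ge0_subset_integral => //; first exact: measurable_funTS.
  by move=> t /=; rewrite !in_itv/= => /andP[at_ tb]; rewrite (le_trans a0)// (le_trans tb).
have key : (`|phi (x, y) ^+ 2 - phi (x, y') ^+ 2|%:E <=
    \int[lebesgue_measure]_(t in `[0%R, l]) (h (x, t))%:E)%E.
  have [yy'|y'y] := leP y y'.
    rewrite distrC; apply: le_trans (sub y y' y0 y'l).
    exact: sqr_variation yy' s0 dF cF'.
  apply: le_trans (sub y' y y'0 yl).
  exact: sqr_variation (ltW y'y) s0 dF cF'.
apply: le_trans (leeD (lexx _) key).
by rewrite -EFinD lee_fin -lerBlDl ler_norm.
Qed.

(** [slice_variation] averaged over the position of the second slice; in [strip_le_slice] the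
    average is over the first. *)
Lemma slice_le_strip l s phi y : 0 < l -> 0 < s -> Cc phi -> 0 <= y <= l ->
  (l%:E * sqint (lebesgue_rV N) (fun x => phi (x, y)) <=
   sqint (strip N l) phi + l%:E * variation l s phi)%E.
Proof.
move=> l0 s0 Cphi yl; have mphi := Cc_measurable Cphi.
rewrite muleC -(integral_lebesgue_itv_cst _ l0).
rewrite sqint_strip// (muleC l%:E) -(integral_lebesgue_itv_cst _ l0).
have mS := measurable_sqint_slice mphi.
rewrite -ge0_integralD//; last 2 first.
- by move=> t _; exact: sqint_ge0.
- by move=> t _; exact: variation_ge0.
apply: le_integral_lebesgue_itv => //.
- by apply: emeasurable_funD.
- by move=> t; exact: sqint_ge0.
- by move=> t; rewrite adde_ge0 ?sqint_ge0 ?variation_ge0.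
by move=> t /andP[t0 tl]; apply: slice_variation => //; rewrite !ltW.
Qed.

Lemma strip_le_slice l s phi y : 0 < l -> 0 < s -> Cc phi -> 0 <= y <= l ->
  (sqint (strip N l) phi <=
   l%:E * sqint (lebesgue_rV N) (fun x => phi (x, y)) + l%:E * variation l s phi)%E.
Proof.
move=> l0 s0 Cphi yl; have mphi := Cc_measurable Cphi.
rewrite sqint_strip// -ge0_muleDr ?sqint_ge0 ?variation_ge0// muleC.
rewrite -(integral_lebesgue_itv_cst _ l0).
apply: le_integral_lebesgue_itv => //.
- exact: measurable_sqint_slice.
- by move=> t; exact: sqint_ge0.
- by move=> t; rewrite adde_ge0 ?sqint_ge0 ?variation_ge0.
by move=> t /andP[t0 tl]; apply: slice_variation => //; rewrite !ltW.
Qed.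

Lemma strip_posneg l (G : X -> R) : continuous G ->
  (forall y, (\int[lebesgue_rV N]_x (Num.max (G (x, y)) 0)%:E =
             \int[lebesgue_rV N]_x (Num.max (- G (x, y)) 0)%:E)%E) \/
  (forall x, (\int[lebesgue_itv l]_y (Num.max (G (x, y)) 0)%:E =
             \int[lebesgue_itv l]_y (Num.max (- G (x, y)) 0)%:E)%E) ->
  \int[strip N l]_z G z = 0.
Proof.
move=> cG H; have mG := continuous_measurable_strip cG.
have mp : measurable_fun (@setT XT) (fun z => (Num.max (G z) 0)%:E).
  by apply/measurable_EFinP; apply: measurable_maxr.
have mn : measurable_fun (@setT XT) (fun z => (Num.max (- G z) 0)%:E).
  by apply/measurable_EFinP; apply: measurable_maxr => //; exact: measurableT_comp.
have p0 (z : XT) : (0 <= (Num.max (G z) 0)%:E)%E by rewrite lee_fin le_max lexx orbT.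
have n0 (z : XT) : (0 <= (Num.max (- G z) 0)%:E)%E by rewrite lee_fin le_max lexx orbT.
have E : (\int[strip N l]_z (Num.max (G z) 0)%:E =
    \int[strip N l]_z (Num.max (- G z) 0)%:E)%E.
  case: H => H.
    by rewrite (strip_yx _ mp p0) (strip_yx _ mn n0); apply: eq_integral => y _.
  by rewrite (strip_xy _ mp p0) (strip_xy _ mn n0); apply: eq_integral => x _.
rewrite /Rintegral integralE.
have -> : (\int[strip N l]_x ((fun t => (G t)%:E)^\+ x) =
    \int[strip N l]_t (Num.max (G t) 0)%:E)%E.
  by apply: eq_integral => x _; rewrite funeposE EFin_max.
have -> : (\int[strip N l]_x ((fun t => (G t)%:E)^\- x) =
    \int[strip N l]_t (Num.max (- G t) 0)%:E)%E.
  by apply: eq_integral => x _; rewrite funenegE EFin_max EFinN.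
(* If both parts are infinite, [fine] of their difference is 0 by convention. *)
rewrite E; set V := (\int[_]_(_ in _) _)%E; case: V => [v| |] //=.
by rewrite subrr.
Qed.

Lemma Cc_sub (U : set X) phi : Cc_infty U phi -> Cc phi.
Proof. by case=> sphi cphi _; split. Qed.

Lemma Cc_strip_eq0 l psi x y : Cc_infty [set z | 0 < z.2 < l] psi ->
  ~~ (0 < y < l) -> psi (x, y) = 0.
Proof.
move=> [_ _ sub] yl; apply/eqP; apply: contraT => nz.
have zs : supp psi (x, y) by apply: (@subset_closure _ [set z | psi z != 0]).
by have := sub _ zs => /= yl'; rewrite yl' in yl.
Qed.

Let ibp l v phi psi : 0 < l -> Cc phi -> Cc psi ->
  \int[strip N l]_z (phi z * 'D_v psi z + psi z * 'D_v phi z) = 0 ->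
  \int[strip N l]_z (phi z * 'D_v psi z) = - \int[strip N l]_z ('D_v phi z * psi z).
Proof.
move=> l0 Cphi Cpsi H.
have L2 f : Cc f -> f \in Lfun (strip N l) 2%:E by exact: Cc_Lfun2.
have i1 : (strip N l).-integrable setT (EFin \o (fun z => phi z * 'D_v psi z)).
  by apply/Lfun1_integrable; apply: Lfun2_mul_Lfun1; apply: L2 => //; exact: Cc_derive.
have i2 : (strip N l).-integrable setT (EFin \o (fun z => psi z * 'D_v phi z)).
  by apply/Lfun1_integrable; apply: Lfun2_mul_Lfun1; apply: L2 => //; exact: Cc_derive.
move: H; rewrite RintegralD// => /eqP; rewrite addr_eq0 => /eqP ->.
by congr (- _); apply: eq_Rintegral => z _; rewrite mulrC.
Qed.

Let continuous_ibp v phi psi : Cc phi -> Cc psi ->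
  continuous (fun z => phi z * 'D_v psi z + psi z * 'D_v phi z).
Proof.
move=> Cphi Cpsi z.
have c1 := Cc_cont Cphi; have c2 := Cc_cont Cpsi.
have c3 := Cc_cont (Cc_derive v Cphi); have c4 := Cc_cont (Cc_derive v Cpsi).
exact: (continuousD (continuousM (c1 z) (c4 z)) (continuousM (c2 z) (c3 z))).
Qed.

Lemma integration_by_parts_dirx l i phi psi : 0 < l -> Cc phi -> Cc psi ->
  \int[strip N l]_z (phi z * 'D_(dirx i) psi z) =
  - \int[strip N l]_z ('D_(dirx i) phi z * psi z).
Proof.
move=> l0 Cphi Cpsi; apply: ibp => //.
apply: strip_posneg; first exact: continuous_ibp.
left => y; have [c2 c3 _ d2] := Cc_slice y Cpsi.
exact: (C1c_integral_derive i (C1c_mul (Cc_slice y Cphi) c2 c3 d2)).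
Qed.

Lemma integration_by_parts_diry l phi psi : 0 < l -> Cc phi ->
  Cc_infty [set z | 0 < z.2 < l] psi ->
  \int[strip N l]_z (phi z * 'D_(diry N) psi z) =
  - \int[strip N l]_z ('D_(diry N) phi z * psi z).
Proof.
move=> l0 Cphi psiU; have Cpsi := Cc_sub psiU; apply: ibp => //.
have cG := continuous_ibp (v := diry N) Cphi Cpsi.
apply: strip_posneg => //; right => x.
have cGx := @continuous_line _ x cG.
have mGx := continuous_measurable_fun cGx.
rewrite -!integral_itv_cc//; try by (move=> t; rewrite lee_fin le_max lexx orbT).
- apply: (integral_derive_posneg (F := fun t => phi (x, t) * psi (x, t))) => //.
    by move=> t; exact: (is_deriveM (Cc_line x t Cphi) (Cc_line x t Cpsi)).
  by rewrite !(Cc_strip_eq0 x psiU) ?mulr0// ltxx// andbF.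
- by apply/measurable_EFinP; apply: measurable_maxr => //; exact: measurableT_comp.
- by apply/measurable_EFinP; apply: measurable_maxr.
Qed.

End Cc_strip.

(** * The Gagliardo-Nirenberg inequality on a strip, applied slice by slice *)

Section gn_strip.
Context {R : realType} (n : nat).
Local Notation N := n.+1.
Local Notation X := ('rV[R]_N * R)%type.
Local Notation XT := ('rV[R]_N * measurableTypeR R)%type.

(** The inequality of R^N is applied to each slice in x and integrated in y. By [slice_le_strip] the
    mass of any slice is at most [(1 / l + 1) A], so the y-derivative enters only through [A]. *)
Lemma gagliardo_nirenberg_strip (l : R) : 0 < l -> exists2 C : R, 0 < C &
  forall (phi : X -> R) (s A : R), Cc_infty setT phi -> 1 <= s -> 0 < A ->
  (s%:E * sqint (strip N l) phi + s^-1%:E * sqint (strip N l) ('D_(diry N) phi) <= A%:E)%E ->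
  (\int[strip N l]_z (`|phi z| `^ (2 + 4 / N%:R))%:E <=
   (C * A `^ (2 / N%:R))%:E * \sum_i sqint (strip N l) ('D_(dirx i) phi))%E.
Proof.
move=> l0; have [C0 C00 HC0] := @gagliardo_nirenberg R n.
have c0 : 0 < l^-1 + 1 by rewrite ltr_wpDl// invr_ge0 ltW.
exists (C0 * (l^-1 + 1) `^ (2 / N%:R)); first by rewrite mulr_gt0// powR_gt0.
move=> phi s A Cphi s1 A0 HA; have s0 : 0 < s by rewrite (lt_le_trans ltr01).
have mphi := Cc_measurable Cphi.
have slice y : 0 < y < l -> (sqint (lebesgue_rV N) (fun x => phi (x, y)) <= ((l^-1 + 1) * A)%:E)%E.
  move=> /andP[y0 yl].
  have yl' : 0 <= y <= l by rewrite !ltW.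
  (* This is where [1 <= s] is used. *)
  have MA : (sqint (strip N l) phi <= A%:E)%E.
    apply: le_trans HA; rewrite -[leLHS]adde0; apply: leeD; last first.
      by rewrite mule_ge0 ?sqint_ge0// lee_fin invr_ge0 ltW.
    by rewrite -[leLHS]mul1e; apply: lee_wpmul2r; rewrite ?sqint_ge0 ?lee_fin.
  have lS : (l%:E * sqint (lebesgue_rV N) (fun x => phi (x, y)) <= (A + l * A)%:E)%E.
    apply: (le_trans (slice_le_strip l0 s0 Cphi yl')); rewrite EFinD EFinM; apply: leeD => //.
    by apply: lee_wpmul2l => //; rewrite lee_fin ltW.
  rewrite -(@lee_pmul2l _ l%:E)// ?lte_fin//; apply: (le_trans lS).
  by rewrite -EFinM lee_fin le_eqVlt; apply/orP; left; apply/eqP; field; rewrite gt_eqF.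
have lA0 : 0 < (l^-1 + 1) * A by rewrite mulr_gt0.
have K0 : 0 < C0 * ((l^-1 + 1) * A) `^ (2 / N%:R) by rewrite mulr_gt0// powR_gt0.
have mq : measurable_fun (@setT XT) (fun z => (`|phi z| `^ (2 + 4 / N%:R))%:E).
  apply/measurable_EFinP.
  by apply: (@measurableT_comp _ _ _ _ _ _ (@powR R ^~ _)) => //; exact: measurableT_comp.
have q0 (z : XT) : (0 <= (`|phi z| `^ (2 + 4 / N%:R))%:E)%E by rewrite lee_fin powR_ge0.
rewrite (strip_yx _ mq q0).
have mD i := Cc_measurable (Cc_derive (dirx i) Cphi).
have -> : C0 * (l^-1+1) `^ (2/N%:R) * A `^ (2/N%:R) = C0 * ((l^-1+1)*A) `^ (2/N%:R)
  by rewrite powRM ?(ltW A0) ?(ltW c0)// mulrA.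
under [X in (_ <= _ * X)%E]eq_bigr do rewrite sqint_strip//.
rewrite -ge0_integral_sum//; last 2 first.
- by move=> i; exact: (measurable_sqint_slice (mD i)).
- by move=> i y _; exact: sqint_ge0.
rewrite -ge0_integralZl//; last 3 first.
- by apply: emeasurable_sum => i; exact: (measurable_sqint_slice (mD i)).
- by move=> y _; apply: sume_ge0 => i _; exact: sqint_ge0.
- by rewrite lee_fin ltW.
apply: le_integral_lebesgue_itv.
- exact: (measurable_strip_x mq q0).
- by apply: measurable_funeM; apply: emeasurable_sum => i; exact: (measurable_sqint_slice (mD i)).
- by move=> y; apply: integral_ge0.
- move=> y; apply: mule_ge0; first by rewrite lee_fin ltW.
  by apply: sume_ge0 => i _; exact: sqint_ge0.
- by move=> y yl; exact: (HC0 _ _ (Cc_slice y Cphi) _ lA0 (slice y yl)).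
Qed.

End gn_strip.

(** * Approximation in H^1 *)

Lemma continuous_powR_norm (R : realType) (q : R) : 0 < q ->
  continuous (fun y : R => `|y| `^ q).
Proof.
move=> q0 y; have [->|y0] := eqVneq y 0.
  rewrite /continuous_at normr0 powR0 ?gt_eqF//.
  apply/cvgrPdist_le => e e0.
  have r0 : 0 < e `^ q^-1 by rewrite powR_gt0.
  have : \forall t \near (0 : R), `|0 - t| <= e `^ q^-1.
    by have := @cvgrPdist_le _ R _ (nbhs (0 : R)) _ id 0; case => /(_ (@cvg_id _ _)) + _; apply.
  apply: filterS => t; rewrite !sub0r !normrN (ger0_norm (powR_ge0 _ _)) => te.
  rewrite -[leRHS](powRr1 (ltW e0)) -(mulVf (lt0r_neq0 q0)) powRrM.
  by apply: ge0_ler_powR => //; rewrite ?nnegrE ?powR_ge0// ltW.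
apply: (@continuous_comp _ _ _ (fun y : R => `|y|) (@powR R ^~ q)).
  exact: norm_continuous.
have ny : 0 < `|y| by rewrite normr_gt0.
apply: differentiable_continuous; apply/derivable1_diffP.
by apply: derivable_powR; rewrite in_itv/= ny.
Qed.

(** * Limits in L^2: pairings, almost everywhere convergence, Fatou's lemma *)

Section L2_limits.
Context d (T : measurableType d) (R : realType) (m : {measure set T -> \bar R}).
Implicit Types f g h : T -> R.

Lemma Lfun2_sub f g : f \in Lfun m 2%:E -> g \in Lfun m 2%:E ->
  (f \- g)%R \in Lfun m 2%:E.
Proof.
move=> /Lfun2P[mf fy] /Lfun2P[mg gy]; apply/Lfun2P; split; first exact: measurable_funB.
have : (sqint m (f \- g)%R <= 2%:E * sqint m f + 2%:E * sqint m g)%E.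
  apply: le_sqint_lin2 => //; first exact: measurable_funB.
  by move=> x /=; have := sqr_ge0 (f x + g x); nra.
move/le_lt_trans; apply; rewrite lte_add_pinfty//.
- by rewrite lte_mul_pinfty.
- by rewrite lte_mul_pinfty.
Qed.

Lemma sqint_triangle f g h : measurable_fun setT f -> measurable_fun setT g ->
  measurable_fun setT h ->
  (sqint m (f \- h)%R <= 2%:E * sqint m (f \- g)%R + 2%:E * sqint m (g \- h)%R)%E.
Proof.
move=> mf mg mh; apply: le_sqint_lin2 => //; try exact: measurable_funB.
by move=> x /=; have := sqr_ge0 (f x - g x - (g x - h x)); nra.
Qed.

(** Cauchy-Schwarz in the form of Young's inequality with a free weight [t]. *)
Lemma norm_Rintegral_mul_le f g (t e : R) : 0 < t ->
  f \in Lfun m 2%:E -> g \in Lfun m 2%:E ->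
  (t%:E * sqint m f + t^-1%:E * sqint m g <= e%:E)%E ->
  `|\int[m]_x (f x * g x)| <= e.
Proof.
move=> t0 Lf Lg le_e; have /Lfun1_integrable fgI := Lfun2_mul_Lfun1 Lf Lg.
have [mf _] := (Lfun2P m f).1 Lf; have [mg _] := (Lfun2P m g).1 Lg.
apply: (le_trans (le_normr_Rintegral measurableT fgI)).
rewrite -lee_fin; apply: le_trans le_e; rewrite /Rintegral fineK; last first.
  exact: integrable_fin_num (integrable_norm fgI).
apply: le_integral_lin2 => //.
- by apply: measurable_funX.
- by apply: measurable_funX.
- by apply: measurableT_comp => //; exact: measurable_funM.
- by move=> x; exact: sqr_ge0.
- by move=> x; exact: sqr_ge0.
- exact: ltW.
- by rewrite invr_ge0 ltW.
move=> x /=; rewrite normrM -[f x ^+ 2]real_normK ?num_real// -[g x ^+ 2]real_normK ?num_real//.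
have a0 := normr_ge0 (f x); have b0 := normr_ge0 (g x).
move: `|f x| `|g x| a0 b0 => a b a0 b0.
apply: (@le_trans _ _ (2 * (a * b))); first by nra.
rewrite -subr_ge0 (_ : _ - _ = t^-1 * (t * a - b) ^+ 2); last by field; rewrite gt_eqF.
by rewrite mulr_ge0 ?sqr_ge0// invr_ge0 ltW.
Qed.

Lemma L2_pairing_cvg (fs : nat -> T -> R) f g : (forall k, fs k \in Lfun m 2%:E) ->
  f \in Lfun m 2%:E -> g \in Lfun m 2%:E -> L2_cvg m fs f ->
  \int[m]_x (fs k x * g x) @[k --> \oo] --> \int[m]_x (f x * g x).
Proof.
move=> Lfs Lf Lg /L2_cvgP cvgf; apply/cvgrPdist_le => e e0.
pose G := fine (sqint m g).
have G0 : 0 <= G by rewrite fine_ge0// sqint_ge0.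
have gG : sqint m g = G%:E by rewrite fineK// Lfun2_sqint.
pose t := (2 * (G + 1)) / e.
have G1 : 0 < G + 1 by rewrite ltr_wpDl.
have t0 : 0 < t by rewrite divr_gt0// mulr_gt0.
have tG : t^-1 * G <= e / 2.
  rewrite invf_div mulrAC ler_pdivrMr ?mulr_gt0//; nra.
have b0 : 0 < t^-1 * (e / 2) by rewrite mulr_gt0 ?invr_gt0// divr_gt0.
have := cvgf _ b0; apply: filterS => k kd.
have /Lfun1_integrable I1 := Lfun2_mul_Lfun1 (Lfs k) Lg.
have /Lfun1_integrable I2 := Lfun2_mul_Lfun1 Lf Lg.
rewrite distrC -RintegralB//.
under eq_Rintegral do rewrite -mulrBl.
apply: (norm_Rintegral_mul_le t0 (Lfun2_sub (Lfs k) Lf) Lg).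
rewrite gG -EFinM; apply: (@le_trans _ _ ((e / 2)%:E + (e / 2)%:E)%E); last first.
  by rewrite -EFinD lee_fin -splitr.
apply: leeD; last by rewrite lee_fin.
apply: (@le_trans _ _ (t%:E * (t^-1 * (e / 2))%:E)%E).
  by apply: lee_wpmul2l => //; rewrite lee_fin ltW.
by rewrite -EFinM lee_fin mulrA mulfV ?mul1r// gt_eqF.
Qed.

(** The sum of the [g k] has finite integral, hence is finite almost everywhere, and the terms of a
    convergent series tend to 0. *)
Lemma ae_cvg0 (g : nat -> T -> \bar R) : (forall k, measurable_fun setT (g k)) ->
  (forall k x, 0 <= g k x)%E -> (forall k, \int[m]_x g k x <= (2 ^- k.+1)%:E)%E ->
  {ae m, forall x, forall e : R, 0 < e -> \forall k \near \oo, (g k x <= e%:E)%E}.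
Proof.
move=> mg g0 gle; pose h x := (\sum_(0 <= k <oo) g k x)%E.
have h0 x : (0 <= h x)%E by apply: nneseries_ge0.
have mh : measurable_fun setT h by apply: ge0_emeasurable_sum.
have hI : m.-integrable setT h.
  apply/integrableP; split => //.
  under eq_integral do rewrite gee0_abs//.
  rewrite integral_nneseries//.
  apply: (@le_lt_trans _ _ (\sum_(0 <= k <oo) (1 / (2 ^ k.+1)%:R)%:E)%E).
    apply: lee_nneseries => [k _ _|k _]; first exact: integral_ge0.
    by rewrite div1r natrX; exact: gle.
  by apply: le_lt_trans (epsilon_trick0 _ ler01) _; rewrite ltry.
have := integrable_ae measurableT hI; apply: filterS => x /(_ I) hx e e0.
have hy : (h x < +oo)%E by rewrite ltey_eq hx.
have := @nneseries_tail_cvg _ (g ^~ x) xpredT hy (fun k _ => g0 k x).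
move=> /(_ [set y | (y < e%:E)%E]) /= H.
have : \forall k \near \oo, (\sum_(k <= i <oo) g i x < e%:E)%E.
  apply: H; apply: open_nbhs_nbhs; split; first exact: open_ereal_lt_ereal.
  by rewrite /= lte_fin.
apply: filterS => k /ltW; apply: le_trans.
apply: le_trans (nneseries_lim_ge k.+1 _) => //.
by rewrite big_nat1.
Qed.

Lemma fatou_le (F : nat -> T -> \bar R) (G : T -> \bar R) (c : \bar R) :
  (forall k, measurable_fun setT (F k)) -> (forall k x, 0 <= F k x)%E ->
  measurable_fun setT G -> (forall x, 0 <= G x)%E ->
  {ae m, forall x, F ^~ x @ \oo --> G x} ->
  (forall k, \int[m]_x F k x <= c)%E -> (\int[m]_x G x <= c)%E.
Proof.
move=> mF F0 mG G0 FG Fc.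
have -> : (\int[m]_x G x = \int[m]_x limn_einf (F ^~ x))%E.
  apply: ge0_ae_eq_integral => //.
  - rewrite /limn_einf; apply: measurableT_comp => //.
    by apply: measurable_fun_limn_esup => k; exact: measurableT_comp.
  - by move=> x _; rewrite limn_einf_lim; apply: lime_ge; [exact: is_cvg_einfs|
      apply: nearW => k; apply: le_ereal_inf_tmp => _ [n _ <-]].
  - move: FG; apply: filterS => x FG _.
    by have [] := cvg_limn_einf_sup FG.
apply: (le_trans (fatou m measurableT mF (fun k x _ => F0 k x))).
rewrite limn_einf_lim; apply: lime_le; first exact: is_cvg_einfs.
apply: nearW => k; apply: ge_ereal_inf => //.
by exists (\int[m]_x F k x)%E => //; exists k => /=.
Qed.

(** A subsequence with squared errors at most [2 ^- k.+1] converges almost everywhere by [ae_cvg0],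
    and Fatou's lemma applies to it. *)
Lemma fatou_powR (fs : nat -> T -> R) f (q c : R) : 0 < q ->
  (forall k, measurable_fun setT (fs k)) -> measurable_fun setT f -> L2_cvg m fs f ->
  (\forall k \near \oo, \int[m]_x (`|fs k x| `^ q)%:E <= c%:E)%E ->
  (\int[m]_x (`|f x| `^ q)%:E <= c%:E)%E.
Proof.
move=> q0 mfs mf /L2_cvgP cvgf lec.
have /choice[s Hs] k : exists n, (sqint m (fs n \- f)%R <= (2 ^- k.+1)%:E)%E /\
    (\int[m]_x (`|fs n x| `^ q)%:E <= c%:E)%E.
  have e0 : (0 : R) < 2 ^- k.+1 by rewrite invr_gt0 exprn_gt0.
  by have [n [n1 n2]] := filter_ex (filterI (cvgf _ e0) lec); exists n.
apply: (@fatou_le (fun k x => (`|fs (s k) x| `^ q)%:E)) => //.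
- by move=> k; exact: measurable_powR_norm.
- exact: measurable_powR_norm.
- have : {ae m, forall x, forall e : R, 0 < e ->
      \forall k \near \oo, (((fs (s k) x - f x) ^+ 2)%:E <= e%:E)%E}.
    apply: ae_cvg0 => [k|k x|k].
    + by apply/measurable_EFinP; apply: measurable_funX; exact: measurable_funB.
    + by rewrite lee_fin sqr_ge0.
    + by have [] := Hs k.
  apply: filterS => x Hx; apply: cvg_EFin; first exact: nearW.
  apply: (@continuous_cvg _ _ _ _ _ _ (fun y : R => `|y| `^ q)).
    exact: continuous_powR_norm.
  apply/cvgrPdist_le => e e0; have := Hx (e ^+ 2); rewrite exprn_gt0// => /(_ isT).
  apply: filterS => k; rewrite lee_fin distrC -real_normK ?num_real//.
  by rewrite ler_pXn2r// nnegrE// ltW.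
- by move=> k; have [] := Hs k.
Qed.

End L2_limits.

Section approximation.
Context {R : realType} (N : nat).
Local Notation X := ('rV[R]_N * R)%type.
Local Notation XT := ('rV[R]_N * measurableTypeR R)%type.
Local Notation Cc := (@Cc_infty R N setT).
Implicit Types (f g : X -> R) (l a : R) (phi : nat -> X -> R).

(** Convergence in H^1 of the strip, with [fx] and [fy] as mere functions: that they are the weak
    derivatives of [f] is deduced in [approx_sobolev]. [trace_of] is [is_trace] unbundled in the
    same way. *)
Definition approx l phi f (fx : 'I_N -> X -> R) (fy : X -> R) :=
  [/\ forall k, Cc (phi k),
      L2_cvg (strip N l) phi f,
      forall i, L2_cvg (strip N l) (fun k => 'D_(dirx i) (phi k)) (fx i) &
      L2_cvg (strip N l) (fun k => 'D_(diry N) (phi k)) fy].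

Definition trace_of l f fx fy a (t : 'rV[R]_N -> R) :=
  t \in Lfun (lebesgue_rV N) 2%:E /\ exists2 phi, approx l phi f fx fy & L2_cvg (lebesgue_rV N) (fun k x => phi k (x, a)) t.

Lemma is_trace_of l (u : sobolev N l) a t : is_trace u a t <->
  trace_of l u (sob_dx u) (sob_dy u) a t.
Proof.
split=> -[Lt].
  by move=> [phi [h1 h2 h3 h4 h5]]; split => //; exists phi.
by move=> [phi [h1 h2 h3 h4] h5]; split => //; exists phi.
Qed.

Lemma approx_weak_derivative l (v : X) phi f g : 0 < l -> (forall k, Cc (phi k)) ->
  f \in Lfun (strip N l) 2%:E -> g \in Lfun (strip N l) 2%:E ->
  L2_cvg (strip N l) phi f -> L2_cvg (strip N l) (fun k => 'D_v (phi k)) g ->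
  (forall k psi, Cc_infty [set z | 0 < z.2 < l] psi ->
    \int[strip N l]_z (phi k z * 'D_v psi z) = - \int[strip N l]_z ('D_v (phi k) z * psi z)) ->
  weak_derivative l v f g.
Proof.
move=> l0 Cphi Lf Lg phif phig ibp psi Cpsi.
have Cpsi' := Cc_sub Cpsi.
have Lphi k := Cc_Lfun2 l0 (Cphi k).
have LDphi k := Cc_Lfun2 l0 (Cc_derive v (Cphi k)).
have c1 := L2_pairing_cvg Lphi Lf (Cc_Lfun2 l0 (Cc_derive v Cpsi')) phif.
have c2 := cvgN (L2_pairing_cvg LDphi Lg (Cc_Lfun2 l0 Cpsi') phig).
rewrite (_ : (fun k => _) = (fun k => - \int[strip N l]_z ('D_v (phi k) z * psi z))) in c1.
  exact: (cvg_unique _ c1 (c2 _)).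
by apply/funext => k; rewrite ibp.
Qed.

Lemma approx_sobolev l phi f fx fy : 0 < l -> f \in Lfun (strip N l) 2%:E ->
  (forall i, fx i \in Lfun (strip N l) 2%:E) -> fy \in Lfun (strip N l) 2%:E ->
  approx l phi f fx fy ->
  exists u : sobolev N l, [/\ sob_val u = f, sob_dx u = fx & sob_dy u = fy].
Proof.
move=> l0 Lf Lfx Lfy [Cphi cf cfx cfy].
have wx i : weak_derivative l (dirx i) f (fx i).
  apply: (approx_weak_derivative l0 Cphi Lf (Lfx i) cf (cfx i)) => k psi /Cc_sub Cpsi.
  exact: integration_by_parts_dirx.
have wy : weak_derivative l (diry N) f fy.
  apply: (approx_weak_derivative l0 Cphi Lf Lfy cf cfy) => k psi.
  exact: integration_by_parts_diry.
by exists (Sobolev Lf Lfx Lfy wx wy).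
Qed.

Lemma H1_approx (G : metric_graph R) (f : edge G -> X -> R) fx fy :
  (forall e, f e \in Lfun (strip N (len e)) 2%:E) ->
  (forall e i, fx e i \in Lfun (strip N (len e)) 2%:E) ->
  (forall e, fy e \in Lfun (strip N (len e)) 2%:E) ->
  (forall e s e' s', endpoint e s = endpoint e' s' ->
    exists t, trace_of (len e) (f e) (fx e) (fy e) (end_pos e s) t /\
      trace_of (len e') (f e') (fx e') (fy e') (end_pos e' s') t) ->
  exists u : H1 N G, forall e,
    [/\ sob_val (u e) = f e, sob_dx (u e) = fx e & sob_dy (u e) = fy e].
Proof.
move=> Lf Lfx Lfy Htr.
have ex e : exists u : sobolev N (len e),
    [/\ sob_val u = f e, sob_dx u = fx e & sob_dy u = fy e].
  (* An end compared with itself provides an approximating sequence on every edge. *)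
  have [t [[_ [phi aphi _]] _]] := Htr e true e true erefl.
  exact: approx_sobolev (len_gt0 e) (Lf e) (Lfx e) (Lfy e) aphi.
pose w e := sval (cid (ex e)).
have wP e : [/\ sob_val (w e) = f e, sob_dx (w e) = fx e & sob_dy (w e) = fy e].
  exact: svalP (cid (ex e)).
have trw e s e' s' : endpoint e s = endpoint e' s' ->
    exists t, is_trace (w e) (end_pos e s) t /\ is_trace (w e') (end_pos e' s') t.
  move=> /Htr[t [t1 t2]]; exists t; have [v1 x1 y1] := wP e; have [v2 x2 y2] := wP e'.
  by split; apply/is_trace_of; rewrite ?v1 ?x1 ?y1 ?v2 ?x2 ?y2.
by exists (MkH1 trw).
Qed.

End approximation.

(** * Dilations *)

Lemma L2_cvg_le d d' (T : measurableType d) (T' : measurableType d') (R : realType)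
    (m : {measure set T -> \bar R}) (m' : {measure set T' -> \bar R})
    (fs : nat -> T -> R) f (gs : nat -> T' -> R) g (K : R) : 0 < K ->
  (forall k, (sqint m' (gs k \- g)%R <= K%:E * sqint m (fs k \- f)%R)%E) ->
  L2_cvg m fs f -> L2_cvg m' gs g.
Proof.
move=> K0 le_K /L2_cvgP cvgf; apply/L2_cvgP => e e0.
have eK : 0 < K^-1 * e by rewrite mulr_gt0 ?invr_gt0.
have := cvgf _ eK; apply: filterS => k ke; apply: (le_trans (le_K k)).
apply: (@le_trans _ _ (K%:E * (K^-1 * e)%:E)%E).
  by apply: lee_wpmul2l => //; rewrite lee_fin ltW.
by rewrite -EFinM mulrA mulfV ?mul1r// gt_eqF.
Qed.

Section dilation.
Context {R : realType} (N : nat).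
Local Notation X := ('rV[R]_N * R)%type.
Local Notation XT := ('rV[R]_N * measurableTypeR R)%type.
Local Notation Cc := (@Cc_infty R N setT).
Variables (c : R) (c0 : 0 < c).
Local Notation dil := (@affine R N c 0 1).
Implicit Types (f g : X -> R) (l a b : R) (phi : nat -> X -> R).

Lemma measurable_dil : measurable_fun (@setT XT) (dil : XT -> XT).
Proof.
apply/measurable_fun_pairP; split.
  by apply: (measurableT_comp (measurable_scalerV c)); exact: measurable_fst.
rewrite (_ : _ \o _ = snd); first exact: measurable_snd.
by apply/funext => z; rewrite /affine /= add0r mul1r.
Qed.

Lemma ge0_integral_strip_dil l (F : XT -> \bar R) : measurable_fun setT F ->
  (forall z, 0 <= F z)%E ->
  (\int[strip N l]_z F (dil z) = (c ^- N)%:E * \int[strip N l]_z F z)%E.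
Proof.
move=> mF F0; have mFd : measurable_fun (@setT XT) (fun z : XT => F (dil z)).
  exact: measurableT_comp mF measurable_dil.
rewrite (strip_yx _ mFd (fun z => F0 (dil z))) (strip_yx _ mF F0).
rewrite -ge0_integralZl//; last 3 first.
- exact: measurable_strip_x.
- by move=> y _; exact: integral_ge0.
- by rewrite lee_fin invr_ge0 exprn_ge0// ltW.
apply: eq_integral => y _; rewrite -(@ge0_integral_scalerV _ _ c (fun x => F (x, y)))//.
- by apply: eq_integral => x _; rewrite /affine /= add0r mul1r.
- by apply: (measurableT_comp mF); exact: measurable_pair2.
Qed.

Let factor_gt0 b : b != 0 -> 0 < b ^+ 2 * c ^- N.
Proof.
by move=> b0; apply: mulr_gt0; [rewrite exprn_even_gt0|rewrite invr_gt0 exprn_gt0].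
Qed.

Lemma sqint_dil l b f : measurable_fun (@setT XT) f ->
  sqint (strip N l) (fun z => f (dil z) * b) = ((b ^+ 2 * c ^- N)%:E * sqint (strip N l) f)%E.
Proof.
move=> mf; have mfd := measurableT_comp mf measurable_dil.
have -> : sqint (strip N l) (fun z => f (dil z) * b) =
    sqint (strip N l) (fun z => b * (f \o dil) z).
  by apply: eq_integral => z _; rewrite mulrC.
rewrite (sqintZ _ b mfd) [in RHS]EFinM -[RHS]muleA; congr (_ * _)%E.
apply: (@ge0_integral_strip_dil l (fun z => (f z ^+ 2)%:E)).
  by apply/measurable_EFinP; exact: measurable_funX.
by move=> z; rewrite lee_fin sqr_ge0.
Qed.

Lemma sqint_dilV b (f : 'rV[R]_N -> R) : measurable_fun setT f ->
  sqint (lebesgue_rV N) (fun x => f (c *: x) * b) =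
  ((b ^+ 2 * c ^- N)%:E * sqint (lebesgue_rV N) f)%E.
Proof.
move=> mf; have mfd := measurableT_comp mf (measurable_scalerV c).
have -> : sqint (lebesgue_rV N) (fun x => f (c *: x) * b) =
    sqint (lebesgue_rV N) (fun x => b * (f \o [eta *:%R c]) x).
  by apply: eq_integral => x _; rewrite mulrC.
rewrite (sqintZ _ b mfd) [in RHS]EFinM -[RHS]muleA; congr (_ * _)%E.
apply: (@ge0_integral_scalerV _ _ _ (fun z => (f z ^+ 2)%:E)) => //.
  by apply/measurable_EFinP; exact: measurable_funX.
by move=> z; rewrite lee_fin sqr_ge0.
Qed.

Lemma integral_powR_dil l b f (r : R) : 0 < b -> measurable_fun (@setT XT) f ->
  (\int[strip N l]_z (`|f (dil z) * b| `^ r)%:E =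
   (b `^ r * c ^- N)%:E * \int[strip N l]_z (`|f z| `^ r)%:E)%E.
Proof.
move=> b0 mf.
have mr : measurable_fun (@setT XT) (fun z : XT => (`|f z| `^ r)%:E).
  apply/measurable_EFinP.
  by apply: (@measurableT_comp _ _ _ _ _ _ (@powR R ^~ _)) => //; exact: measurableT_comp.
have r0 (z : XT) : (0 <= (`|f z| `^ r)%:E)%E by rewrite lee_fin powR_ge0.
transitivity (\int[strip N l]_z ((b `^ r)%:E * (`|f (dil z)| `^ r)%:E))%E.
  apply: eq_integral => z _.
  by rewrite normrM (gtr0_norm b0) mulrC powRM ?(ltW b0)// EFinM.
pose h (z : XT) := (`|f (dil z)| `^ r)%:E.
have mh : measurable_fun setT h := measurableT_comp mr measurable_dil.
have b1 : (0 <= (b `^ r)%:E)%E by rewrite lee_fin powR_ge0.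
apply: (etrans (ge0_integralZl (strip N l) measurableT mh (fun z _ => r0 (dil z)) b1)).
by rewrite EFinM -muleA -(ge0_integral_strip_dil l mr r0).
Qed.

Lemma Lfun2_dil l b f : f \in Lfun (strip N l) 2%:E ->
  (fun z => f (dil z) * b) \in Lfun (strip N l) 2%:E.
Proof.
move=> /Lfun2P[mf fy]; apply/Lfun2P; split.
  by apply: measurable_funM => //; exact: (measurableT_comp mf measurable_dil).
rewrite sqint_dil// lte_mul_pinfty// lee_fin.
by rewrite mulr_ge0 ?sqr_ge0// invr_ge0 exprn_ge0// ltW.
Qed.

Lemma L2_cvg_dil l b phi f : b != 0 -> (forall k, measurable_fun (@setT XT) (phi k)) ->
  measurable_fun (@setT XT) f -> L2_cvg (strip N l) phi f ->
  L2_cvg (strip N l) (fun k z => phi k (dil z) * b) (fun z => f (dil z) * b).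
Proof.
move=> b0 mphi mf; apply: L2_cvg_le (b ^+ 2 * c ^- N) _ _.
  exact: factor_gt0.
move=> k; rewrite -sqint_dil; last exact: measurable_funB.
by rewrite le_eqVlt; apply/orP; left; apply/eqP; apply: eq_integral => z _ /=; rewrite mulrBl.
Qed.

Lemma trace_of_dil l a y f fx fy t : 0 < l -> a != 0 ->
  f \in Lfun (strip N l) 2%:E -> (forall i, fx i \in Lfun (strip N l) 2%:E) ->
  fy \in Lfun (strip N l) 2%:E -> trace_of l f fx fy y t ->
  trace_of l (fun z => f (dil z) * a) (fun i z => fx i (dil z) * (c * a))
    (fun z => fy (dil z) * a) y (fun x => t (c *: x) * a).
Proof.
move=> l0 a0 Lf Lfx Lfy [Lt [phi [Cphi cf cfx cfy] ct]].
have [mt ty] := (Lfun2P _ _).1 Lt.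
have cn0 : c != 0 by rewrite gt_eqF.
split.
  apply/Lfun2P; split.
    by apply: measurable_funM => //; exact: (measurableT_comp mt (measurable_scalerV c)).
  rewrite sqint_dilV// lte_mul_pinfty// lee_fin.
  by rewrite mulr_ge0 ?sqr_ge0// invr_ge0 exprn_ge0// ltW.
(* The factor [a] is a constant polynomial, so that [Cc_tensor] and its derivative rules cover
   dilations too. *)
exists (fun k z => phi k (dil z) * a%:P.[z.2]).
  split.
  - by move=> k; apply: Cc_tensor => //; exact: oner_neq0.
  - under [X in L2_cvg _ X _]eq_fun do under eq_fun do rewrite hornerC.
    apply: (@L2_cvg_dil l a phi f) => //; last exact: (Lfun2_measurable Lf).
    by move=> k; exact: Cc_measurable.
  - move=> i; under [X in L2_cvg _ X _]eq_fun do under eq_fun do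
      rewrite (derive_tensor_dirx c 0 1 a%:P _ i (Cphi _)) hornerC -mulrA mulrCA.
    apply: (@L2_cvg_dil l (c * a) (fun k => 'D_(dirx i) (phi k)) (fx i)).
    + by rewrite mulf_neq0.
    + by move=> k; apply: Cc_measurable; exact: Cc_derive.
    + exact: (Lfun2_measurable (Lfx i)).
    + exact: cfx.
  - under [X in L2_cvg _ X _]eq_fun do under eq_fun do
      rewrite (derive_tensor_diry c 0 1 a%:P _ (Cphi _)) hornerC derivC horner0 mulr0 addr0 mul1r.
    apply: (@L2_cvg_dil l a (fun k => 'D_(diry N) (phi k)) fy) => //.
    + by move=> k; apply: Cc_measurable; exact: Cc_derive.
    + exact: (Lfun2_measurable Lfy).
under [X in L2_cvg _ X _]eq_fun do under eq_fun do rewrite hornerC /affine /= add0r mul1r.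
apply: L2_cvg_le (a ^+ 2 * c ^- N) _ _ ct.
  exact: factor_gt0.
move=> k; rewrite -sqint_dilV.
  by rewrite le_eqVlt; apply/orP; left; apply/eqP; apply: eq_integral => z _ /=; rewrite mulrBl.
apply: measurable_funB => //; exact: (measurable_slice_x y (Cc_measurable (Cphi k))).
Qed.

End dilation.

(** * Norms of functions on the graph *)

Section realized.
Context {R : realType} (N : nat) (G : metric_graph R).
Local Notation X := ('rV[R]_N * R)%type.
Local Notation XT := ('rV[R]_N * measurableTypeR R)%type.
Implicit Type u : H1 N G.

Lemma norm_powE u (r : R) : r != 0 ->
  norm_pow u r = (\sum_e \int[strip N (len e)]_z (`|u e z| `^ r)%:E)%E.
Proof. by move=> r0; apply: eq_bigr => e _; rewrite powR_Lnorm_EFin. Qed.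

Lemma norm_pow2E u : norm_pow u 2 = (\sum_e sqint (strip N (len e)) (u e))%E.
Proof. by apply: eq_bigr => e _; rewrite sqint_Lnorm. Qed.

Lemma normsq_dxE u :
  normsq_dx u = (\sum_e \sum_i sqint (strip N (len e)) (sob_dx (u e) i))%E.
Proof. by apply: eq_bigr => e _; apply: eq_bigr => i _; rewrite sqint_Lnorm. Qed.

Lemma normsq_dyE u : normsq_dy u = (\sum_e sqint (strip N (len e)) (sob_dy (u e)))%E.
Proof. by apply: eq_bigr => e _; rewrite sqint_Lnorm. Qed.

Lemma normsq_dx_fin u : normsq_dx u \is a fin_num.
Proof.
rewrite normsq_dxE; apply/sum_fin_numP => e _ _; apply/sum_fin_numP => i _ _.
exact: Lfun2_sqint (sob_dx_L2 _ _).
Qed.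

Lemma normsq_dy_fin u : normsq_dy u \is a fin_num.
Proof.
by rewrite normsq_dyE; apply/sum_fin_numP => e _ _; exact: Lfun2_sqint (sob_dy_L2 _).
Qed.

(** The final comparison of masses sees functions only through these four numbers. *)
Definition realized (p : R) (M X Y P : R) := exists u : H1 N G,
  [/\ norm_pow u 2 = M%:E, normsq_dx u = X%:E, normsq_dy u = Y%:E & norm_pow u p = P%:E].

Lemma norm_pow_ge0 u r : (0 <= norm_pow u r)%E.
Proof. by apply: sume_ge0 => e _; rewrite poweR_ge0. Qed.

Lemma normsq_dx_ge0 u : (0 <= normsq_dx u)%E.
Proof. by apply: sume_ge0 => e _; apply: sume_ge0 => i _; rewrite poweR_ge0. Qed.

Lemma normsq_dy_ge0 u : (0 <= normsq_dy u)%E.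
Proof. by apply: sume_ge0 => e _; rewrite poweR_ge0. Qed.

Lemma realized_ge0 p M X Y P : realized p M X Y P -> [/\ 0 <= M, 0 <= X, 0 <= Y & 0 <= P].
Proof.
move=> [u [uM uX uY uP]]; rewrite -!lee_fin -uM -uX -uY -uP.
by split; [exact: norm_pow_ge0|exact: normsq_dx_ge0|exact: normsq_dy_ge0|exact: norm_pow_ge0].
Qed.

Lemma realized_mass0 p X Y P : p != 0 -> realized p 0 X Y P -> P = 0.
Proof.
move=> p0 [u [uM _ _]]; rewrite norm_powE// big1 => [[]//|e _].
apply: (@integral_powR_eq0 _ _ _ _ _ 2) => //; first exact: Lfun2_measurable (sob_val_L2 _).
rewrite -sqint_powR; apply: le_anti; rewrite sqint_ge0 andbT -[leRHS]uM norm_pow2E (bigD1 e)//=.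
by rewrite leeDl// sume_ge0// => i _; exact: sqint_ge0.
Qed.

Lemma realized_dilation p M X Y P a c : p != 0 -> realized p M X Y P -> 0 < a -> 0 < c ->
  realized p (a ^+ 2 * c ^- N * M) (a ^+ 2 * c ^+ 2 * c ^- N * X)
    (a ^+ 2 * c ^- N * Y) (a `^ p * c ^- N * P).
Proof.
move=> p0 [u [uM uX uY uP]] a0 c0.
pose dil := @affine R N c 0 1.
have Lu e := sob_val_L2 (u e); have Lx e := sob_dx_L2 (u e); have Ly e := sob_dy_L2 (u e).
have [w Hw] : exists w : H1 N G, forall e, [/\ sob_val (w e) = (fun z => u e (dil z) * a),
    sob_dx (w e) = (fun i z => sob_dx (u e) i (dil z) * (c * a)) &
    sob_dy (w e) = (fun z => sob_dy (u e) (dil z) * a)].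
  apply: H1_approx => [e|e i|e|e s e' s' /(@H1_trace _ _ _ u)].
  - exact: Lfun2_dil.
  - exact: Lfun2_dil.
  - exact: Lfun2_dil.
  move=> [t [/is_trace_of t1 /is_trace_of t2]]; exists (fun x => t (c *: x) * a).
  by split; apply: trace_of_dil => //; rewrite ?len_gt0 ?gt_eqF.
have sumZ (k : R) (F : edge G -> \bar R) : 0 <= k -> (forall e, (0 <= F e)%E) ->
    (\sum_e k%:E * F e = k%:E * \sum_e F e)%E.
  by move=> k0 F0; rewrite ge0_sume_distrr.
have a2 : 0 <= a ^+ 2 * c ^- N by rewrite mulr_ge0 ?sqr_ge0// invr_ge0 exprn_ge0// ltW.
have a2c : 0 <= a ^+ 2 * c ^+ 2 * c ^- N.
  by apply: mulr_ge0; [rewrite mulr_ge0 ?sqr_ge0|rewrite invr_ge0 exprn_ge0// ltW].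
exists w; split.
- rewrite norm_pow2E EFinM -uM norm_pow2E -sumZ//; last by move=> e; exact: sqint_ge0.
  apply: eq_bigr => e _; have [-> _ _] := Hw e.
  exact: (@sqint_dil R N c c0 _ a (u e) (Lfun2_measurable (Lu e))).
- rewrite normsq_dxE EFinM -uX normsq_dxE -sumZ//; last first.
    by move=> e; apply: sume_ge0 => i _; exact: sqint_ge0.
  apply: eq_bigr => e _; have [_ -> _] := Hw e.
  rewrite ge0_sume_distrr; last by move=> i _; exact: sqint_ge0.
  apply: eq_bigr => i _.
  rewrite (_ : a ^+ 2 * c ^+ 2 * c ^- N = (c * a) ^+ 2 * c ^- N); last by rewrite exprMn [c ^+ 2 * _]mulrC.
  exact: (@sqint_dil R N c c0 _ (c * a) (sob_dx (u e) i) (Lfun2_measurable (Lx e i))).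
- rewrite normsq_dyE EFinM -uY normsq_dyE -sumZ//; last by move=> e; exact: sqint_ge0.
  apply: eq_bigr => e _; have [_ _ ->] := Hw e.
  exact: (@sqint_dil R N c c0 _ a (sob_dy (u e)) (Lfun2_measurable (Ly e))).
- rewrite norm_powE// EFinM -uP norm_powE// -sumZ//; last 2 first.
  + by rewrite mulr_ge0 ?powR_ge0// invr_ge0 exprn_ge0// ltW.
  + by move=> e; apply: integral_ge0 => z _; rewrite lee_fin powR_ge0.
  apply: eq_bigr => e _; have [-> _ _] := Hw e.
  exact: (@integral_powR_dil R N c c0 _ a (u e) p a0 (Lfun2_measurable (Lu e))).
Qed.

End realized.

Section realized_gn.
Context {R : realType} (n : nat) (G : metric_graph R).
Local Notation N := n.+1.
Local Notation X := ('rV[R]_N * R)%type.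
Local Notation XT := ('rV[R]_N * measurableTypeR R)%type.

(** The inequality for test functions passes to the limit by [fatou_powR]. The trace is assumed for
    the sake of its approximating sequence. *)
Lemma gagliardo_nirenberg_sobolev (l : R) : 0 < l -> exists2 C : R, 0 < C &
  forall (u : sobolev N l) (s A : R), 1 <= s -> 0 < A ->
  (s%:E * sqint (strip N l) u + s^-1%:E * sqint (strip N l) (sob_dy u) <= A%:E)%E ->
  (exists a t, is_trace u a t) ->
  (\int[strip N l]_z (`|u z| `^ (2 + 4 / N%:R))%:E <=
   (C * A `^ (2 / N%:R))%:E * \sum_i sqint (strip N l) (sob_dx u i))%E.
Proof.
move=> l0; have [C0 C00 HC0] := @gagliardo_nirenberg_strip R n l l0.
(* The factor 2 in the power is there because the approximations satisfy the hypothesis with [2 A]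
   only. *)
pose C := C0 * 2 `^ (2 / N%:R).
have C_gt0 : 0 < C by rewrite mulr_gt0// powR_gt0.
exists C => // u s A s1 A0 HA [a [t [_ [phi [Cphi cf cfx cfy _]]]]].
have s0 : 0 < s by rewrite (lt_le_trans ltr01).
have Lu := sob_val_L2 u; have Lx := sob_dx_L2 u; have Ly := sob_dy_L2 u.
have xfin : (\sum_i sqint (strip N l) (sob_dx u i))%E \is a fin_num.
  by apply/sum_fin_numP => i _ _; exact: Lfun2_sqint (Lx i).
have mD v k := Cc_measurable (Cc_derive v (Cphi k)).
have K0 : 0 < C * A `^ (2 / N%:R) by rewrite mulr_gt0// powR_gt0.
apply/lee_addgt0Pr => e e0.
pose d := e / (C * A `^ (2 / N%:R)) / N%:R.
have d0 : 0 < d by rewrite !divr_gt0.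
rewrite -(fineK xfin) -EFinM -EFinD.
have q0 : 0 < 2 + 4 / N%:R :> R by rewrite ltr_wpDr// divr_ge0.
apply: (fatou_powR q0 (fun k => Cc_measurable (Cphi k)) (Lfun2_measurable Lu) cf).
(* These errors contribute [A / 2] each, after multiplication by [s] and by [s^-1]. *)
pose d1 := A / 2 / s; pose d2 := A / 2 * s.
have d10 : 0 < d1 by rewrite !divr_gt0.
have d20 : 0 < d2 by rewrite mulr_gt0// divr_gt0.
have h1 := L2_cvg_sqint_le (fun k => Cc_measurable (Cphi k)) Lu cf d10.
have h2 := L2_cvg_sqint_le (mD _) Ly cfy d20.
have h3 : \forall k \near \oo, forall i : 'I_N,
    (sqint (strip N l) ('D_(dirx i) (phi k)) <= sqint (strip N l) (sob_dx u i) + d%:E)%E.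
  apply: filter_forall => i; have := L2_cvg_sqint_le (mD _) (Lx i) (cfx i) d0.
  by apply: filterS => k [].
near=> k.
have k1 : (sqint (strip N l) (phi k) <= sqint (strip N l) u + d1%:E)%E.
  by have [] : (sqint (strip N l) (phi k) <= sqint (strip N l) u + d1%:E)%E /\
      (sqint (strip N l) u <= sqint (strip N l) (phi k) + d1%:E)%E by near: k.
have k2 : (sqint (strip N l) ('D_(diry N) (phi k)) <= sqint (strip N l) (sob_dy u) + d2%:E)%E.
  by have [] : (sqint (strip N l) ('D_(diry N) (phi k)) <= sqint (strip N l) (sob_dy u) + d2%:E)%E /\
      (sqint (strip N l) (sob_dy u) <= sqint (strip N l) ('D_(diry N) (phi k)) + d2%:E)%E by near: k.
have k3 : forall i : 'I_N,
    (sqint (strip N l) ('D_(dirx i) (phi k)) <= sqint (strip N l) (sob_dx u i) + d%:E)%E by near: k.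
have A2 : 0 < 2 * A by rewrite mulr_gt0.
have le2A : (s%:E * sqint (strip N l) (phi k) +
    s^-1%:E * sqint (strip N l) ('D_(diry N) (phi k)) <= (2 * A)%:E)%E.
  apply: (@le_trans _ _ (s%:E * (sqint (strip N l) u + d1%:E) +
      s^-1%:E * (sqint (strip N l) (sob_dy u) + d2%:E))%E).
    by apply: leeD; apply: lee_wpmul2l => //; rewrite lee_fin ?invr_ge0 ltW.
  move: HA; rewrite -(fineK (Lfun2_sqint Lu)) -(fineK (Lfun2_sqint Ly)).
  set M := fine _; set Y := fine _.
  rewrite -!EFinD -?EFinM -?EFinD !lee_fin.
  have -> : s * (M + d1) = s * M + A / 2 by rewrite /d1; field; rewrite gt_eqF.
  have -> : s^-1 * (Y + d2) = s^-1 * Y + A / 2 by rewrite /d2; field; rewrite gt_eqF.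
  lra.
apply: (le_trans (HC0 _ _ _ (Cphi k) s1 A2 le2A)).
have -> : C0 * (2 * A) `^ (2 / N%:R) = C * A `^ (2 / N%:R).
  by rewrite powRM ?(ltW A0)// mulrA.
apply: (@le_trans _ _ ((C * A `^ (2 / N%:R))%:E *
    \sum_(i < N) (sqint (strip N l) (sob_dx u i) + d%:E))%E).
  apply: lee_wpmul2l; first by rewrite lee_fin ltW.
  by apply: lee_sum => i _; exact: k3.
rewrite big_split/= -(fineK xfin) sumEFin sumr_const card_ord -EFinD -EFinM lee_fin.
have dN : C * A `^ (2 / N%:R) * (d *+ N) = e.
  by rewrite -(mulr_natr d) /d divfK ?pnatr_eq0// mulrC divfK// gt_eqF.
by rewrite mulrDr lerD2l dN.
Unshelve. all: by end_near. Qed.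

(** Interpolation on each edge between 2 and the Gagliardo-Nirenberg exponent, then summation. The
    bound is on the extended real [norm_pow u p], so it also yields its finiteness. *)
Lemma norm_pow_gn p : 2 < p -> p < 2 + 4 / N%:R ->
  exists2 C : R, 0 < C & forall (u : H1 N G) M X Y,
  norm_pow u 2 = M%:E -> normsq_dx u = X%:E -> normsq_dy u = Y%:E -> 0 < M -> 0 <= Y ->
  forall t s : R, 0 < t -> 1 <= s ->
  (norm_pow u p <= (t `^ (- ((p - 2) / (2 + 4 / N%:R - p))) * M +
       t * (C * (s * M + s^-1 * Y) `^ (2 / N%:R) * X))%:E)%E.
Proof.
move=> p2 pq; have p0 : p != 0 by rewrite gt_eqF// (lt_trans _ p2).
have /choice[C HC] (e : edge G) : exists C : R, 0 < C /\
    forall (u : sobolev N (len e)) (s A : R), 1 <= s -> 0 < A ->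
    (s%:E * sqint (strip N (len e)) u + s^-1%:E * sqint (strip N (len e)) (sob_dy u) <= A%:E)%E ->
    (exists a t, is_trace u a t) ->
    (\int[strip N (len e)]_z (`|u z| `^ (2 + 4 / N%:R))%:E <=
     (C * A `^ (2 / N%:R))%:E * \sum_i sqint (strip N (len e)) (sob_dx u i))%E.
  by have [C C0 HC] := gagliardo_nirenberg_sobolev (len_gt0 e); exists C.
have C0 e : 0 <= C e by have [/ltW] := HC e.
(* The sum of the constants serves all edges at once; the 1 keeps it positive on a graph without
   edges. *)
exists (1 + \sum_e C e); first by rewrite ltr_wpDr// sumr_ge0.
move=> u M X Y uM uX uY M0 Y0 t s t0 s1; have s0 : 0 < s by rewrite (lt_le_trans ltr01).
have sD0 : 0 <= 1 + \sum_e C e by rewrite addr_ge0// sumr_ge0.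
pose A := s * M + s^-1 * Y.
have A0 : 0 < A.
  by rewrite ltr_wpDr// ?mulr_ge0 ?invr_ge0 ?(ltW s0)// mulr_gt0.
have Q e : (\int[strip N (len e)]_z (`|u e z| `^ (2 + 4 / N%:R))%:E <=
    ((1 + \sum_e C e) * A `^ (2 / N%:R))%:E * \sum_i sqint (strip N (len e)) (sob_dx (u e) i))%E.
  have [_ /(_ (u e) s A s1 A0)] := HC e.
  have leA : (s%:E * sqint (strip N (len e)) (u e) +
      s^-1%:E * sqint (strip N (len e)) (sob_dy (u e)) <= A%:E)%E.
    rewrite /A EFinD !EFinM -uM -uY norm_pow2E normsq_dyE.
    apply: leeD; apply: lee_wpmul2l; rewrite ?lee_fin ?invr_ge0 ?(ltW s0)//;
      rewrite (bigD1 e)//= leeDl// sume_ge0// => i _; exact: sqint_ge0.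
  move=> /(_ leA) H; apply: le_trans (H _) _.
    by have [t' [tr _]] := @H1_trace _ _ _ u e true e true erefl; exists (end_pos e true), t'.
  apply: lee_wpmul2r; first by apply: sume_ge0 => i _; exact: sqint_ge0.
  rewrite lee_fin ler_wpM2r ?powR_ge0//.
  by rewrite (bigD1 e)//= addrCA lerDl addr_ge0// sumr_ge0.
rewrite norm_powE//.
apply: (@le_trans _ _ (\sum_e ((t `^ (- ((p - 2) / (2 + 4 / N%:R - p))))%:E *
    sqint (strip N (len e)) (u e) + t%:E * (((1 + \sum_e C e) * A `^ (2 / N%:R))%:E *
    \sum_i sqint (strip N (len e)) (sob_dx (u e) i))))%E).
  apply: lee_sum => e _.
  apply: (le_trans (integral_interpolation (strip N (len e)) p2 pq t0 (Lfun2_measurable (sob_val_L2 (u e))))).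
  by rewrite leeD2l//; apply: lee_wpmul2l; [rewrite lee_fin ltW|exact: Q].
rewrite big_split/= -ge0_sume_distrr; last by move=> e _; exact: sqint_ge0.
rewrite -ge0_sume_distrr; last first.
  move=> e _; apply: mule_ge0; first by rewrite lee_fin mulr_ge0 ?powR_ge0.
  by apply: sume_ge0 => i _; exact: sqint_ge0.
rewrite -ge0_sume_distrr; last by move=> e _; apply: sume_ge0 => i _; exact: sqint_ge0.
by rewrite -norm_pow2E -normsq_dxE uM uX -!EFinM -EFinD.
Qed.

Lemma realized_gn p : 2 < p -> p < 2 + 4 / N%:R ->
  exists2 C : R, 0 < C & forall M X Y P, @realized R N G p M X Y P ->
  forall t s : R, 0 < t -> 1 <= s ->
  P <= t `^ (- ((p - 2) / (2 + 4 / N%:R - p))) * M +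
       t * (C * (s * M + s^-1 * Y) `^ (2 / N%:R) * X).
Proof.
move=> p2 pq; have p0 : p != 0 by rewrite gt_eqF// (lt_trans _ p2).
have [C C0 HC] := norm_pow_gn p2 pq.
exists C => // M X Y P SMP t s t0 s1.
have [M0 X0 Y0 P0] := realized_ge0 SMP.
(* [norm_pow_gn] needs [0 < M]; at mass 0 the function is 0 almost everywhere and [P = 0]. *)
have [ME|Mn0] := eqVneq M 0.
  move: SMP; rewrite ME => /(realized_mass0 p0) ->.
  by rewrite mulr0 add0r mulr_ge0 ?(ltW t0)// mulr_ge0// mulr_ge0 ?powR_ge0// ltW.
have [u [uM uX uY uP]] := SMP.
by rewrite -lee_fin -uP; apply: HC => //; rewrite lt0r Mn0.
Qed.

End realized_gn.

(** * Products of a slice and a polynomial *)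

Section tensor.
Context {R : realType} (N : nat).
Local Notation X := ('rV[R]_N * R)%type.
Local Notation XT := ('rV[R]_N * measurableTypeR R)%type.
Local Notation Cc := (@Cc_infty R N setT).
Local Notation rV2 := (sqint (@lebesgue_rV R N)).
Implicit Types (l y : R) (phi : nat -> X -> R) (h : {poly R}).

Lemma ge0_integral_strip_tensor l (a : 'rV[R]_N -> R) (b : R -> R) :
  measurable_fun setT a -> measurable_fun setT b ->
  (forall x, 0 <= a x) -> (forall y, 0 <= b y) ->
  (\int[strip N l]_z (a z.1 * b z.2)%:E =
   \int[lebesgue_rV N]_x (a x)%:E * \int[lebesgue_itv l]_y (b y)%:E)%E.
Proof.
move=> ma mb a0 b0.
have mab : measurable_fun (@setT XT) (fun z => (a z.1 * b z.2)%:E).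
  apply/measurable_EFinP; apply: measurable_funM.
    by apply: (measurableT_comp ma); exact: measurable_fst.
  by apply: (measurableT_comp mb); exact: measurable_snd.
have ab0 (z : XT) : (0 <= (a z.1 * b z.2)%:E)%E by rewrite lee_fin mulr_ge0.
rewrite (strip_yx _ mab ab0) /=.
have ma' : measurable_fun setT (EFin \o a) by exact/measurable_EFinP.
have mb' : measurable_fun (@setT (measurableTypeR R)) (EFin \o b) by exact/measurable_EFinP.
have a'0 : (0 <= \int[lebesgue_rV N]_x (a x)%:E)%E.
  by apply: integral_ge0 => x _; rewrite lee_fin.
transitivity (\int[lebesgue_itv l]_y (\int[lebesgue_rV N]_x (a x)%:E * (b y)%:E))%E.
  apply: eq_integral => y _; under eq_integral do rewrite mulrC EFinM.
  rewrite muleC; apply: (ge0_integralZl (lebesgue_rV N) measurableT ma').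
    by move=> x _; rewrite /= lee_fin.
  by rewrite lee_fin.
apply: (ge0_integralZl (lebesgue_itv l) measurableT mb') => //.
by move=> y _; rewrite /= lee_fin.
Qed.

Lemma sqint_tensor l (g : 'rV[R]_N -> R) (b : R -> R) :
  measurable_fun setT g -> measurable_fun setT b ->
  sqint (strip N l) (fun z => g z.1 * b z.2) = (rV2 g * sqint (lebesgue_itv l) b)%E.
Proof.
move=> mg mb; rewrite /sqint; under eq_integral do rewrite exprMn.
apply: (@ge0_integral_strip_tensor l (fun x => g x ^+ 2) (fun y => b y ^+ 2)).
- exact: measurable_funX.
- exact: measurable_funX.
- by move=> x; exact: sqr_ge0.
- by move=> x; exact: sqr_ge0.
Qed.

Lemma integral_powR_tensor l (g : 'rV[R]_N -> R) (b : R -> R) (r : R) :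
  measurable_fun setT g -> measurable_fun setT b ->
  (\int[strip N l]_z (`|g z.1 * b z.2| `^ r)%:E =
   \int[lebesgue_rV N]_x (`|g x| `^ r)%:E * \int[lebesgue_itv l]_y (`|b y| `^ r)%:E)%E.
Proof.
move=> mg mb.
transitivity (\int[strip N l]_z (`|g z.1| `^ r * `|b z.2| `^ r)%:E)%E.
  by apply: eq_integral => z _; rewrite normrM powRM.
apply: (@ge0_integral_strip_tensor l (fun x => `|g x| `^ r) (fun y => `|b y| `^ r)).
- by apply/measurable_EFinP; exact: measurable_powR_norm.
- by apply/measurable_EFinP; exact: measurable_powR_norm.
- by move=> x; exact: powR_ge0.
- by move=> x; exact: powR_ge0.
Qed.

Lemma measurable_horner h : measurable_fun setT (horner h).
Proof. by apply: continuous_measurable_fun => x; exact: continuous_horner. Qed.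

Lemma horner_bounded l h : 0 < l -> exists2 H : R, 0 < H &
  forall y, 0 <= y <= l -> `|h.[y]| <= H.
Proof.
move=> l0; have [c _ Hc] : exists2 c, c \in `[0, l] &
    forall y, y \in `[0, l] -> `|h.[y]| <= `|h.[c]|.
  apply: EVT_max; first exact: ltW.
  apply: continuous_subspaceT => y.
  by apply: continuous_comp; [exact: continuous_horner|exact: norm_continuous].
exists (`|h.[c]| + 1); first by rewrite ltr_wpDl.
by move=> y yl; rewrite (le_trans (Hc y _)) ?in_itv// lerDl.
Qed.

Lemma sqint_horner_fin l h : 0 < l -> (sqint (lebesgue_itv l) (horner h) < +oo)%E.
Proof.
move=> l0; have [H H0 Hh] := horner_bounded h l0.
apply: (@le_lt_trans _ _ (\int[lebesgue_itv l]_y (H ^+ 2)%:E)%E).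
  apply: le_integral_lebesgue_itv => //.
  - by apply/measurable_EFinP; apply: measurable_funX; exact: measurable_horner.
  - by move=> y; rewrite lee_fin sqr_ge0.
  - by move=> y; rewrite lee_fin sqr_ge0.
  move=> y /andP[y0 yl]; rewrite lee_fin -real_normK ?num_real//.
  by rewrite ler_pXn2r// ?nnegrE// ?(ltW H0)// Hh// !ltW.
by rewrite integral_lebesgue_itv_cst// -EFinM ltry.
Qed.

Lemma Lfun2_tensor l g h : 0 < l -> g \in Lfun (lebesgue_rV N) 2%:E ->
  (fun z : X => g z.1 * h.[z.2]) \in Lfun (strip N l) 2%:E.
Proof.
move=> l0 /Lfun2P[mg gy]; have mh := measurable_horner h; apply/Lfun2P; split.
  apply: measurable_funM.
    by apply: (measurableT_comp mg); exact: measurable_fst.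
  by apply: (measurableT_comp mh); exact: measurable_snd.
rewrite sqint_tensor// lte_mul_pinfty ?sqint_ge0 ?sqint_horner_fin//.
by rewrite ge0_fin_numE ?sqint_ge0.
Qed.

Lemma L2_cvg_slices l (F : nat -> X -> R) (f : X -> R) : 0 < l ->
  (forall k, measurable_fun (@setT XT) (F k)) -> measurable_fun (@setT XT) f ->
  (forall e : R, 0 < e -> \forall k \near \oo, forall y, 0 <= y <= l ->
    (rV2 (fun x => (F k (x, y) - f (x, y))%R) <= e%:E)%E) ->
  L2_cvg (strip N l) F f.
Proof.
move=> l0 mF mf HF; apply/L2_cvgP => e e0.
have el0 : 0 < e / l by rewrite divr_gt0.
have := HF _ el0; apply: filterS => k Hk.
have md : measurable_fun (@setT XT) (F k \- f)%R by exact: measurable_funB.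
rewrite (sqint_strip _ md); apply: (@le_trans _ _ (\int[lebesgue_itv l]_y (e / l)%:E)%E).
  apply: le_integral_lebesgue_itv => //.
  - exact: measurable_sqint_slice.
  - by move=> y; exact: sqint_ge0.
  - by move=> y; rewrite lee_fin ltW.
  by move=> y /andP[y0 yl]; apply: Hk; rewrite !ltW.
by rewrite integral_lebesgue_itv_cst// -EFinM divfK// gt_eqF.
Qed.

(** The mean value theorem in y bounds the difference pointwise, and all slices are supported in one
    box. *)
Lemma Cc_slice_near chi y0 l e : Cc chi -> 0 < l -> 0 < e ->
  \forall d \near (0 : R)^'+, forall y, 0 <= y <= l ->
    (rV2 (fun x => (chi (x, y0 + d * y) - chi (x, y0))%R) <= e%:E)%E.
Proof.
move=> Cchi l0 e0; have mchi := Cc_measurable Cchi.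
have [K K0 HK] := Cc_bounded (Cc_derive (diry N) Cchi).
have [B B0 HB] := Cc_box Cchi.
have [I I0 HI] := @sqint_box_le R N B.
(* For [d <= 1] the bound [(K d l) ^ 2 I] is at most [d c]. *)
pose c := (K * l) ^+ 2 * I + 1.
have c0 : 0 < c by rewrite ltr_wpDl// mulr_ge0// sqr_ge0.
have ec : 0 < e / c by rewrite divr_gt0.
near=> d.
have d0 : 0 < d by near: d; exact: nbhs_right_gt.
have d1 : d <= 1 by near: d; exact: nbhs_right_le.
have dec : d <= e / c by near: d; exact: nbhs_right_le.
move=> y /andP[yge0 yl].
have dy : 0 <= d * y by rewrite mulr_ge0// ltW.
apply: (@le_trans _ _ ((K * (d * l)) ^+ 2 * I)%:E).
  apply: HI.
  - by apply: measurable_funB; exact: (measurable_slice_x _ mchi).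
  - move=> x; have [|t|//|z _] := @MVT_segment R (fun t => chi (x, t)) (fun t => 'D_(diry N) chi (x, t)) y0 (y0 + d * y).
    + by rewrite lerDl.
    + by move=> _; exact: Cc_line.
    + by apply: continuous_subspaceT; apply: continuous_line; exact: Cc_cont.
    move=> ->; rewrite addrAC subrr add0r normrM (ger0_norm dy).
    by apply: ler_pM => //; rewrite ler_pM2l.
  - move=> x nz i; have [z0|/HB[/(_ i)//]] := eqVneq (chi (x, y0)) 0.
    by have [/(_ i)] : (forall i, `|(x, y0 + d * y).1 ord0 i| <= B) /\ `|(x, y0 + d * y).2| <= B
      by apply: HB; move: nz; rewrite z0 subr0.
rewrite lee_fin; apply: (@le_trans _ _ (d * c)); last by rewrite -ler_pdivlMr.
rewrite (_ : _ * I = d * (d * ((K * l) ^+ 2 * I))); last by ring.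
rewrite ler_pM2l// (@le_trans _ _ (1 * ((K * l) ^+ 2 * I)))//.
  by rewrite ler_wpM2r// mulr_ge0// sqr_ge0.
by rewrite mul1r lerDl.
Unshelve. all: by end_near. Qed.

Let rate k : R := k.+1%:R^-1.

Let rate_gt0 k : 0 < rate k. Proof. by rewrite invr_gt0. Qed.

Let rate_cvg (e : R) : 0 < e -> \forall k \near \oo, rate k <= e.
Proof.
by move=> e0; have := near_infty_natSinv_lt (PosNum e0); apply: filterS => k /ltW.
Qed.

Lemma slice_shift_cvg l (F : nat -> X -> R) y0 (d : nat -> R) (g : 'rV[R]_N -> R) :
  (forall k, Cc (F k)) -> measurable_fun setT g ->
  L2_cvg (lebesgue_rV N) (fun k x => F k (x, y0)) g ->
  (forall k y, 0 <= y <= l ->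
    (rV2 (fun x => (F k (x, y0 + d k * y) - F k (x, y0))%R) <= (rate k)%:E)%E) ->
  forall e, 0 < e -> \forall k \near \oo, forall y, 0 <= y <= l ->
    (rV2 (fun x => (F k (x, y0 + d k * y) - g x)%R) <= e%:E)%E.
Proof.
move=> CF mg /L2_cvgP cvgF HF e e0; have e4 : 0 < e / 4 by rewrite divr_gt0.
apply: filterS2 (cvgF _ e4) (rate_cvg e4) => k k1 k2 y yl.
have mF a := measurable_slice_x a (Cc_measurable (CF k)).
apply: (le_trans (sqint_triangle _ (mF (y0 + d k * y)) (mF y0) mg)).
apply: (@le_trans _ _ (2%:E * (e / 4)%:E + 2%:E * (e / 4)%:E)%E).
  apply: leeD; apply: lee_wpmul2l => //.
  by apply: (le_trans (HF k y yl)); rewrite lee_fin.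
by rewrite -!EFinM -EFinD lee_fin; lra.
Qed.

Lemma slice_mul_cvg l (F : nat -> X -> R) y0 (d : nat -> R) (g : 'rV[R]_N -> R) h :
  0 < l -> (forall k, measurable_fun (@setT XT) (F k)) -> measurable_fun setT g ->
  (forall e, 0 < e -> \forall k \near \oo, forall y, 0 <= y <= l ->
    (rV2 (fun x => (F k (x, y0 + d k * y) - g x)%R) <= e%:E)%E) ->
  forall e, 0 < e -> \forall k \near \oo, forall y, 0 <= y <= l ->
    (rV2 (fun x => (F k (x, y0 + d k * y) * h.[y] - g x * h.[y])%R) <= e%:E)%E.
Proof.
move=> l0 mF mg cvgF e e0; have [H H0 Hh] := horner_bounded h l0.
have H2 : 0 < H ^+ 2 by rewrite exprn_gt0.
have eH : 0 < (H ^+ 2)^-1 * e by rewrite mulr_gt0// invr_gt0.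
have := cvgF _ eH; apply: filterS => k Hk y yl.
have md : measurable_fun setT (fun x => F k (x, y0 + d k * y) - g x).
  by apply: measurable_funB => //; exact: (measurable_slice_x _ (mF k)).
have -> : rV2 (fun x => (F k (x, y0 + d k * y) * h.[y] - g x * h.[y])%R) =
    rV2 (fun x => (h.[y] * (F k (x, y0 + d k * y) - g x))%R).
  by apply: eq_integral => x _; rewrite -mulrBl mulrC.
rewrite (sqintZ _ _ md); apply: (@le_trans _ _ ((H ^+ 2)%:E * ((H ^+ 2)^-1 * e)%:E)%E).
  apply: lee_pmul => //; first by rewrite lee_fin sqr_ge0.
  - exact: sqint_ge0.
  - by rewrite lee_fin -real_normK ?num_real// ler_pXn2r// ?nnegrE// ?(ltW H0)// Hh.
  - exact: Hk.
by rewrite -EFinM mulrA mulfV ?mul1r// gt_eqF.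
Qed.

(* Following an approximation of [u] along [y0 + d_k y], with [d_k] tending to 0
   fast enough, approximates the extension of the slice of [u] at [y0] that does
   not depend on [y]. *)
Lemma trace_of_tensor l phi y0 (g : 'rV[R]_N -> R) (gx : 'I_N -> 'rV[R]_N -> R) h a :
  0 < l -> (forall k, Cc (phi k)) -> g \in Lfun (lebesgue_rV N) 2%:E ->
  (forall i, gx i \in Lfun (lebesgue_rV N) 2%:E) ->
  L2_cvg (lebesgue_rV N) (fun k x => phi k (x, y0)) g ->
  (forall i, L2_cvg (lebesgue_rV N) (fun k x => 'D_(dirx i) (phi k) (x, y0)) (gx i)) ->
  0 <= a <= l ->
  trace_of l (fun z : X => g z.1 * h.[z.2]) (fun i z => gx i z.1 * h.[z.2])
    (fun z => g z.1 * h^`().[z.2]) a (fun x => g x * h.[a]).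
Proof.
move=> l0 Cphi Lg Lgx cg cgx al; have mg := Lfun2_measurable Lg.
have mgx i := Lfun2_measurable (Lgx i).
have CD v k : Cc ('D_v (phi k)) := Cc_derive v (Cphi k).
(* The y-derivative of [phi k (x, y0 + d y)] is [d] times that of [phi k]. The latter is not
   controlled near the slice as [k] grows, so [d] is chosen after [phi k], small enough to make the
   product tend to 0. *)
have /choice[d Hd] k : exists d : R, [/\ 0 < d,
    forall y, 0 <= y <= l -> (rV2 (fun x => (phi k (x, y0 + d * y) - phi k (x, y0))%R) <= (rate k)%:E)%E,
    forall i y, 0 <= y <= l -> (rV2 (fun x => ('D_(dirx i) (phi k) (x, y0 + d * y) -
      'D_(dirx i) (phi k) (x, y0))%R) <= (rate k)%:E)%E &
    forall y, (rV2 (fun x => (d * 'D_(diry N) (phi k) (x, y))%R) <= (rate k)%:E)%E].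
  have [C C0 HC] := Cc_slice_bound (CD (diry N) k).
  have f1 := Cc_slice_near y0 (Cphi k) l0 (rate_gt0 k).
  have f2 : \forall d \near (0 : R)^'+, forall i : 'I_N, forall y, 0 <= y <= l ->
      (rV2 (fun x => ('D_(dirx i) (phi k) (x, y0 + d * y) -
      'D_(dirx i) (phi k) (x, y0))%R) <= (rate k)%:E)%E.
    by apply: filter_forall => i; exact: (Cc_slice_near y0 (CD _ k) l0 (rate_gt0 k)).
  have C1 : 0 < rate k / (C + 1) by rewrite divr_gt0// ltr_wpDl.
  have [d dP] := filter_ex (filterI (filterI f1 f2) (filterI (nbhs_right_gt (0 : R))
    (filterI (nbhs_right_le C1) (nbhs_right_le (@ltr01 R))))).
  case: dP => -[d1 d2] [d0 [dC dle1]]; exists d; split => // y.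
  rewrite (sqintZ _ _ (measurable_slice_x y (Cc_measurable (CD (diry N) k)))).
  apply: (@le_trans _ _ ((d ^+ 2)%:E * C%:E)%E).
    by apply: lee_wpmul2l; rewrite ?lee_fin ?sqr_ge0.
  rewrite -EFinM lee_fin; move: dC; rewrite ler_pdivlMr ?ltr_wpDl// => dC.
  apply: le_trans dC; rewrite expr2 -mulrA ler_pM2l//.
  by rewrite (@le_trans _ _ (1 * C))// ?ler_wpM2r// mul1r lerDl.
have c1 := slice_shift_cvg (F := phi) Cphi mg cg (fun k => let: And4 _ H _ _ := Hd k in H).
have c2 i := slice_shift_cvg (F := fun k => 'D_(dirx i) (phi k)) (CD (dirx i)) (mgx i) (cgx i)
  (fun k => let: And4 _ _ H _ := Hd k in H i).
have mphi k := Cc_measurable (Cphi k).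
have mD v k := Cc_measurable (CD v k).
have m1 b : measurable_fun (@setT XT) (fun z => g z.1 * horner b z.2).
  apply: measurable_funM; first by apply: (measurableT_comp mg); exact: measurable_fst.
  by apply: (measurableT_comp (measurable_horner b)); exact: measurable_snd.
have m2 i : measurable_fun (@setT XT) (fun z => gx i z.1 * h.[z.2]).
  apply: measurable_funM; first by apply: (measurableT_comp (mgx i)); exact: measurable_fst.
  by apply: (measurableT_comp (measurable_horner h)); exact: measurable_snd.
pose psi k z := phi k (affine 1 y0 (d k) z) * h.[z.2].
have Cpsi k : Cc (psi k).
  by apply: Cc_tensor; rewrite ?oner_neq0//; have [/lt0r_neq0] := Hd k.
have psiE k x y : psi k (x, y) = phi k (x, y0 + d k * y) * h.[y] by rewrite /psi /affine scale1r.
have u1 := slice_mul_cvg h l0 mphi mg c1.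
have mpsi k := Cc_measurable (Cpsi k).
have mDpsi v k := Cc_measurable (Cc_derive v (Cpsi k)).
split.
  apply/Lfun2P; split; first exact: measurable_funM.
  rewrite (_ : (fun x => _) = (fun x => h.[a] * g x)); last by apply/funext => x; rewrite mulrC.
  by rewrite (sqintZ _ _ mg) lte_mul_pinfty ?lee_fin ?sqr_ge0//; have /Lfun2P[] := Lg.
exists psi; first split => //.
- apply: (L2_cvg_slices l0 mpsi (m1 h)) => e /u1; apply: filterS => k Hk y /Hk.
  by congr (_ <= _)%E; apply: eq_integral => x _; rewrite psiE.
- move=> i; apply: (L2_cvg_slices l0 (mDpsi _) (m2 i)) => e.
  move=> /(slice_mul_cvg h l0 (mD (dirx i)) (mgx i) (c2 i)).
  apply: filterS => k Hk y /Hk; congr (_ <= _)%E; apply: eq_integral => x _.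
  by rewrite (derive_tensor_dirx 1 y0 (d k) h (x, y) i (Cphi k)) mul1r /affine scale1r.
- apply: (L2_cvg_slices l0 (mDpsi _) (m1 _)) => e e0.
  have e4 : 0 < e / 4 by rewrite divr_gt0.
  have [H H0 Hh] := horner_bounded h l0.
  have H2 : 0 < H ^+ 2 by rewrite exprn_gt0.
  have eH : 0 < (H ^+ 2)^-1 * (e / 4) by rewrite mulr_gt0// invr_gt0.
  apply: filterS2 (slice_mul_cvg h^`() l0 mphi mg c1 e4) (rate_cvg eH) => k k1 k2 y yl.
  have [_ _ _ d4] := Hd k.
  have mphiy := measurable_slice_x (y0 + d k * y) (mphi k).
  have mDy := measurable_slice_x (y0 + d k * y) (mD (diry N) k).
  (* By the product rule the error in the y-derivative is [A + B]: [A] is small by the choice of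
     [d k], and [B] tends to 0 because the shifted slices converge to [g]. *)
  pose A x := h.[y] * (d k * 'D_(diry N) (phi k) (x, y0 + d k * y)).
  pose B x := phi k (x, y0 + d k * y) * h^`().[y] - g x * h^`().[y].
  have mA : measurable_fun setT A by apply: measurable_funM => //; exact: measurable_funM.
  have mB : measurable_fun setT B by apply: measurable_funB; exact: measurable_funM.
  have -> : rV2 (fun x => ('D_(diry N) (psi k) (x, y) - g x * h^`().[y])%R) =
      rV2 (fun x => (A x + B x)%R).
    apply: eq_integral => x _.
    rewrite (derive_tensor_diry 1 y0 (d k) h (x, y) (Cphi k)) /affine scale1r /A /B /=.
    by congr ((_ ^+ 2)%:E); ring.
  apply: (@le_trans _ _ (2%:E * rV2 A + 2%:E * rV2 B)%E).
    apply: le_sqint_lin2 => //; first exact: measurable_funD.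
    by move=> x; have := sqr_ge0 (A x - B x); nra.
  apply: (@le_trans _ _ (2%:E * (e / 4)%:E + 2%:E * (e / 4)%:E)%E); last first.
    by rewrite -!EFinM -EFinD lee_fin; lra.
  apply: leeD; apply: lee_wpmul2l => //; last exact: k1.
  rewrite (sqintZ _ _ (measurable_funM (measurable_cst _) mDy)).
  apply: (@le_trans _ _ ((H ^+ 2)%:E * ((H ^+ 2)^-1 * (e / 4))%:E)%E).
    apply: lee_pmul => //; first by rewrite lee_fin sqr_ge0.
    + exact: sqint_ge0.
    + by rewrite lee_fin -real_normK ?num_real// ler_pXn2r// ?nnegrE// ?(ltW H0)// Hh.
    + by apply: (le_trans (d4 _)); rewrite lee_fin.
  by rewrite -EFinM mulrA mulfV ?mul1r// gt_eqF.
- apply/L2_cvgP => e /u1; apply: filterS => k /(_ a al).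
  by congr (_ <= _)%E; apply: eq_integral => x _; rewrite /= psiE.
Qed.

End tensor.

(** * Extensions of slices *)

(** Young's inequality for the product of [1 + t] and 1, with the exponent [g] and its conjugate. *)
Lemma bernoulli_powR (R : realType) (g t : R) : 1 < g -> 0 <= 1 + t ->
  1 + g * t <= (1 + t) `^ g.
Proof.
move=> g1 t0; have g0 : 0 < g by lra.
have gq : g^-1 + (1 - g^-1) = 1 by lra.
have q0 : 0 < 1 - g^-1 by rewrite subr_gt0 invf_lt1.
have := @conjugate_powR R (1 + t) 1 g (1 - g^-1)^-1 t0 ler01 g0.
rewrite invr_gt0 invrK => /(_ q0 gq).
rewrite powR1 mulr1 mul1r -(ler_pM2l g0) => h.
suff e : g * ((1 + t) `^ g / g + (1 - g^-1)) = (1 + t) `^ g + (g - 1) by lra.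
by field; rewrite gt_eqF.
Qed.

(** The graph of [z ^ (p / 2)] lies above its tangent at 1, with [z = y ^ 2]. Bernoulli's inequality
    for the exponent [r = p / 2] is squared, and the leftover [r (r - 1) (y - 1) ^ 2] gives
    strictness. *)
Lemma powR_gt_tangent (R : realType) (p y : R) : 2 < p -> 0 <= y -> y != 1 ->
  1 + p / 2 * (y ^+ 2 - 1) < y `^ p.
Proof.
move=> p2 y0 y1; pose r := p / 2; have r1 : 1 < r by rewrite /r; lra.
have -> : y `^ p = (y `^ r) ^+ 2.
  by rewrite -powR_mulrn ?powR_ge0// -powRrM /r divfK.
have yy : 0 < (y - 1) ^+ 2 by rewrite exprn_even_gt0//= subr_eq0.
have := @bernoulli_powR R r (y - 1) r1; rewrite addrC subrK => /(_ y0).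
rewrite -/r; have z0 := powR_ge0 y r; move: (y `^ r) z0 => z z0 zle.
have [tneg|tpos] := ltP (r * (y - 1) + 1) 0.
  by have : 0 <= z ^+ 2; rewrite ?sqr_ge0//; nra.
have : (r * (y - 1) + 1) ^+ 2 <= z ^+ 2.
  by rewrite ler_pXn2r// 1?nnegrE// 1?addrC//.
have rr : 0 < r * (r - 1) * (y - 1) ^+ 2 by apply: mulr_gt0 => //; apply: mulr_gt0; lra.
rewrite (_ : (r * (y - 1) + 1) ^+ 2 = 1 + r * (y ^+ 2 - 1) + r * (r - 1) * (y - 1) ^+ 2); last by ring.
by move/(lt_le_trans _); apply; rewrite ltrDl.
Qed.

Section strict_integral.
Context d (T : measurableType d) (R : realType) (m : {measure set T -> \bar R}).
Implicit Types f : T -> R.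

Lemma Rintegral_gt0 f : m.-integrable setT (EFin \o f) ->
  {ae m, forall x, 0 <= f x} -> ~ {ae m, forall x, f x = 0} -> 0 < \int[m]_x f x.
Proof.
move=> fI f0 nf; have mf : measurable_fun setT (EFin \o f) := measurable_int _ fI.
have E : (\int[m]_x (EFin \o f) x = \int[m]_x `|(EFin \o f) x|)%E.
  apply: ae_eq_integral => //; first exact: measurableT_comp.
  by move: f0; apply: filterS => x fx _ /=; rewrite ger0_norm.
have abs0 : (0 <= \int[m]_x `|(EFin \o f) x|)%E by exact: integral_ge0.
rewrite lt_neqAle /Rintegral E fine_ge0// andbT eq_sym; apply/negP => /eqP int0.
apply: nf; have : (\int[m]_x `|(EFin \o f) x|)%E = 0%E.
  rewrite -[LHS]fineK ?int0// ge0_fin_numE//.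
  by have /integrableP[] := fI.
by move/(ae_eq_integral_abs _ measurableT mf); apply: filterS => x /(_ I)[].
Qed.

Lemma integrable_fine (F : T -> \bar R) (c : R) : measurable_fun setT F ->
  (forall x, 0 <= F x)%E -> (\int[m]_x F x)%E = c%:E ->
  [/\ {ae m, forall x, F x \is a fin_num}, m.-integrable setT (EFin \o (fine \o F)) &
    \int[m]_x fine (F x) = c].
Proof.
move=> mF F0 Fc; have FI : m.-integrable setT F.
  apply/integrableP; split => //; under eq_integral do rewrite gee0_abs//.
  by rewrite Fc ltry.
have Ffin := integrable_ae measurableT FI.
have mf : measurable_fun setT (EFin \o (fine \o F)).
  by apply/measurable_EFinP; exact: measurableT_comp.
have E : (\int[m]_x (EFin \o (fine \o F)) x = c%:E)%E.
  rewrite -Fc; apply: ge0_ae_eq_integral => //.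
  - by move=> x _; rewrite /= lee_fin fine_ge0.
  - by move: Ffin; apply: filterS => x /(_ I) h _; rewrite /= fineK.
split.
- by move: Ffin; apply: filterS => x; exact.
- apply/integrableP; split => //.
  under eq_integral do rewrite gee0_abs ?lee_fin ?fine_ge0//.
  by rewrite E ltry.
- by rewrite /Rintegral E.
Qed.

End strict_integral.

Section bump.
Context {R : realType}.

(* The polynomial [1 - 10 z (1 - z)], with [z = y / l], equals 1 at both ends of
   [0, l] and its square has mean 1 there. *)
Definition bump (l : R) : {poly R} := 1 - (10 / l) *: 'X + (10 / l ^+ 2) *: 'X^2.

Lemma bumpE l y : (bump l).[y] = 1 - 10 / l * y + 10 / l ^+ 2 * y ^+ 2.
Proof. by rewrite /bump !hornerE. Qed.

Lemma bump_end l : l != 0 -> (bump l).[0] = 1 /\ (bump l).[l] = 1.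
Proof. by move=> l0; rewrite !bumpE; split; field. Qed.

(** The mean of [(1 - c z (1 - z)) ^ 2] on [[0, 1]] is [1 - c / 3 + c ^ 2 / 30], which is 1 for
    [c = 10]. The polynomial [P] below is an explicit primitive of the square. *)
Lemma sqint_bump l : 0 < l -> sqint (lebesgue_itv l) (horner (bump l)) = l%:E.
Proof.
move=> l0; have ln0 : l != 0 by rewrite gt_eqF.
pose P : {poly R} := 'X - (10 / l) *: 'X^2 + (40 / l ^+ 2) *: 'X^3
  - (50 / l ^+ 3) *: 'X^4 + (20 / l ^+ 4) *: 'X^5.
have dP (y : R) : is_derive y 1 (horner P) ((bump l).[y] ^+ 2).
  apply: is_derive_eq (is_derive_poly P y) _.
  by rewrite bumpE /P !poly.derivE !hornerE /=; field.
have mb : measurable_fun (@setT (measurableTypeR R)) (fun y => ((bump l).[y] ^+ 2)%:E).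
  by apply/measurable_EFinP; apply: measurable_funX; exact: measurable_horner.
have cb : continuous (fun y => (bump l).[y] ^+ 2).
  by move=> y; apply: (@continuous_comp _ _ _ (horner (bump l)) (fun x => x ^+ 2));
    [exact: continuous_horner|exact: exprn_continuous].
rewrite /sqint -(integral_itv_cc l0 mb); last by move=> y; rewrite lee_fin sqr_ge0.
rewrite (integral_derive l0 dP cb); congr (_%:E); by rewrite /P !hornerE /=; field.
Qed.

(** Strict Jensen inequality: [powR_gt_tangent] at [|bump|] is integrated, and its linear term
    disappears since the square has mean 1. *)
Lemma integral_powR_bump l p : 0 < l -> 2 < p ->
  exists2 k : R, l < k & (\int[lebesgue_itv l]_y (`|(bump l).[y]| `^ p)%:E)%E = k%:E.
Proof.
move=> l0 p2; have ln0 : l != 0 by rewrite gt_eqF.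
have [H H0 Hh] := horner_bounded (bump l) l0.
have mb := measurable_horner (bump l).
have mpow := @measurable_powR_norm R p _ (measurableTypeR R) _ mb.
have powH : (\int[lebesgue_itv l]_y (`|(bump l).[y]| `^ p)%:E < +oo)%E.
  apply: (@le_lt_trans _ _ (\int[lebesgue_itv l]_y (H `^ p)%:E)%E).
    apply: le_integral_lebesgue_itv => //.
    - by move=> y; rewrite lee_fin powR_ge0.
    move=> y /andP[y0 yl]; rewrite lee_fin; apply: ge0_ler_powR.
    - lra.
    - by rewrite nnegrE.
    - by rewrite nnegrE ltW.
    - by rewrite Hh// !ltW.
  by rewrite integral_lebesgue_itv_cst// -EFinM ltry.
have powfin : (\int[lebesgue_itv l]_y (`|(bump l).[y]| `^ p)%:E)%E \is a fin_num.
  by rewrite ge0_fin_numE// integral_ge0// => y _; rewrite lee_fin powR_ge0.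
exists (fine (\int[lebesgue_itv l]_y (`|(bump l).[y]| `^ p)%:E)%E); last by rewrite fineK.
have I1 : (lebesgue_itv l).-integrable setT (EFin \o (fun y => `|(bump l).[y]| `^ p)).
  apply/integrableP; split; first exact: mpow.
  by under eq_integral do rewrite gee0_abs ?lee_fin ?powR_ge0//.
have I2 : (lebesgue_itv l).-integrable setT (EFin \o (fun y => (bump l).[y] ^+ 2)).
  apply/integrableP; split; first by apply/measurable_EFinP; exact: measurable_funX.
  under eq_integral do rewrite gee0_abs ?lee_fin ?sqr_ge0//.
  by rewrite -/(sqint _ _) (sqint_bump l0) ltry.
have I3 : (lebesgue_itv l).-integrable setT (EFin \o (fun=> 1 - p / 2)).
  exact: finite_measure_integrable_cst.
have I4 : (lebesgue_itv l).-integrable setT (EFin \o (fun y => p / 2 * (bump l).[y] ^+ 2)).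
  exact: (integrableZl measurableT _ I2).
have I5 : (lebesgue_itv l).-integrable setT (EFin \o (fun y => (1 - p / 2) + p / 2 * (bump l).[y] ^+ 2)).
  exact: (integrableD measurableT I3 I4).
have I6 := integrableB measurableT I1 I5.
have pos y : (bump l).[y] != 1 -> (bump l).[y] != -1 ->
    1 - p / 2 + p / 2 * (bump l).[y] ^+ 2 < `|(bump l).[y]| `^ p.
  move=> b1 b2; have := @powR_gt_tangent R p `|(bump l).[y]| p2 (normr_ge0 _).
  rewrite real_normK ?num_real// eqr_norml ler01 andbT negb_or b1 b2 => /(_ isT).
  by rewrite mulrBr mulr1; lra.
have ge y : 1 - p / 2 + p / 2 * (bump l).[y] ^+ 2 <= `|(bump l).[y]| `^ p.
  have [->|b1] := eqVneq (bump l).[y] 1.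
    by rewrite normr1 powR1 expr1n; lra.
  have [->|b2] := eqVneq (bump l).[y] (-1).
    by rewrite normrN1 powR1 sqrrN expr1n; lra.
  exact/ltW/pos.
have := @Rintegral_gt0 _ (measurableTypeR R) R (lebesgue_itv l)
  (fun y => `|(bump l).[y]| `^ p - (1 - p / 2 + p / 2 * (bump l).[y] ^+ 2)) I6.
rewrite (RintegralB measurableT I1 I5) (RintegralD measurableT I3 I4) (RintegralZl _ measurableT I2).
have -> : \int[lebesgue_itv l]_y (1 - p / 2) = (1 - p / 2) * l.
  by rewrite /Rintegral (integral_lebesgue_itv_cst _ l0).
have -> : \int[lebesgue_itv l]_x ((bump l).[x] ^+ 2) = l.
  by rewrite /Rintegral; have := sqint_bump l0; rewrite /sqint => ->.
rewrite (_ : (1 - p / 2) * l + p / 2 * l = l); last by ring.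
rewrite subr_gt0; apply; first by apply: nearW => y; rewrite subr_ge0.
move=> [A [mA A0 sub]].
(* On []0, l / 10[] the polynomial is strictly between 0 and 1, so the inequality is strict on a set
   of positive measure. *)
have lA : (0 < lebesgue_itv l `]0%R, (l / 10)%R[)%E.
  rewrite /lebesgue_itv /mrestr setIidl; last first.
    by move=> y /=; rewrite !in_itv/= => /andP[-> /lt_trans ->//]; rewrite gtr_pMr//; lra.
  by rewrite lebesgue_measure_itv/= lte_fin divr_gt0// -EFinB lte_fin subr0 divr_gt0.
have : (lebesgue_itv l `]0%R, (l / 10)%R[ <= lebesgue_itv l A)%E.
  apply: le_measure; rewrite ?inE//.
  apply: subset_trans sub => y /=; rewrite in_itv/= => /andP[y0 yl] /eqP.
  apply/negP; rewrite subr_eq0 gt_eqF//.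
  have zE : (bump l).[y] = 1 - 10 * (y / l) + 10 * (y / l) ^+ 2 by rewrite bumpE; field.
  have z0 : 0 < y / l by rewrite divr_gt0.
  have z1 : y / l < 10^-1 by rewrite ltr_pdivrMr// mulrC.
  by apply: pos; rewrite zE; apply/eqP; nra.
by rewrite A0 leNgt lA.
Qed.

End bump.

(* Comparing along a path of edges; the constant is uniform since there are
   finitely many edges. *)
Lemma graph_variation (R : realType) (G : metric_graph R) : exists2 C : R, 0 <= C &
  forall (f : edge G -> R) (D : R), 0 <= D ->
  (forall e s e' s', endpoint e s = endpoint e' s' -> `|f e - f e'| <= D) ->
  forall e e', `|f e - f e'| <= C * D.
Proof.
pose r : rel (vertex G) := [rel a b | [exists e, [exists s,
  (endpoint e s == a) && (endpoint e (~~ s) == b)]]].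
have pathP (f : edge G -> R) (D : R) : 0 <= D ->
    (forall e s e' s', endpoint e s = endpoint e' s' -> `|f e - f e'| <= D) ->
    forall q v e s, endpoint e s = v -> path r v q -> forall e' s',
    endpoint e' s' = last v q -> `|f e - f e'| <= (size q).+1%:R * D.
  move=> D0 fD; elim=> [|w q IH] v e s ev /=.
    by move=> _ e' s' e'v; rewrite mul1r (fD e s e' s')// ev e'v.
  move=> /andP[/existsP[e1 /existsP[s1 /andP[/eqP e1v /eqP e1w]]] pq] e' s' e'w.
  rewrite -[f e - f e'](subrKA (f e1)) (le_trans (ler_normD _ _))//.
  rewrite -natr1 mulrDl mul1r addrC lerD//; first exact: IH e1w pq _ _ e'w.
  by apply: (fD e s e1 s1); rewrite ev e1v.
have /choice[n Hn] (ee : edge G * edge G) : exists n : nat,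
    forall (f : edge G -> R) (D : R), 0 <= D ->
    (forall e s e' s', endpoint e s = endpoint e' s' -> `|f e - f e'| <= D) ->
    `|f ee.1 - f ee.2| <= n%:R * D.
  have /connectP[q pq qE] := graph_connected (endpoint ee.1 true) (endpoint ee.2 true).
  exists (size q).+1 => f D D0 fD.
  exact: (pathP f D D0 fD q (endpoint ee.1 true) ee.1 true erefl pq ee.2 true qE).
exists (\sum_ee (n ee)%:R); first by rewrite sumr_ge0.
move=> f D D0 fD e e'; apply: (le_trans (Hn (e, e') f D D0 fD)).
by rewrite ler_wpM2r// (bigD1 (e, e'))//= lerDl sumr_ge0.
Qed.

(** * Almost every slice as an L^2 limit of slices of test functions *)

Section slices.
Context {R : realType} (N : nat).
Local Notation X := ('rV[R]_N * R)%type.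
Local Notation XT := ('rV[R]_N * measurableTypeR R)%type.
Local Notation Cc := (@Cc_infty R N setT).
Local Notation rV2 := (sqint (@lebesgue_rV R N)).
Implicit Types (l y : R) (phi : nat -> X -> R).

Lemma exp2V_cvg (e : R) : 0 < e -> \forall k \near \oo, 2 ^- k.+1 <= e.
Proof.
move=> e0; have := near_infty_natSinv_lt (PosNum e0); apply: filterS => k /ltW.
apply: le_trans; rewrite lef_pV2 ?posrE ?exprn_gt0// -natrX ler_nat.
by rewrite ltnW// ltn_expl.
Qed.

Lemma L2_cvg_of_rate d (T : measurableType d) (m : {measure set T -> \bar R})
    (fs : nat -> T -> R) f :
  (forall k, sqint m (fs k \- f)%R <= (2 ^- k.+1)%:E)%E -> L2_cvg m fs f.
Proof.
move=> fsf; apply/L2_cvgP => e /exp2V_cvg; apply: filterS => k ke.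
by apply: (le_trans (fsf k)); rewrite lee_fin.
Qed.

(** A common subsequence for the function and all its derivatives, fast enough for convergence on
    almost every slice without further extraction. *)
Lemma approx_rate l phi f fx fy : approx l phi f fx fy -> exists psi : nat -> X -> R,
  [/\ forall k, Cc (psi k),
      forall k, (sqint (strip N l) (psi k \- f)%R <= (2 ^- k.+1)%:E)%E,
      forall i k, (sqint (strip N l) ('D_(dirx i) (psi k) \- fx i)%R <= (2 ^- k.+1)%:E)%E &
      forall k, (sqint (strip N l) ('D_(diry N) (psi k) \- fy)%R <= (2 ^- k.+1)%:E)%E].
Proof.
move=> [Cphi /L2_cvgP cf cfx /L2_cvgP cfy].
have /choice[s Hs] k : exists n,
    [/\ (sqint (strip N l) (phi n \- f)%R <= (2 ^- k.+1)%:E)%E,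
      forall i, (sqint (strip N l) ('D_(dirx i) (phi n) \- fx i)%R <= (2 ^- k.+1)%:E)%E &
      (sqint (strip N l) ('D_(diry N) (phi n) \- fy)%R <= (2 ^- k.+1)%:E)%E].
  have e0 : (0 : R) < 2 ^- k.+1 by rewrite invr_gt0 exprn_gt0.
  have fxk : \forall n \near \oo, forall i : 'I_N,
      (sqint (strip N l) ('D_(dirx i) (phi n) \- fx i)%R <= (2 ^- k.+1)%:E)%E.
    by apply: filter_forall => i; have /L2_cvgP := cfx i; exact.
  by have [n [[n1 n2] n3]] := filter_ex (filterI (filterI (cf _ e0) fxk) (cfy _ e0)); exists n.
exists (phi \o s); split => /= [k|k|i k|k]; first exact: Cphi.
- by have [] := Hs k.
- by have [_ ] := Hs k.
- by have [] := Hs k.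
Qed.

(** By Fubini the squared errors on the slices have summable integrals over y, so [ae_cvg0]
    applies. *)
Lemma ae_slice_cvg l (psi : nat -> X -> R) (f : X -> R) :
  (forall k, measurable_fun (@setT XT) (psi k)) -> measurable_fun (@setT XT) f ->
  (forall k, (sqint (strip N l) (psi k \- f)%R <= (2 ^- k.+1)%:E)%E) ->
  {ae lebesgue_itv l, forall y,
    L2_cvg (lebesgue_rV N) (fun k x => psi k (x, y)) (fun x => f (x, y))}.
Proof.
move=> mpsi mf rate.
have md k : measurable_fun (@setT XT) (psi k \- f)%R by exact: measurable_funB.
have : {ae lebesgue_itv l, forall y, forall e : R, 0 < e ->
    \forall k \near \oo, (rV2 (fun x => (psi k \- f)%R (x, y)) <= e%:E)%E}.
  apply: ae_cvg0 => [k|k y|k]; first exact: measurable_sqint_slice.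
    exact: sqint_ge0.
  by rewrite -sqint_strip.
have FF : Filter (nbhs (almost_everywhere (lebesgue_itv l))).
  exact: ae_filter_ringOfSetsType.
by apply: filterS => y Hy; apply/L2_cvgP => e /Hy.
Qed.

Lemma ae_itv l : {ae lebesgue_itv l, forall y : R, 0 < y < l}.
Proof.
exists (~` `]0%R, l[); split; first by apply: measurableC.
  by rewrite /lebesgue_itv /mrestr setICl measure0.
by move=> y /= /negP ny; rewrite in_itv/=; apply/negP.
Qed.

(** The limit of [slice_le_strip] and [strip_le_slice] along the approximation. Since [g] is any
    limit of slices at height [y], this covers traces at the ends as well as interior slices. *)
Lemma slice_mean l (u : sobolev N l) phi y (g : 'rV[R]_N -> R) (s : R) : 0 < l -> 0 < s ->
  approx l phi u (sob_dx u) (sob_dy u) -> g \in Lfun (lebesgue_rV N) 2%:E ->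
  L2_cvg (lebesgue_rV N) (fun k x => phi k (x, y)) g -> 0 <= y <= l ->
  `|fine (rV2 g) - fine (sqint (strip N l) u) / l| <=
    s * fine (sqint (strip N l) u) + s^-1 * fine (sqint (strip N l) (sob_dy u)).
Proof.
move=> l0 s0 [Cphi cu _ cy] Lg cg yl.
have Lu := sob_val_L2 u; have Ly := sob_dy_L2 u.
pose M := fine (sqint (strip N l) u); pose Y := fine (sqint (strip N l) (sob_dy u)).
pose m := fine (rV2 g); rewrite -/M -/Y -/m.
have uM : sqint (strip N l) u = M%:E by rewrite fineK// Lfun2_sqint.
have yY : sqint (strip N l) (sob_dy u) = Y%:E by rewrite fineK// Lfun2_sqint.
have gm : rV2 g = m%:E by rewrite fineK// Lfun2_sqint.
have mphi k := Cc_measurable (Cphi k).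
have si : 0 < s^-1 by rewrite invr_gt0.
have key : forall e, 0 < e -> l * m <= M + l * (s * M + s^-1 * Y) + (2 * l + 2 + l * s + l / s) * e /\
    M <= l * m + l * (s * M + s^-1 * Y) + (2 * l + 2 + l * s + l / s) * e.
  move=> e e0.
  have h1 := L2_cvg_sqint_le mphi Lu cu e0.
  have h2 := L2_cvg_sqint_le (fun k => Cc_measurable (Cc_derive (diry N) (Cphi k))) Ly cy e0.
  have h3 := L2_cvg_sqint_le (fun k => measurable_slice_x y (mphi k)) Lg cg e0.
  have [k [[[k1 k2] [k3 k4]] [k5 k6]]] := filter_ex (filterI (filterI h1 h2) h3).
  have [a fa] : exists a, sqint (strip N l) (phi k) = a%:E.
    by exists (fine (sqint (strip N l) (phi k))); rewrite fineK// Cc_sqint_fin.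
  have [b fb] : exists b, sqint (strip N l) ('D_(diry N) (phi k)) = b%:E.
    by exists (fine (sqint (strip N l) ('D_(diry N) (phi k)))); rewrite fineK// Cc_sqint_fin//; exact: Cc_derive.
  have [c fc] : exists c, rV2 (fun x => phi k (x, y)) = c%:E.
    have [C _ /(_ y) HC] := Cc_slice_bound (Cphi k).
    exists (fine (rV2 (fun x => phi k (x, y)))); rewrite fineK//.
    by rewrite ge0_fin_numE ?sqint_ge0// (le_lt_trans HC)// ltry.
  move: k1 k2 k3 k4 k5 k6; rewrite fa fb fc uM yY gm -!EFinD !lee_fin => k1 k2 k3 k4 k5 k6.
  have := slice_le_strip l0 s0 (Cphi k) yl; have := strip_le_slice l0 s0 (Cphi k) yl.
  rewrite /variation fa fb fc -!EFinM -!EFinD -?EFinM -?EFinD !lee_fin => v1 v2.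
  have w1 : s * a <= s * (M + e) by rewrite ler_pM2l.
  have w2 : s^-1 * b <= s^-1 * (Y + e) by rewrite ler_pM2l.
  have w3 : l * (s * a + s^-1 * b) <= l * (s * (M + e) + s^-1 * (Y + e)) by rewrite ler_pM2l// lerD.
  have w4 : l * m <= l * (c + e) by rewrite ler_pM2l.
  have w5 : l * c <= l * (m + e) by rewrite ler_pM2l.
  have le0 : 0 < l * e by rewrite mulr_gt0.
  by rewrite /= in v1 v2 *; split; lra.
pose K := 2 * l + 2 + l * s + l / s.
have K0 : 0 < K by rewrite !addr_gt0// ?mulr_gt0.
have [k1 k2] : l * m <= M + l * (s * M + s^-1 * Y) /\ M <= l * m + l * (s * M + s^-1 * Y).
  split; apply/ler_addgt0Pr => e e0; have eK : 0 < e / K by rewrite divr_gt0.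
    by have [h _] := key _ eK; move: h; rewrite -/K [K * _]mulrC divfK// gt_eqF.
  by have [_ h] := key _ eK; move: h; rewrite -/K [K * _]mulrC divfK// gt_eqF.
rewrite -(ler_pM2l l0) -[X in X * `|_|](gtr0_norm l0) -normrM mulrBr.
rewrite [l * (M / l)]mulrC divfK ?gt_eqF// ler_norml; apply/andP; split; lra.
Qed.

End slices.

Section slice_action.
Context {R : realType} (N : nat).
Local Notation X := ('rV[R]_N * R)%type.
Local Notation XT := ('rV[R]_N * measurableTypeR R)%type.
Local Notation Cc := (@Cc_infty R N setT).
Local Notation rV2 := (sqint (@lebesgue_rV R N)).
Variables (p w : R).
Implicit Types (l y : R).

Definition slice_dx l (u : sobolev N l) y : \bar R :=
  (\sum_i rV2 (fun x => sob_dx u i (x, y)))%E.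

Definition slice_pow l (u : sobolev N l) y : \bar R :=
  (\int[lebesgue_rV N]_x (`|u (x, y)| `^ p)%:E)%E.

(** The action functional on R^N, with [w] as multiplier of the mass; its integral over the graph is
    [J + w M]. The [fine]s give default values on a null set of [y], which [good_slice] avoids. *)
Definition slice_action l (u : sobolev N l) y : R :=
  2^-1 * fine (slice_dx u y) - p^-1 * fine (slice_pow u y) +
  w * fine (rV2 (fun x => u (x, y))).

Lemma integral_slice_action l (u : sobolev N l) (P : R) :
  (\int[strip N l]_z (`|u z| `^ p)%:E)%E = P%:E ->
  [/\ (lebesgue_itv l).-integrable setT (EFin \o slice_action u),
    \int[lebesgue_itv l]_y slice_action u y =
      2^-1 * fine (\sum_i sqint (strip N l) (sob_dx u i))%E - p^-1 * P
      + w * fine (sqint (strip N l) u) &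
    {ae lebesgue_itv l, forall y, [/\ rV2 (fun x => u (x, y)) \is a fin_num,
      slice_dx u y \is a fin_num & slice_pow u y \is a fin_num]}].
Proof.
move=> uP; have mu := Lfun2_measurable (sob_val_L2 u).
have mx i := Lfun2_measurable (sob_dx_L2 u i).
have mpow := @measurable_powR_norm R p _ XT _ mu.
have pow0 (z : XT) : (0 <= (`|u z| `^ p)%:E)%E by rewrite lee_fin powR_ge0.
have m0 (y : measurableTypeR R) : (0 <= rV2 (fun x => u (x, y)))%E by exact: sqint_ge0.
have x0 (y : measurableTypeR R) : (0 <= slice_dx u y)%E.
  by apply: sume_ge0 => i _; exact: sqint_ge0.
have p0 (y : measurableTypeR R) : (0 <= slice_pow u y)%E by apply: integral_ge0.
have mm : measurable_fun (@setT (measurableTypeR R)) (fun y => rV2 (fun x => u (x, y))).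
  exact: measurable_sqint_slice.
have mdx : measurable_fun (@setT (measurableTypeR R)) (slice_dx u).
  by apply: emeasurable_sum => i; exact: (measurable_sqint_slice (mx i)).
have mp : measurable_fun (@setT (measurableTypeR R)) (slice_pow u).
  exact: (measurable_strip_x mpow pow0).
have im : (\int[lebesgue_itv l]_y rV2 (fun x => u (x, y)) = (fine (sqint (strip N l) u))%:E)%E.
  by rewrite fineK -?sqint_strip// Lfun2_sqint// sob_val_L2.
have ix : (\int[lebesgue_itv l]_y slice_dx u y =
    (fine (\sum_i sqint (strip N l) (sob_dx u i)))%:E)%E.
  rewrite fineK; last by apply/sum_fin_numP => i _ _; exact: Lfun2_sqint (sob_dx_L2 _ _).
  rewrite /slice_dx ge0_integral_sum//.
  - by apply: eq_bigr => i _; rewrite sqint_strip.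
  - by move=> i; exact: (measurable_sqint_slice (mx i)).
  - by move=> i y _; exact: sqint_ge0.
have ip : (\int[lebesgue_itv l]_y slice_pow u y = P%:E)%E.
  by rewrite -uP (strip_yx _ mpow pow0).
have [fm Im Em] := integrable_fine mm m0 im.
have [fx Ix Ex] := integrable_fine mdx x0 ix.
have [fp Ip Ep] := integrable_fine mp p0 ip.
have I1 : (lebesgue_itv l).-integrable setT (EFin \o (fun y => 2^-1 * fine (slice_dx u y))).
  exact: (integrableZl measurableT _ Ix).
have I2 : (lebesgue_itv l).-integrable setT (EFin \o (fun y => p^-1 * fine (slice_pow u y))).
  exact: (integrableZl measurableT _ Ip).
have I3 : (lebesgue_itv l).-integrable setT (EFin \o (fun y => w * fine (rV2 (fun x => u (x, y))))).
  exact: (integrableZl measurableT _ Im).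
have I4 : (lebesgue_itv l).-integrable setT
    (EFin \o (fun y => 2^-1 * fine (slice_dx u y) - p^-1 * fine (slice_pow u y))).
  exact: (integrableB measurableT I1 I2).
split.
- exact: (integrableD measurableT I4 I3).
- rewrite (RintegralD measurableT I4 I3) (RintegralB measurableT I1 I2).
  rewrite (RintegralZl _ measurableT Ix) (RintegralZl _ measurableT Ip).
  by rewrite (RintegralZl _ measurableT Im) Em Ex Ep.
- have FF : Filter (nbhs (almost_everywhere (lebesgue_itv l))).
    exact: ae_filter_ringOfSetsType.
  by apply: filterS3 fm fx fp => y.
Qed.

(** What makes the slice at [y] extendable by [realized_tensor]; this holds for almost every [y]. *)
Definition good_slice l (u : sobolev N l) (psi : nat -> X -> R) y :=
  [/\ 0 < y < l,
    (fun x => u (x, y)) \in Lfun (lebesgue_rV N) 2%:E /\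
      (forall i, (fun x => sob_dx u i (x, y)) \in Lfun (lebesgue_rV N) 2%:E),
    L2_cvg (lebesgue_rV N) (fun k x => psi k (x, y)) (fun x => u (x, y)),
    forall i, L2_cvg (lebesgue_rV N) (fun k x => 'D_(dirx i) (psi k) (x, y))
      (fun x => sob_dx u i (x, y)) &
    slice_pow u y \is a fin_num].

Lemma ae_good_slice l (u : sobolev N l) (P a : R) t : is_trace u a t ->
  (\int[strip N l]_z (`|u z| `^ p)%:E)%E = P%:E ->
  exists2 psi, approx l psi u (sob_dx u) (sob_dy u) &
    {ae lebesgue_itv l, forall y, good_slice u psi y}.
Proof.
move=> /is_trace_of[_ [phi /approx_rate[psi [Cpsi r1 r2 r3]] _]] uP.
have mu := Lfun2_measurable (sob_val_L2 u).
have mx i := Lfun2_measurable (sob_dx_L2 u i).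
exists psi.
  by split => // [|i|]; apply: L2_cvg_of_rate; [exact: r1|exact: r2|exact: r3].
have [_ _ fin] := integral_slice_action uP.
have c1 := ae_slice_cvg (fun k => Cc_measurable (Cpsi k)) mu r1.
have FF : Filter (nbhs (almost_everywhere (lebesgue_itv l))).
  exact: ae_filter_ringOfSetsType.
have c2 : {ae lebesgue_itv l, forall y, forall i, L2_cvg (lebesgue_rV N)
    (fun k x => 'D_(dirx i) (psi k) (x, y)) (fun x => sob_dx u i (x, y))}.
  apply: filter_forall => i.
  exact: (ae_slice_cvg (fun k => Cc_measurable (Cc_derive (dirx i) (Cpsi k))) (mx i) (r2 i)).
apply: filterS2 (filterI (ae_itv l) fin) (filterI c1 c2) => y [yl [f1 f2 f3]] [d1 d2].
split => //; split => [|i]; apply/Lfun2P; split.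
- exact: (measurable_slice_x _ mu).
- by rewrite ltey_eq f1.
- exact: (measurable_slice_x _ (mx i)).
- by move/sum_fin_numP : f2 => /(_ i); rewrite mem_index_enum => /(_ isT isT) h; rewrite ltey_eq h.
Qed.

End slice_action.

(** * Choice of a slice, and the two competitors built from it *)

Section slice_extension.
Context {R : realType} (N : nat) (G : metric_graph R).
Local Notation X := ('rV[R]_N * R)%type.
Local Notation XT := ('rV[R]_N * measurableTypeR R)%type.
Local Notation Cc := (@Cc_infty R N setT).
Local Notation rV2 := (sqint (@lebesgue_rV R N)).
Variable p : R.

(** An average: otherwise [L] times the action exceeds [c] on almost every slice of every edge, and
    integrating over the graph gives [L c > c L]. *)
Lemma exists_slice (w : R) (u : H1 N G) (M X P : R) (e0 : edge G) : p != 0 ->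
  norm_pow u 2 = M%:E -> normsq_dx u = X%:E -> norm_pow u p = P%:E ->
  exists e psi y, [/\ approx (len e) psi (u e) (sob_dx (u e)) (sob_dy (u e)),
    good_slice p (u e) psi y &
    (\sum_(e : edge G) len e) * slice_action p w (u e) y <= 2^-1 * X - p^-1 * P + w * M].
Proof.
move=> p0 uM uX uP; set c := 2^-1 * X - _ + _; set L := \sum_(e : edge G) len e.
have pow0 e : (0 <= \int[strip N (len e)]_z (`|u e z| `^ p)%:E)%E.
  by apply: integral_ge0 => z _; rewrite lee_fin powR_ge0.
have powfin e : (\int[strip N (len e)]_z (`|u e z| `^ p)%:E)%E \is a fin_num.
  rewrite ge0_fin_numE//; apply: (@le_lt_trans _ _ P%:E); last by rewrite ltry.
  rewrite -uP norm_powE// (bigD1 e)//= leeDl//.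
  by apply: sume_ge0 => i _; exact: pow0.
pose Pe e := fine (\int[strip N (len e)]_z (`|u e z| `^ p)%:E)%E.
have PeE e : (\int[strip N (len e)]_z (`|u e z| `^ p)%:E)%E = (Pe e)%:E by rewrite fineK.
have act e := integral_slice_action w (PeE e).
apply: contrapT => no.
have lt_e e : 0 < L * (2^-1 * fine (\sum_i sqint (strip N (len e)) (sob_dx (u e) i))%E
    - p^-1 * Pe e + w * fine (sqint (strip N (len e)) (u e))) - c * len e.
  have [I1 <- _] := act e.
  have [t [tr _]] := @H1_trace _ _ _ u e true e true erefl.
  have [psi ap good] := ae_good_slice w tr (PeE e).
  have I2 : (lebesgue_itv (len e)).-integrable setT
      (EFin \o (fun y => L * slice_action p w (u e) y)).
    exact: (integrableZl measurableT _ I1).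
  have I3 : (lebesgue_itv (len e)).-integrable setT (EFin \o (fun=> c)).
    exact: finite_measure_integrable_cst.
  have I4 := integrableB measurableT I2 I3.
  have FF : Filter (nbhs (almost_everywhere (lebesgue_itv (len e)))).
    exact: ae_filter_ringOfSetsType.
  have pos : {ae lebesgue_itv (len e), forall y, 0 < L * slice_action p w (u e) y - c}.
    move: good; apply: filterS => y gy; rewrite subr_gt0 ltNge; apply/negP => le_c.
    by apply: no; exists e, psi, y.
  have := @Rintegral_gt0 _ (measurableTypeR R) R (lebesgue_itv (len e))
    (fun y => L * slice_action p w (u e) y - c) I4.
  rewrite (RintegralB measurableT I2 I3) (RintegralZl _ measurableT I1).
  have -> : \int[lebesgue_itv (len e)]_y c = c * len e.
    by rewrite /Rintegral (integral_lebesgue_itv_cst _ (len_gt0 e)).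
  apply; first by move: pos; apply: filterS => y /ltW.
  move=> ae0; have mT : (0 < lebesgue_itv (len e) setT)%E.
    by rewrite (lebesgue_itvT (len_gt0 e)) lte_fin len_gt0.
  have PF := ae_properfilter_algebraOfSetsType mT.
  by have [y [y1 y2]] := filter_ex (filterI pos ae0); rewrite y2 ltxx in y1.
have : 0 < \sum_e (L * (2^-1 * fine (\sum_i sqint (strip N (len e)) (sob_dx (u e) i))%E
    - p^-1 * Pe e + w * fine (sqint (strip N (len e)) (u e))) - c * len e).
  (* The edge [e0] makes the sum nonempty, hence strictly positive. *)
  by rewrite (bigD1 e0)//= ltr_wpDr// sumr_ge0// => e _; exact/ltW.
rewrite sumrB -!mulr_sumr big_split/= sumrB -!mulr_sumr -/L.
have -> : \sum_e fine (\sum_i sqint (strip N (len e)) (sob_dx (u e) i))%E = X.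
  apply: EFin_inj; rewrite -uX normsq_dxE -sumEFin; apply: eq_bigr => e _.
  by rewrite fineK//; apply/sum_fin_numP => i _ _; exact: Lfun2_sqint (sob_dx_L2 _ _).
have -> : \sum_e Pe e = P.
  by apply: EFin_inj; rewrite -uP norm_powE// -sumEFin; apply: eq_bigr => e _; rewrite PeE.
have -> : \sum_e fine (sqint (strip N (len e)) (u e)) = M.
  apply: EFin_inj; rewrite -uM norm_pow2E -sumEFin; apply: eq_bigr => e _.
  by rewrite fineK// Lfun2_sqint// sob_val_L2.
by rewrite -/c mulrC subrr ltxx.
Qed.

(** Each [h e] is 1 at both ends of its edge, so all traces equal [g] and the vertex conditions hold
    whatever the graph. The norms factor into a part in x and a part in y. *)
Lemma realized_tensor (psi : nat -> X -> R) y0 (g : 'rV[R]_N -> R)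
    (gx : 'I_N -> 'rV[R]_N -> R) (h : edge G -> {poly R}) (m x P : R) (dh kh : edge G -> R) :
  p != 0 -> (forall k, Cc (psi k)) -> g \in Lfun (lebesgue_rV N) 2%:E ->
  (forall i, gx i \in Lfun (lebesgue_rV N) 2%:E) ->
  L2_cvg (lebesgue_rV N) (fun k x => psi k (x, y0)) g ->
  (forall i, L2_cvg (lebesgue_rV N) (fun k x => 'D_(dirx i) (psi k) (x, y0)) (gx i)) ->
  rV2 g = m%:E -> (\sum_i rV2 (gx i))%E = x%:E ->
  (\int[lebesgue_rV N]_x (`|g x| `^ p)%:E)%E = P%:E ->
  (forall e, (h e).[0] = 1 /\ (h e).[len e] = 1) ->
  (forall e, sqint (lebesgue_itv (len e)) (horner (h e)) = (len e)%:E) ->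
  (forall e, sqint (lebesgue_itv (len e)) (horner (h e)^`()) = (dh e)%:E) ->
  (forall e, (\int[lebesgue_itv (len e)]_y (`|(h e).[y]| `^ p)%:E)%E = (kh e)%:E) ->
  realized N G p (m * \sum_(e : edge G) len e) (x * \sum_(e : edge G) len e) (m * \sum_(e : edge G) dh e) (P * \sum_(e : edge G) kh e).
Proof.
move=> p0 Cpsi Lg Lgx cg cgx gm gxx gP hend hl hd hk.
have mg := Lfun2_measurable Lg; have mgx i := Lfun2_measurable (Lgx i).
have mh e := measurable_horner (h e); have mdh e := measurable_horner (h e)^`().
have [v Hv] : exists v : H1 N G, forall e, [/\ sob_val (v e) = (fun z => g z.1 * (h e).[z.2]),
    sob_dx (v e) = (fun i z => gx i z.1 * (h e).[z.2]) &
    sob_dy (v e) = (fun z => g z.1 * (h e)^`().[z.2])].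
  apply: H1_approx => [e|e i|e|e s e' s' _].
  - exact: Lfun2_tensor (len_gt0 e) Lg.
  - exact: Lfun2_tensor (len_gt0 e) (Lgx i).
  - exact: Lfun2_tensor (len_gt0 e) Lg.
  have tr f b : trace_of (len f) (fun z : X => g z.1 * (h f).[z.2])
      (fun i z => gx i z.1 * (h f).[z.2]) (fun z => g z.1 * (h f)^`().[z.2]) (end_pos f b) g.
    have endl : 0 <= end_pos f b <= len f.
      by rewrite /end_pos; case: b; rewrite ?lexx ?(ltW (len_gt0 f)).
    have := trace_of_tensor (h f) (len_gt0 f) Cpsi Lg Lgx cg cgx endl.
    rewrite (_ : (fun x => g x * _) = g)//; apply/funext => z; have [h0 h1] := hend f.
    by rewrite /end_pos; case: b {endl}; rewrite ?h0 ?h1 mulr1.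
  by exists g.
exists v; split.
- rewrite norm_pow2E mulr_sumr -sumEFin; apply: eq_bigr => e _; have [-> _ _] := Hv e.
  by rewrite (sqint_tensor _ mg (mh e)) gm hl.
- rewrite normsq_dxE mulr_sumr -sumEFin; apply: eq_bigr => e _; have [_ -> _] := Hv e.
  rewrite EFinM -gxx ge0_sume_distrl; last by move=> i _; exact: sqint_ge0.
  by apply: eq_bigr => i _; rewrite (sqint_tensor _ (mgx i) (mh e)) hl.
- rewrite normsq_dyE mulr_sumr -sumEFin; apply: eq_bigr => e _; have [_ _ ->] := Hv e.
  by rewrite (sqint_tensor _ mg (mdh e)) gm hd.
- rewrite norm_powE// mulr_sumr -sumEFin; apply: eq_bigr => e _; have [-> _ _] := Hv e.
  by rewrite (integral_powR_tensor _ _ mg (mh e)) gP hk.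
Qed.

Lemma mass_mean (u : H1 N G) (M Y s : R) : 0 < s ->
  norm_pow u 2 = M%:E -> normsq_dy u = Y%:E ->
  forall e a g psi, approx (len e) psi (u e) (sob_dx (u e)) (sob_dy (u e)) ->
  g \in Lfun (lebesgue_rV N) 2%:E ->
  L2_cvg (lebesgue_rV N) (fun k x => psi k (x, a)) g -> 0 <= a <= len e ->
  `|fine (rV2 g) - fine (sqint (strip N (len e)) (u e)) / len e| <= s * M + s^-1 * Y.
Proof.
move=> s0 uM uY e a g psi ap Lg cg al.
apply: (le_trans (slice_mean (len_gt0 e) s0 ap Lg cg al)).
have Lu f := Lfun2_sqint (sob_val_L2 (u f)); have Ly f := Lfun2_sqint (sob_dy_L2 (u f)).
rewrite lerD// ler_pM2l ?invr_gt0// -lee_fin fineK//.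
- by rewrite -uM norm_pow2E (bigD1 e)//= leeDl// sume_ge0// => i _; exact: sqint_ge0.
- by rewrite -uY normsq_dyE (bigD1 e)//= leeDl// sume_ge0// => i _; exact: sqint_ge0.
Qed.

(** Both competitors extend the slice of [exists_slice], by the constant 1 and by [bump]. They have
    the same mass and the same [X], and the second has a larger [P]. *)
Lemma realized_slice : 2 < p -> exists2 C : R, 0 < C &
  forall M X Y P w, @realized R N G p M X Y P -> 0 < M -> exists M' X' P',
  [/\ realized N G p M' X' 0 P',
    2^-1 * X' - p^-1 * P' + w * M' <= 2^-1 * X - p^-1 * P + w * M,
    forall s : R, 0 < s -> `|M' - M| <= C * (s * M + s^-1 * Y) &
    0 < M' -> exists X2 Y2 P2, realized N G p M' X2 Y2 P2 /\
      2^-1 * X2 - p^-1 * P2 < 2^-1 * X' - p^-1 * P'].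
Proof.
move=> p2; have p0 : p != 0 by rewrite gt_eqF// (lt_trans _ p2).
have [C1 C10 HC1] := graph_variation G.
set L := \sum_(e : edge G) len e.
have L0 : 0 <= L by apply: sumr_ge0 => e _; exact/ltW/len_gt0.
have CL0 : 0 <= L * (1 + C1 * 2) by rewrite mulr_ge0// addr_ge0// mulr_ge0.
exists (L * (1 + C1 * 2) + 1); first by rewrite ltr_wpDl.
move=> M X Y P w SMP M0; have [_ _ Y0 _] := realized_ge0 SMP.
have [u [uM uX uY uP]] := SMP.
have [e0] : exists e : edge G, True.
  apply: contrapT => no; move: M0; rewrite -lte_fin -uM norm_pow2E big1 ?ltxx// => e _.
  by exfalso; apply: no; exists e.
move=> _; have [e [psi [y [ap gy le_c]]]] := exists_slice w e0 p0 uM uX uP.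
have [/andP[y0 yl] [Lg Lgx] cg cgx pf] := gy.
have [Cpsi _ _ _] := ap.
pose g x := u e (x, y); pose gx i x := sob_dx (u e) i (x, y).
pose m := fine (rV2 g); pose x := fine (slice_dx (u e) y).
pose pi := fine (slice_pow p (u e) y).
have gm : rV2 g = m%:E by rewrite fineK// Lfun2_sqint.
have gxx : (\sum_i rV2 (gx i))%E = x%:E.
  by rewrite fineK//; apply/sum_fin_numP => i _ _; exact: Lfun2_sqint (Lgx i).
have gp : (\int[lebesgue_rV N]_x (`|g x| `^ p)%:E)%E = pi%:E by rewrite fineK.
have m0 : 0 <= m by rewrite fine_ge0// sqint_ge0.
have S1 : realized N G p (m * L) (x * L) (m * \sum_(f : edge G) 0) (pi * L).
  apply: (realized_tensor (h := fun=> 1) p0 Cpsi Lg Lgx cg cgx gm gxx gp) => f.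
  - by rewrite !hornerC.
  - transitivity (\int[lebesgue_itv (len f)]_y (1 : \bar R))%E.
      by apply: eq_integral => z _; rewrite hornerC expr1n.
    by rewrite (integral_lebesgue_itv_cst _ (len_gt0 f)) mul1e.
  - transitivity (\int[lebesgue_itv (len f)]_y (0 : \bar R))%E; last by rewrite integral0.
    by apply: eq_integral => z _; rewrite -[1]/(1%:P) derivC horner0 expr0n.
  - transitivity (\int[lebesgue_itv (len f)]_y (1 : \bar R))%E.
      by apply: eq_integral => z _; rewrite hornerC normr1 powR1.
    by rewrite (integral_lebesgue_itv_cst _ (len_gt0 f)) mul1e.
rewrite big1 ?mulr0// in S1.
exists (m * L), (x * L), (pi * L); split => //.
- move: le_c; rewrite /slice_action -/x -/pi -/L.
  rewrite -[fine (rV2 _)]/m => le_c; apply: le_trans le_c.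
  by rewrite le_eqVlt; apply/orP; left; apply/eqP; ring.
- move=> s s0; set D := s * M + s^-1 * Y.
  have D0 : 0 <= D by rewrite addr_ge0// mulr_ge0// ?invr_ge0 ltW.
  pose f e := fine (sqint (strip N (len e)) (u e)) / len e.
  (* The mean masses of two edges that meet are both within [D] of the mass of their common
     trace. *)
  have fD e1 s1 e2 s2 : endpoint e1 s1 = endpoint e2 s2 -> `|f e1 - f e2| <= 2 * D.
    move=> /(@H1_trace _ _ _ u)[t [/is_trace_of[Lt [q1 a1 c1]] /is_trace_of[_ [q2 a2 c2]]]].
    have b1 (e3 : edge G) b : 0 <= end_pos e3 b <= len e3.
      by rewrite /end_pos; case: b; rewrite ?lexx ?(ltW (len_gt0 e3)).
    have d1 : `|fine (rV2 t) - f e1| <= D := mass_mean s0 uM uY a1 Lt c1 (b1 _ _).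
    have d2 : `|fine (rV2 t) - f e2| <= D := mass_mean s0 uM uY a2 Lt c2 (b1 _ _).
    move: d1 d2; rewrite !ler_norml => /andP[? ?] /andP[? ?].
    by apply/andP; split; lra.
  have D2 : 0 <= 2 * D by rewrite mulr_ge0.
  have fee := HC1 f (2 * D) D2 fD e.
  have yle : 0 <= y <= len e by rewrite !ltW.
  have me : `|m - f e| <= D := mass_mean s0 uM uY ap Lg cg yle.
  have ME : M = \sum_e f e * len e.
    apply: EFin_inj; rewrite -uM norm_pow2E -sumEFin; apply: eq_bigr => e' _.
    by rewrite /f divfK ?gt_eqF ?len_gt0// fineK// Lfun2_sqint// sob_val_L2.
  (* [M' - M] is the sum over the edges of length times [m - f e']. Each difference goes through
     [f e], the mean mass on the edge that carries the slice. *)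
  rewrite ME mulr_sumr -sumrB; apply: (le_trans (ler_norm_sum _ _ _)).
  apply: (@le_trans _ _ (\sum_(e' : edge G) len e' * ((1 + C1 * 2) * D))).
    apply: ler_sum => e' _; rewrite -mulrBl normrM (gtr0_norm (len_gt0 e')) mulrC.
    rewrite ler_pM2l ?len_gt0// mulrDl mul1r -mulrA.
    by rewrite -(subrKA (f e)) (le_trans (ler_normD _ _))// lerD.
  by rewrite -mulr_suml -/L mulrA [leRHS]mulrDl mul1r lerDl.
- move=> mL; have mpos : 0 < m.
    by rewrite lt0r m0 andbT; apply: contraTneq mL => ->; rewrite mul0r ltxx.
  (* A slice of positive mass has a positive p-norm; otherwise multiplying by [bump] would gain
     nothing. *)
  have pipos : 0 < pi.
    rewrite lt0r fine_ge0 ?andbT; last by apply: integral_ge0 => z _; rewrite lee_fin powR_ge0.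
    apply/eqP => pi0; move: gm; rewrite sqint_powR.
    rewrite (@integral_powR_eq0 _ _ _ _ _ p)//.
    + by move=> [m00]; rewrite -m00 ltxx in mpos.
    + exact: Lfun2_measurable Lg.
    + by rewrite gp pi0.
  have /choice[dh Hdh] (f : edge G) : exists d : R,
      sqint (lebesgue_itv (len f)) (horner (bump (len f))^`()) = d%:E.
    exists (fine (sqint (lebesgue_itv (len f)) (horner (bump (len f))^`()))).
    by rewrite fineK// ge0_fin_numE ?sqint_ge0// sqint_horner_fin// len_gt0.
  have /choice[kh Hkh] (f : edge G) : exists k : R, len f < k /\
      (\int[lebesgue_itv (len f)]_y (`|(bump (len f)).[y]| `^ p)%:E)%E = k%:E.
    by have [k k1 k2] := integral_powR_bump (len_gt0 f) p2; exists k.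
  have S2 : realized N G p (m * L) (x * L) (m * \sum_(f : edge G) dh f) (pi * \sum_(f : edge G) kh f).
    apply: (realized_tensor (h := fun f => bump (len f)) p0 Cpsi Lg Lgx cg cgx gm gxx gp) => f.
    - by apply: bump_end; rewrite gt_eqF// len_gt0.
    - exact: sqint_bump (len_gt0 f).
    - exact: Hdh.
    - by have [] := Hkh f.
  exists (x * L), (m * \sum_(f : edge G) dh f), (pi * \sum_(f : edge G) kh f); split => //.
  rewrite ltrD2l ltrN2 ltr_pM2l ?invr_gt0 ?(lt_trans _ p2)// ltr_pM2l//.
  rewrite -subr_gt0 /L -sumrB (bigD1 e0)//= ltr_wpDr ?subr_gt0//; last by have [] := Hkh e0.
  by apply: sumr_ge0 => f _; rewrite subr_ge0; have [/ltW] := Hkh f.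
Qed.

End slice_extension.

(** * The critical mass from the attainable norms *)

Lemma powR_invE (R : realType) (x r : R) : 0 <= x -> x^-1 `^ r = (x `^ r)^-1.
Proof. by move=> x0; rewrite -powR_inv1// -powRrM mulN1r powRN. Qed.

(** The terms of first order in [t] cancel, so the ratio is [1 - O(t ^ 2)]. This cancellation is
    what the multiplier [w] is chosen for. *)
Lemma inv_bernoulli_powR (R : realType) (g t : R) : 1 < g -> g * `|t| <= 2^-1 ->
  1 - 2 * g ^+ 2 * t ^+ 2 <= (1 + g * t) / (1 + t) `^ g <= 1.
Proof.
move=> g1; rewrite -[in g * `|t|](gtr0_norm (lt_trans ltr01 g1)) -normrM ler_norml.
move=> /andP[gt1 gt2].
have t1 : - 2^-1 <= t by nra.
have t2 : t <= 2^-1 by nra.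
have p0 : 0 < (1 + t) `^ g by rewrite powR_gt0//; lra.
apply/andP; split; last first.
  by rewrite ler_pdivrMr// mul1r bernoulli_powR//; lra.
have t0 : 0 < 1 + t by lra.
(* Bernoulli at [1 / (1 + t)] bounds [(1 + t) ^ (- g)] from below by [(1 + t - g t) / (1 + t)]. *)
have := @bernoulli_powR R g ((1 + t)^-1 - 1) g1.
have -> : 1 + ((1 + t)^-1 - 1) = (1 + t)^-1 by rewrite addrC subrK.
rewrite invr_ge0 ltW// => /(_ isT).
rewrite powR_invE ?(ltW t0)// => H.
have H2 : (1 + t + - g * t) / (1 + t) <= ((1 + t) `^ g)^-1.
  apply: le_trans H; rewrite le_eqVlt; apply/orP; left; apply/eqP.
  by field; rewrite gt_eqF.
apply: (@le_trans _ _ ((1 + g * t) * ((1 + t + - g * t) / (1 + t)))); last first.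
  by apply: ler_wpM2l => //; lra.
rewrite mulrA ler_pdivlMr//; nra.
Qed.

Section threshold.
Context {R : realType} (N : nat) (p : R).
Hypotheses (N1 : (1 <= N)%N) (p2 : 2 < p) (pN : p <= 2 + 4 / (N + 1)%:R).
(* [S M X Y P]: some function has [M = |u|_2^2], [X = |d_x u|_2^2],
   [Y = |d_y u|_2^2] and [P = |u|_p^p]. *)
Variable S : R -> R -> R -> R -> Prop.
Local Notation J X P := (2^-1 * X - p^-1 * P).
Let r := (p - 2) / (2 + 4 / N%:R - p).

Hypothesis S_ge0 : forall M X Y P, S M X Y P ->
  [/\ 0 <= M, 0 <= X, 0 <= Y & 0 <= P].
Hypothesis S_mass0 : forall X Y P, S 0 X Y P -> P = 0.
Hypothesis S_dilation : forall M X Y P (a l : R), S M X Y P -> 0 < a -> 0 < l ->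
  S (a ^+ 2 * l ^- N * M) (a ^+ 2 * l ^+ 2 * l ^- N * X)
    (a ^+ 2 * l ^- N * Y) (a `^ p * l ^- N * P).
Hypothesis S_GN : exists2 C : R, 0 < C & forall M X Y P, S M X Y P ->
  forall t s : R, 0 < t -> 1 <= s ->
  P <= t `^ (- r) * M + t * (C * (s * M + s^-1 * Y) `^ (2 / N%:R) * X).
Hypothesis S_slice : exists2 C : R, 0 < C & forall M X Y P w,
  S M X Y P -> 0 < M -> exists M' X' P',
  [/\ S M' X' 0 P', J X' P' + w * M' <= J X P + w * M,
      forall s : R, 0 < s -> `|M' - M| <= C * (s * M + s^-1 * Y) &
      0 < M' -> exists X2 Y2 P2, S M' X2 Y2 P2 /\ J X2 P2 < J X' P'].

(** With [a = l ^ (2 / (p - 2))] in [S_dilation], both terms of [J] are multiplied by [l ^ (s + 2)],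
    and [M] and [Y] by [l ^ s]. *)
Let s := 4 / (p - 2) - N%:R.
Let g := (s + 2) / s.

Let N0 : 0 < N%:R :> R. Proof. by rewrite ltr0n. Qed.

Let s_gt0 : 0 < s.
Proof.
have p2' := p2; rewrite /s subr_gt0 ltr_pdivlMr; last lra.
move: pN; rewrite natrD -lerBlDl ler_pdivlMr; last by rewrite ltr_wpDl// ltW.
have N0' := N0; nra.
Qed.

Let g_gt1 : 1 < g.
Proof. by rewrite /g ltr_pdivlMr// mul1r ltrDl. Qed.

(** Here [r / N = 1 / s], so the second bound is [s >= 1], which is [p <= 2 + 4 / (N + 1)]. It keeps
    the growth in [Y] linear in [S_GN1]. *)
Let rN : 0 <= r /\ r / N%:R <= 1.
Proof.
have N0' := N0; have p2' := p2.
have pN' : (p - 2) * (N%:R + 1) <= 4.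
  by move: pN; rewrite natrD -lerBlDl ler_pdivlMr//; lra.
have e : 2 + 4 / N%:R - p = (4 - (p - 2) * N%:R) / N%:R.
  by field; rewrite gt_eqF.
rewrite /r e invf_div; have h : 0 < 4 - (p - 2) * N%:R by nra.
split; first by rewrite !mulr_ge0 ?invr_ge0 ?ltW//; lra.
rewrite (_ : _ * _ / _ = (p - 2) / (4 - (p - 2) * N%:R)); last first.
  by field; rewrite !gt_eqF.
by rewrite ler_pdivrMr// mul1r; nra.
Qed.

(* The dilation that multiplies [M] and [Y] by [c] and both terms of [J] by [c ^ g]. *)
Let S_scale M X Y P (c : R) : S M X Y P -> 0 < c ->
  S (c * M) (c `^ g * X) (c * Y) (c `^ g * P).
Proof.
move=> h c0; have s0 := s_gt0.
have sneq : s != 0 by rewrite gt_eqF.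
have p2n : p - 2 != 0 by rewrite gt_eqF//; have := p2; lra.
pose l := c `^ s^-1; pose a := l `^ (2 / (p - 2)).
have l0 : 0 < l by rewrite powR_gt0.
have a0 : 0 < a by rewrite powR_gt0.
have lne : (l != 0) by rewrite gt_eqF.
have := S_dilation h a0 l0.
have El : l ^- N = l `^ (- N%:R) by rewrite powRN powR_mulrn// ltW.
have E1 : a ^+ 2 * l ^- N = c.
  rewrite El -powR_mulrn ?ltW// -powRrM -powRD; last by rewrite lne implybT.
  rewrite -powRrM (_ : _ * _ = 1) ?powRr1 ?ltW//.
  rewrite (_ : _ + - _ = s) ?mulVf//.
  by rewrite /s; field.
have E2 : a ^+ 2 * l ^+ 2 * l ^- N = c `^ g.
  rewrite mulrAC E1 -{1}(powRr1 (ltW c0)) -powR_mulrn ?ltW// -powRrM -powRD.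
    by congr powR; rewrite /g; field.
  by rewrite [c == 0]gt_eqF// implybT.
have E3 : a `^ p * l ^- N = c `^ g.
  rewrite El -powRrM -powRD; last by rewrite lne implybT.
  rewrite -powRrM; congr powR; rewrite /g.
  rewrite (_ : _ + - _ = s + 2); first by rewrite mulrC.
  by rewrite /s; field.
by rewrite E1 E2 E3.
Qed.

Let gs M X Y P := S M X Y P /\ forall X' Y' P', S M X' Y' P' ->
  J X P + 2^-1 * Y <= J X' P' + 2^-1 * Y'.

(** A competitor of mass [c M] is brought back to mass [M] before minimality is used. *)
Let gs_scale M X Y P (c : R) X' Y' P' : gs M X Y P -> 0 < c -> S (c * M) X' Y' P' ->
  J X P + 2^-1 * Y <= (c `^ g)^-1 * J X' P' + c^-1 * (2^-1 * Y').
Proof.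
move=> [h1 h2] c0 /S_scale => /(_ c^-1).
rewrite invr_gt0 => /(_ c0); rewrite mulKf ?gt_eqF// => /h2 /le_trans; apply.
rewrite powR_invE ?(ltW c0)//; lra.
Qed.

(** Suppose [c = a / b > 1] and let [J], [J'] belong to the non-flat and the flat one. Each is
    scaled to the mass of the other: [c ^ g (J + Y / 2) <= J' <= c ^ g J + c Y / 2]. So
    [c ^ g Y <= c Y], although [c < c ^ g]. *)
Let gs_separated (a : R) X Y P (b : R) X' P' : 0 < b -> gs b X Y P -> 0 < Y ->
  gs a X' 0 P' -> a <= b.
Proof.
move=> b0 gb Y0 ga; rewrite leNgt; apply/negP => ab.
have a0 : 0 < a by lra.
have c0 : 0 < a / b by rewrite divr_gt0.
have h1 : S (a / b * b) X' 0 P' by rewrite divfK ?gt_eqF//; case: ga.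
have := gs_scale gb c0 h1.
have [hb _] := gb.
have [_] := ga; move/(_ _ _ _); have := S_scale hb c0; rewrite divfK ?gt_eqF//.
move=> h2 /(_ _ _ _ h2) h3.
set c := a / b in c0 h3 *.
have c1 : 1 < c by rewrite /c ltr_pdivlMr// mul1r.
have cg0 : 0 < c `^ g by rewrite powR_gt0.
have cg : c < c `^ g.
  have g1 := g_gt1; rewrite -[ltLHS](powRr1 (ltW c0)) /powR gt_eqF//.
  rewrite ltr_expR ltr_pM2r ?ln_gt0//; lra.
rewrite mulr0 mulr0 addr0 ler_pdivlMl// => h4; nra.
Qed.

(* A flat ground state of mass [a] has a non-flat competitor with smaller [J]; since
   [g > 1], for large masses the gain in [J] outweighs the cost in [Y]. *)
Let gs0_bounded : exists B : R, forall (a : R) X P, 0 < a -> gs a X 0 P -> a <= B.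
Proof.
have [[a [X [P [a0 ga]]]]|H] := pselect (exists a X P, 0 < a /\ gs a X 0 P);
    last first.
  by exists 0 => a X P a0 ga; exfalso; apply: H; exists a, X, P.
have [C C0 H] := S_slice.
have [Sa _] := ga.
have [M' [X' [P' [S' J' M'P' H2]]]] := H _ _ _ _ 0 Sa a0.
(* As [Y = 0], letting the weight [s] of [S_slice] tend to 0 leaves no room between [M'] and [a]. *)
have M'E : M' = a.
  apply/eqP; rewrite -subr_eq0 -normr_le0; apply/ler_addgt0Pl => e e0.
  rewrite addr0.
  have := M'P' (e / (C * a)); rewrite divr_gt0// ?mulr_gt0// => /(_ isT).
  suff -> : C * (e / (C * a) * a + (e / (C * a))^-1 * 0) = e by [].
  by field; rewrite !gt_eqF.
have := H2; rewrite M'E => /(_ a0)[X2 [Y2 [P2 [S2 J2]]]].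
rewrite !mul0r !addr0 in J'.
pose D := J X P - J X2 P2.
have D0 : 0 < D by rewrite /D; lra.
have [_ _ Y20 _] := S_ge0 S2.
(* For a flat mass [b = c a] the comparisons below give [c ^ g * 2 D <= c Y2], that is
   [c ^ (g - 1) <= Y2 / (2 D)]. *)
exists (a * Num.max 1 ((Y2 / (2 * D)) `^ (g - 1)^-1)) => b X3 P3 b0 gb.
rewrite -ler_pdivrMl// mulrC.
have c0 : 0 < b / a by rewrite divr_gt0.
have h1 : S (b / a * a) X3 0 P3 by rewrite divfK ?gt_eqF//; case: gb.
have := gs_scale ga c0 h1; rewrite !mulr0 !addr0.
have := S_scale S2 c0; rewrite divfK ?gt_eqF// => h2.
have [_ /(_ _ _ _ h2)] := gb.
set c := b / a in c0 *.
have cg0 : 0 < c `^ g by rewrite powR_gt0.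
have gn : c `^ g = c `^ (g - 1) * c.
  by rewrite mulrC mulr_powRB1// ?ltW// (lt_trans ltr01 g_gt1).
rewrite mulr0 addr0 ler_pdivlMl// => h3 h4.
have h5 : c `^ g * (2 * D) <= c * Y2 by rewrite /D; lra.
rewrite le_max; apply/orP; right.
have g1 : 0 < g - 1 by have := g_gt1; lra.
have -> : c = (c `^ (g - 1)) `^ (g - 1)^-1.
  by rewrite -powRrM mulfV ?gt_eqF// powRr1// ltW.
apply: ge0_ler_powR; rewrite ?nnegrE ?powR_ge0 ?invr_ge0 ?(ltW g1)//.
  by rewrite divr_ge0//; lra.
rewrite ler_pdivlMr; last lra.
by rewrite -(ler_pM2r c0) mulrAC -gn (mulrC Y2).
Qed.

(** The coefficient 1/4 leaves half of the term [X / 2] of [J], so at mass 1 [J] is bounded below by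
    [- C1 (1 + Y)]. *)
Let S_GN1 : exists2 C1 : R, 0 <= C1 & forall X Y P, S 1 X Y P ->
  p^-1 * P <= 4^-1 * X + C1 * (1 + Y).
Proof.
have [C C0 H] := S_GN.
have p0 : 0 < p by have := p2; lra.
pose T := p / (4 * (C * 2 `^ (2 / N%:R))).
have T0 : 0 < T by rewrite !(divr_gt0, mulr_gt0)// powR_gt0.
exists (p^-1 * T `^ (- r)); first by rewrite mulr_ge0// ?invr_ge0 ?ltW ?powR_gt0.
move=> X Y P SY; have [_ X0 Y0 _] := S_ge0 SY.
pose y := 1 + Y; have y1 : 1 <= y by rewrite /y; lra.
have y0 : 0 < y by lra.
have yN0 : 0 < y `^ N%:R^-1 by rewrite powR_gt0.
(* With [y = 1 + Y], the weight [sqrt y] bounds the bracket of the inequality by [2 sqrt y].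
   Dividing [T] by [y ^ (1 / N)] cancels its power, and [T] is such that the coefficient of [X]
   becomes [p / 4]. The other term costs [y ^ (r / N) <= y]. *)
have := H _ _ _ _ SY (T / y `^ N%:R^-1) (Num.sqrt y).
rewrite divr_gt0// => /(_ isT).
have sy1 : 1 <= Num.sqrt y by rewrite -{1}sqrtr1 ler_sqrt// ltW.
move=> /(_ sy1); rewrite !mulr1 => h.
have h1 : (Num.sqrt y + (Num.sqrt y)^-1 * Y) `^ (2 / N%:R) <=
    2 `^ (2 / N%:R) * y `^ N%:R^-1.
  have e2 : y `^ N%:R^-1 = (Num.sqrt y) `^ (2 / N%:R).
    by rewrite -powR12_sqrt ?ltW// -powRrM mulrA mulVf// mul1r.
  rewrite e2 -powRM ?sqrtr_ge0//.
  apply: ge0_ler_powR; rewrite ?nnegrE.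
  - by rewrite divr_ge0// ltW.
  - by rewrite addr_ge0 ?mulr_ge0 ?invr_ge0 ?sqrtr_ge0.
  - by rewrite mulr_ge0 ?sqrtr_ge0.
  rewrite mulr2n mulrDl mul1r lerD2l mulrC ler_pdivrMr; last lra.
  by rewrite -expr2 sqr_sqrtr ?ltW// /y; lra.
have h2 : (T / y `^ N%:R^-1) `^ (- r) <= T `^ (- r) * y.
  rewrite powRM ?invr_ge0 ?(ltW T0) ?(ltW yN0)// ler_pM2l ?powR_gt0//.
  rewrite -powR_inv1 ?(ltW yN0)// -!powRrM.
  rewrite -[leRHS](powRr1 (ltW y0)); apply: ler_powR => //.
  rewrite mulN1r opprK mulrC; exact: (proj2 rN).
have h3 : T / y `^ N%:R^-1 * (C * (Num.sqrt y + (Num.sqrt y)^-1 * Y) `^ (2 / N%:R) * X)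
   <= p / 4 * X.
  rewrite mulrA; apply: ler_wpM2r => //.
  apply: (@le_trans _ _ (T / y `^ N%:R^-1 * (C * (2 `^ (2 / N%:R) * y `^ N%:R^-1)))).
    apply: ler_wpM2l; first by rewrite divr_ge0// ltW.
    by apply: ler_wpM2l => //; rewrite ltW.
  have z0 : 0 < 2 `^ (2 / N%:R) :> R by rewrite powR_gt0.
  rewrite /T le_eqVlt; apply/orP; left; apply/eqP.
  by field; rewrite !gt_eqF.
rewrite -(ler_pM2l p0) mulrA mulfV ?gt_eqF// mul1r.
apply: (le_trans h); apply: (le_trans (lerD h2 h3)).
rewrite le_eqVlt; apply/orP; left; apply/eqP; rewrite -/y.
by field; rewrite gt_eqF.
Qed.

(** The multiplier [- (|J| + 1) / M] makes [J + w M] negative. A slice of mass 0 would have [P' = 0]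
    and hence a nonnegative left-hand side, so the slice has positive mass and can be scaled to mass
    1. *)
Let S_flat1 (M : R) X Y P : S M X Y P -> 0 < M -> exists X' P', S 1 X' 0 P'.
Proof.
move=> SM M0; have [C C0 H] := S_slice.
have [M' [X' [P' [S' J' _ _]]]] := H _ _ _ _ (- (`|J X P| + 1) / M) SM M0.
have [M'0 X'0 _ _] := S_ge0 S'.
have : 0 < M'.
  rewrite lt_neqAle M'0 andbT eq_sym; apply/eqP => M'E.
  move: S' J'; rewrite M'E => S'; rewrite (S_mass0 S') mulr0 mulr0 divfK ?gt_eqF//.
  have := ler_norm (J X P); lra.
move=> M'p; have c0 : 0 < M'^-1 by rewrite invr_gt0.
by have := S_scale S' c0; rewrite mulVf ?gt_eqF// mulr0 => ?; do 2 eexists; eassumption.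
Qed.

(* At mass 1 the term in [Y] gets the weight [K = mu ^ (1 - g)]. The multiplier [- g J]
   makes [J (1 + g t)] the bound for a slice extension of mass [1 + t], so that
   bringing it back to mass 1 costs only [O(t ^ 2) = O(Y)]; minimality then bounds [K]. *)
Let gs_bounded_below : exists2 b : R, 0 < b &
  forall (mu : R) X Y P, 0 < mu -> gs mu X Y P -> 0 < Y -> b <= mu.
Proof.
have [[m1 [X1 [Y1 [P1 [m10 S1]]]]]|H] :=
    pselect (exists m X Y P, 0 < m /\ S m X Y P); last first.
  exists 1 => // mu X Y P mu0 [Sm _] _; exfalso; apply: H.
  by exists mu, X, Y, P.
have [Xr [Pr Sr]] := S_flat1 S1 m10.
(* The value of one fixed flat function of mass 1, which bounds [J + K Y / 2] for the rescaled
   ground state. *)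
set C0 := J Xr Pr.
have [C1 C10 HGN] := S_GN1.
have [C Cp H] := S_slice.
pose D : R := `|C0| + C1.
have D0 : 0 <= D by rewrite addr_ge0.
pose C2 : R := `|C0| + C1 + D.
have C20 : 0 <= C2 by rewrite !addr_ge0.
have g1 := g_gt1.
(* One term per use of [K0 < K]: absorbing [C1 Y] into [K Y / 4], making [g |t| <= 1 / 2], and the
   final contradiction. *)
pose K0 : R := 4 * C1 + 16 * C ^+ 2 * D * (4 * g ^+ 2) + 16 * C2 * g ^+ 2 * C ^+ 2 + 1.
have CC0 : 0 <= C ^+ 2 by rewrite sqr_ge0.
have gg0 : 0 <= g ^+ 2 by rewrite sqr_ge0.
have k1 : 0 <= 4 * C1 by rewrite mulr_ge0.
have k2 : 0 <= 16 * C ^+ 2 * D * (4 * g ^+ 2) by do ![apply: mulr_ge0 => //].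
have k3 : 0 <= 16 * C2 * g ^+ 2 * C ^+ 2 by do ![apply: mulr_ge0 => //].
have K00 : 0 < K0 by rewrite /K0; lra.
have K1 : 4 * C1 <= K0 by rewrite /K0; lra.
have K2 : 16 * C ^+ 2 * D * (4 * g ^+ 2) <= K0 by rewrite /K0; lra.
have K3 : 16 * C2 * g ^+ 2 * C ^+ 2 < K0 by rewrite /K0; lra.
have gm1 : 0 < g - 1 by lra.
(* The mass at which [K = K0]; smaller masses have larger [K]. *)
exists (K0 `^ (- (g - 1)^-1)); first by rewrite powR_gt0.
move=> mu X0 Y0 P0 mu0 gmu Y0p.
have c0 : 0 < mu^-1 by rewrite invr_gt0.
have Su := proj1 gmu.
have := S_scale Su c0; rewrite mulVf ?gt_eqF//.
set X := _ * X0; set Y := _ * Y0; set P := _ * P0 => Sv.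
have Yp : 0 < Y by rewrite mulr_gt0.
pose K := mu `^ (1 - g).
have Kp : 0 < K by rewrite powR_gt0.
(* Minimality of the ground state, rescaled to mass 1 and tested on flat functions. *)
have HK X' P' : S 1 X' 0 P' -> J X P + 2^-1 * (K * Y) <= J X' P'.
  move=> /S_scale => /(_ mu mu0); rewrite !mulr1 mulr0.
  have [_ h] := gmu => /h; rewrite mulr0 addr0 => h'.
  have mg0 : 0 < mu `^ g by rewrite powR_gt0.
  rewrite -(ler_pM2l mg0); apply: le_trans (le_trans h' _); last lra.
  have e1 : mu `^ g * X = X0.
    rewrite /X mulrA powR_invE ?(ltW mu0)// mulfV ?mul1r// gt_eqF//.
  have e2 : mu `^ g * P = P0.
    rewrite /P mulrA powR_invE ?(ltW mu0)// mulfV ?mul1r// gt_eqF//.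
  have e3 : mu `^ g * (K * Y) = Y0.
    rewrite mulrA /K -powRD; last by rewrite [mu == 0]gt_eqF// implybT.
    by rewrite addrC subrK powRr1 ?ltW// /Y mulrA mulfV ?mul1r// gt_eqF.
  rewrite -e1 -e2 -e3 le_eqVlt; apply/orP; left; apply/eqP; ring.
rewrite leNgt; apply/negP => muK0.
have KK0 : K0 < K.
  have -> : K = (mu^-1) `^ (g - 1) by rewrite powR_invE ?(ltW mu0)// -powRN opprB.
  have -> : K0 = (K0 `^ (g - 1)^-1) `^ (g - 1).
    by rewrite -powRrM mulVf ?gt_eqF// powRr1// ltW.
  apply: gt0_ltr_powR; rewrite ?nnegrE ?powR_ge0 ?(ltW c0)//.
  by rewrite -[X in X < _]invrK ltf_pV2 ?posrE ?invr_gt0 ?powR_gt0// -powRN.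
have hJ := HK _ _ Sr; rewrite -/C0 in hJ.
have [_ Xp _ _] := S_ge0 Sv.
have hGN := HGN _ _ _ Sv.
have KC1 := le_trans K1 (ltW KK0).
have C0n := ler_norm C0.
(* From [K Y / 2 <= C0 - J] and [- J <= C1 (1 + Y)], with [C1 Y] absorbed by [K Y / 4]. *)
have KY : K * Y <= 4 * D by rewrite /D; nra.
have JC2 : - J X P <= C2.
  have CY : 4 * C1 * Y <= K * Y by rewrite ler_pM2r.
  have C0p := normr_ge0 C0; rewrite /C2; lra.
have [M' [X' [P' [S' J' M'P _]]]] := H _ _ _ _ (- g * J X P) Sv ltr01.
have sY0 : 0 < Num.sqrt Y by rewrite sqrtr_gt0.
(* The weight [sqrt Y] minimizes the bound at mass 1 and gives [|t| <= 2 C sqrt Y]. *)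
have := M'P _ sY0; set t := M' - 1 => ht.
have tY : t ^+ 2 <= 4 * C ^+ 2 * Y.
  have ht2 : `|t| <= 2 * C * Num.sqrt Y.
    apply: (le_trans ht).
    have -> : (Num.sqrt Y)^-1 * Y = Num.sqrt Y.
      by rewrite -[X in _ * X](sqr_sqrtr (ltW Yp)) expr2 mulKf ?gt_eqF.
    lra.
  rewrite -real_normK ?num_real// -[X in _ * X](sqr_sqrtr (ltW Yp)).
  rewrite (_ : 4 * _ * _ = (2 * C * Num.sqrt Y) ^+ 2); last by ring.
  by rewrite ler_sqr ?nnegrE// !mulr_ge0// ltW.
have tsmall : g * `|t| <= 2^-1.
  have Kb := le_trans K2 (ltW KK0).
  have Kt : K * t ^+ 2 <= 16 * C ^+ 2 * D.
    apply: (@le_trans _ _ (K * (4 * C ^+ 2 * Y))); first by rewrite ler_pM2l.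
    have := ler_wpM2l CC0 KY; lra.
  have gKt := ler_wpM2l gg0 Kt.
  have gt4 : (g * `|t|) ^+ 2 <= 4^-1.
    by rewrite exprMn real_normK ?num_real// -(ler_pM2l Kp); lra.
  rewrite leNgt; apply/negP => h; nra.
have /andP[r1 r2] := inv_bernoulli_powR g1 tsmall.
set rho := (1 + g * t) / _ in r1 r2.
have tpos : 0 < 1 + t.
  have : `|t| <= 2^-1 by have := normr_ge0 t; nra.
  rewrite ler_norml => /andP[]; lra.
have M'E : M' = 1 + t by rewrite /t addrC subrK.
have M'i : 0 < M'^-1 by rewrite invr_gt0 M'E.
have := S_scale S' M'i; rewrite mulVf ?gt_eqF ?M'E// mulr0 => /HK.
rewrite powR_invE ?(ltW tpos)//.
set m := ((1 + t) `^ g)^-1 => h1.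
have m0 : 0 < m by rewrite invr_gt0 powR_gt0.
(* The choice of [w] gives [J' <= J (1 + g t)], and scaling back to mass 1 divides by
   [(1 + t) ^ g]. *)
have h2 : J X P + 2^-1 * (K * Y) <= J X P * rho.
  apply: (le_trans h1).
  have -> : J (m * X') (m * P') = m * J X' P' by ring.
  apply: (@le_trans _ _ (m * (J X P + - g * J X P * (1 - M')))).
    by rewrite ler_pM2l//; lra.
  by rewrite /rho -/m M'E le_eqVlt; apply/orP; left; apply/eqP; ring.
have h3 : 2^-1 * (K * Y) <= C2 * (1 - rho).
  apply: (@le_trans _ _ (- J X P * (1 - rho))); first lra.
  by apply: ler_wpM2r => //; lra.
have h4 : C2 * (1 - rho) <= C2 * (2 * g ^+ 2 * (4 * C ^+ 2 * Y)).
  apply: ler_wpM2l => //; apply: (@le_trans _ _ (2 * g ^+ 2 * t ^+ 2)); first lra.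
  by apply: ler_wpM2l => //; rewrite mulr_ge0.
have h5 : K <= 16 * C2 * g ^+ 2 * C ^+ 2.
  rewrite -(ler_pM2r Yp); lra.
by move: (lt_trans K3 KK0); rewrite ltNge h5.
Qed.

(** The threshold is the infimum of the masses with a non-flat ground state. Above it some smaller
    mass has a non-flat ground state, so by [gs_separated] a ground state cannot be flat. *)
Lemma mass_threshold : exists mu2 : R, 0 < mu2 /\
  forall (mu : R) X Y P, 0 < mu -> S mu X Y P ->
    (forall X' Y' P', S mu X' Y' P' ->
       J X P + 2^-1 * Y <= J X' P' + 2^-1 * Y') ->
  (mu < mu2 -> Y = 0) /\ (mu2 < mu -> Y <> 0).
Proof.
have [b b0 Hb] := gs_bounded_below.
have [B HB] := gs0_bounded.
pose Bs := [set m : R | 0 < m /\ exists X Y P : R, 0 < Y /\ gs m X Y P].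
have [[m0 Bm0]|nB] := pselect (Bs !=set0).
- have lbB : lbound Bs b.
    by move=> m [mp [X [Y [P [Yp gm]]]]]; exact: Hb gm Yp.
  have infB : has_inf Bs by split; [exists m0|exists b].
  exists (inf Bs); split.
    by apply: (lt_le_trans b0); apply: lb_le_inf => //; exists m0.
  move=> mu X Y P mup Smu gmu; have [_ _ Y0 _] := S_ge0 Smu; split.
    move=> lt; apply/eqP; rewrite eq_le Y0 andbT leNgt; apply/negP => Yp.
    have : inf Bs <= mu.
      apply: inf_lbound; first by exists b.
      by split=> //; exists X, Y, P; split.
    lra.
  move=> lt YE; subst Y.
  have [x [xp [X' [Y' [P' [Y'p gx]]]]] xmu] := inf_lt (ex_intro _ m0 Bm0 : Bs !=set0) lt.
  by have := gs_separated xp gx Y'p (conj Smu gmu); lra.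
(* All ground states are flat here, so beyond the bound [B] there is none at all; the 1 ensures
   positivity. *)
- exists (Num.max 1 (B + 1)); split; first by rewrite lt_max ltr01.
  move=> mu X Y P mup Smu gmu; have [_ _ Y0 _] := S_ge0 Smu; split.
    move=> _; apply/eqP; rewrite eq_le Y0 andbT leNgt; apply/negP => Yp.
    by apply: nB; exists mu; split => //; exists X, Y, P; split.
  rewrite gt_max => /andP[_ lt] YE; subst Y.
  by have := HB _ _ _ mup (conj Smu gmu); lra.
Qed.

End threshold.

(** * Ground states *)

Section ground_states.
Context {R : realType} (N : nat) (G : metric_graph R).
Implicit Type u : H1 N G.

Lemma dy_zeroP u : dy_zero u <-> normsq_dy u = 0%E.
Proof.
have sqe e : sob_dy (u e) = cst 0 %[ae strip N (len e)] <->
    sqint (strip N (len e)) (sob_dy (u e)) = 0%E.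
  have my := Lfun2_measurable (sob_dy_L2 (u e)).
  have msq := measurable_sqr my.
  have E : (\int[strip N (len e)]_z `|(sob_dy (u e) z ^+ 2)%:E| =
      sqint (strip N (len e)) (sob_dy (u e)))%E.
    by apply: eq_integral => z _; rewrite gee0_abs// lee_fin sqr_ge0.
  rewrite -E; rewrite (ae_eq_integral_abs _ measurableT msq).
  have FF : Filter (nbhs (almost_everywhere (strip N (len e)))).
    exact: ae_filter_ringOfSetsType.
  split; apply: filterS => z.
    by move=> /(_ I) /= ->; rewrite expr0n.
  by move=> /(_ I) [] /= /eqP; rewrite sqrf_eq0 => /eqP -> _.
rewrite normsq_dyE; split => [u0|].
  by apply: big1 => e _; apply/sqe; exact: u0.
move=> sum0 e; apply/sqe/le_anti; rewrite sqint_ge0 andbT -sum0 (bigD1 e)//= leeDl//.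
by apply: sume_ge0 => i _; exact: sqint_ge0.
Qed.

Lemma energy_EFin p u X Y P : normsq_dx u = X%:E -> normsq_dy u = Y%:E ->
  norm_pow u p = P%:E -> energy p u = (2^-1 * X - p^-1 * P + 2^-1 * Y)%:E.
Proof.
move=> uX uY uP; rewrite /energy uX uY uP.
by transitivity (2^-1 * X + 2^-1 * Y - p^-1 * P)%:E => //; rewrite addrAC.
Qed.

End ground_states.

Theorem theorem1p2 (R : realType) (G : metric_graph R) (N : nat) (p : R) :
  (1 <= N)%N -> 2 < p -> p <= 2 + 4 / (N + 1)%:R ->
  exists mu2 : R, 0 < mu2 /\
    forall (mu : R), 0 < mu ->
    forall u : H1 N G, ground_state p mu u ->
      (mu < mu2 -> dy_zero u) /\ (mu2 < mu -> ~ dy_zero u).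
Proof.
case: N => [//|n] N1 p2 pN; have p0 : p != 0 by rewrite gt_eqF// (lt_trans _ p2).
have pq : p < 2 + 4 / n.+1%:R.
  apply: (le_lt_trans pN); rewrite ltrD2l ltr_pM2l// ltf_pV2 ?posrE//.
  by rewrite ltr_nat addn1.
have [mu2 [mu20 H]] := mass_threshold N1 p2 pN (@realized_ge0 R n.+1 G p)
  (fun X Y P => @realized_mass0 R n.+1 G p X Y P p0)
  (fun M X Y P a c => @realized_dilation R n.+1 G p M X Y P a c p0)
  (realized_gn G p2 pq) (realized_slice n.+1 G p2).
exists mu2; split => // mu mu0 u [uM umin].
pose X := fine (normsq_dx u); pose Y := fine (normsq_dy u); pose P := fine (norm_pow u p).
have uX : normsq_dx u = X%:E by rewrite fineK// normsq_dx_fin.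
have uY : normsq_dy u = Y%:E by rewrite fineK// normsq_dy_fin.
have Y0 : 0 <= Y by rewrite fine_ge0// normsq_dy_ge0.
(* Finiteness of the p-norm comes from Gagliardo-Nirenberg with both parameters equal to 1. *)
have uP : norm_pow u p = P%:E.
  have [C _ HC] := norm_pow_gn G p2 pq; rewrite fineK// ge0_fin_numE ?norm_pow_ge0//.
  by apply: le_lt_trans (HC u _ _ _ uM uX uY mu0 Y0 1 1 ltr01 (lexx 1)) _; rewrite ltry.
have Su : realized n.+1 G p mu X Y P by exists u.
have [X' Y' P' [v [vM vX vY vP]]|lo hi] := H mu X Y P mu0 Su.
  by rewrite -lee_fin -(energy_EFin uX uY uP) -(energy_EFin vX vY vP); exact: umin.
split => [/lo Y_0|/hi Yn0]; first by apply/dy_zeroP; rewrite uY Y_0.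
by move/dy_zeroP; rewrite uY => -[].
Qed.
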